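(* Let $X$ be the Segerdahl process with $r=1$, $c=0$ and exponential jumps of rate $\mu=1$, i.e. $dX_t=X_t\,dt-d\big(\sum_{i=1}^{N_t}C_i\big)$, where $N$ is a Poisson process of rate $\lambda>0$ and the $C_i$ are i.i.d. exponential of mean $1$, independent of $N$. Let $q\ge0$ and $n=q+\lambda$. With $M$, $U$, $K_1$, $K_2$, $T_{a,-}$, $T_{b,+}$, $H_q$ as in the context, the following hold. 1. Up to a multiplicative constant, $$H_q(z)=K_1(q,n,z)=z^ne^{-z}M(q+1,n+1,z)=z^nM(\lambda,n+1,-z),$$ where $K_1$ is the unique (up to a constant) $q$-harmonic function which increases on $(0,\infty)$. 2. The ruin function $\Psi_q(z,a)=\mathbb E_z[e^{-qT_{a,-}}]$ is $$\Psi_q(z,a)=\lambda\,\frac{K_2(q,n,z)}{K_2(q,n+1,a)}=\lambda\,\frac{e^{-z}z^nU(q+1,n+1,z)}{e^{-a}a^{n+1}U(q+1,n+2,a)},\qquad z\ge a>0,$$ and, for $a=0$ (using $\lim_{z\to0}z^{q+1+\lambda}U(1+q,q+2+\lambda,z)=\Gamma(1+q+\lambda)/\Gamma(1+q)$), $$\Psi_q(z,0)=\frac{\lambda\,\Gamma(1+q)}{\Gamma(1+q+\lambda)}\,e^{-z}z^nU(q+1,n+1,z).$$ 3. $$\Psi_q(z,a,\theta):=\mathbb E_z\big[e^{-qT_{a,-}+\theta(X_{T_{a,-}}-a)}\big]=\Psi_q(z,a)\,\frac{1}{1+\theta}.$$ 4. For $z\ge a>0$, the scale function (i.e. the function with $\mathbb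 E_z[e^{-qT_{b,+}};T_{b,+}<T_{a,-}]=W_q(z,a)/W_q(b,a)$ for $a\le z\le b$) is given by $$\begin{aligned}W_q(z,a)&=H_q(z)-\Psi_q(z,a)\int_0^ae^{-y}H_q(a-y)\,dy=K_1(q,n,z)-\Psi_q(z,a)\frac{K_1(q,n+1,a)}{n+1}\\&=K_1(q,n,z)-\frac{\lambda}{n+1}\,\frac{K_1(q,n+1,a)}{K_2(q,n+1,a)}\,K_2(q,n,z)\\&=z^ne^{-z}\Big[M(q+1,n+1,z)-\frac{\lambda}{n+1}U(q+1,n+1,z)\frac{M(q+1,n+2,a)}{U(q+1,n+2,a)}\Big].\end{aligned}$$ Since it is only determined up to a constant (a factor not depending on $z$), one may also take $$\begin{aligned}W_q(z,a)&=z^ne^{-z}\begin{vmatrix}M(1+q,\lambda+1+q,z)&M(1+q,\lambda+2+q,a)\\ \lambda\,U(1+q,\lambda+1+q,z)&(\lambda+1+q)\,U(1+q,\lambda+2+q,a)\end{vmatrix}\\&=z^ne^{-z}\big[(\lambda+q+1)M(q+1,n+1,z)U(q+1,n+2,a)-\lambda\,U(q+1,n+1,z)M(q+1,n+2,a)\big].\end{aligned}$$ The second derivative in $z$ (for the first normalization) is $$W_q''(z,a)=K_1''(q,n,z)-\frac{\lambda}{n+1}\frac{K_1(q,n+1,a)}{K_2(q,n+1,a)}K_2''(q,n,z),$$ which implies, at $z=a$, $$\begin{aligned}\frac{e^{a}a^{-n+2}}{\Gamma(n)}\,W_q''(a,a)={}&\frac{{}_1\tilde F_1(q+1;n+2;a)}{n+1}\left(\frac{\lambda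 n\,(an-aq-n^2+n)\,U(q+1,n+1,a)}{U(q+1,n+2,a)}+a(a-n+1)\big((n+1)(n-q)-\lambda n\big)\right)\\&+\big(-(a+1)n+aq+n^2\big)\,{}_1\tilde F_1(q+1;n+1;a),\end{aligned}$$ and it satisfies $$W_q''(0,0)=\frac{(n-1)\,n\left(1-\dfrac{\lambda n\,U(q+1,n+1,0)}{(n+1)^2\,U(q+1,n+2,0)}\right)}{\Gamma(n+1)}<0\quad\text{if and only if}\quad q+\lambda<1 .$$ 5. The two-sided ruin function $\Psi_q^b(z,a)=\mathbb E_z[e^{-qT_{a,-}};T_{a,-}<T_{b,+}]$, $0<a\le z\le b$, $a<b$, satisfies $$\begin{aligned}\Psi_q^b(z,a)&=\Psi_q(z,a)-\frac{W_q(z,a)}{W_q(b,a)}\Psi_q(b,a)\\&=\frac{\lambda}{a}\frac{e^{-z}z^nU(q+1,n+1,z)}{e^{-a}a^nU(q+1,n+2,a)}-\frac{\lambda}{a}\frac{e^{-b}b^nU(q+1,n+1,b)}{e^{-a}a^nU(q+1,n+2,a)}\Big(\frac zb\Big)^ne^{b-z}\,\frac{D(z)}{D(b)},\end{aligned}$$ where $D(u)=(\lambda+q+1)M(q+1,n+1,u)U(q+1,n+2,a)-\lambda\,U(q+1,n+1,u)M(q+1,n+2,a)$.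
   Context: First passage times: $T_{b,+}=\inf\{t\ge0:X_t>b\}$ and $T_{a,-}=\inf\{t\ge0:X_t<a\}$, with $\inf\emptyset=\infty$ and $e^{-q\cdot\infty}:=0$ (also for $q=0$; expectations involving $X_{T_{a,-}}$ are restricted to $T_{a,-}<\infty$). $\mathbb E_z$ denotes expectation with $X_0=z$. For this process $0$ is the absolute ruin level: once below $0$ the process never returns above $0$. $H_q$ is the function on $(0,\infty)$, determined up to a multiplicative constant, with $\mathbb E_z[e^{-qT_{b,+}};T_{b,+}<T_{0,-}]=H_q(z)/H_q(b)$ for $0<z\le b$. A function $h$ on $(0,\infty)$ is $q$-harmonic (for the process absorbed below $0$) if $z h'(z)+\lambda\int_0^zh(z-y)e^{-y}\,dy-(\lambda+q)h(z)=0$, $z>0$. Special functions: $M(\alpha,\beta,z)={}_1F_1(\alpha;\beta;z)$ is Kummer's confluent hypergeometric function; ${}_1\tilde F_1(\alpha;\beta;z)=M(\alpha,\beta,z)/\Gamma(\beta)$ is its regularized version; $U(\alpha,\beta,z)=\frac1{\Gamma(\alpha)}\int_0^\infty e^{-zt}t^{\alpha-1}(1+t)^{\beta-\alpha-1}dt$ ($z>0$, $\alpha>0$) is Tricomi's function. A ratio of two $U$ functions at argument $0$ is understood as the limit of the ratio as the argument decreases to $0$. For parameters $q,m$ set $$K_1(q,m,z)=z^me^{-z}M(q+1,m+1,z),\qquad K_2(q,m,z)=z^me^{-z}U(q+1,m+1,z).$$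
   Formalization: In the display for W''(a,a), Γ(n) is replaced by Γ(n+1) and both λn on the right by λ(n+1); W''(0,0) is read as the limit, as a decreases to 0, of e^a a^{2-n} W''(a,a)/Γ(n+1); item 3 is for θ>-1, 0≤a≤z; Ψ_q(z,0) is for z>0. *)

(* Defs.v *)
From HB Require Import structures.
From mathcomp Require Import all_boot all_order all_algebra finmap.
From mathcomp Require Import all_classical all_reals all_analysis.

Set Implicit Arguments.
Unset Strict Implicit.
Unset Printing Implicit Defensive.
Import Order.TTheory GRing.Theory Num.Theory.
Import numFieldNormedType.Exports.
Local Open Scope classical_set_scope.
Local Open Scope ring_scope.

Section SpecialFunctions.
Context {R : realType}.
Implicit Types (x z alpha beta q m lam a u : R).

Definition Gamma x : R :=
  \int[lebesgue_measure]_(t in `]0, +oo[) (t `^ (x - 1) * expR (- t)).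

Definition pochhammer x (k : nat) : R := \prod_(i < k) (x + i%:R).

Definition KummerM alpha beta z : R :=
  limn (series (fun k => pochhammer alpha k / pochhammer beta k
                         * (z ^+ k / (k`!)%:R))).

Definition KummerM_reg alpha beta z : R := KummerM alpha beta z / Gamma beta.

(* Only used for 0 < alpha and 0 < z, where the integral converges. *)
Definition TricomiU alpha beta z : R :=
  (Gamma alpha)^-1 *
  \int[lebesgue_measure]_(t in `]0, +oo[)
     (expR (- (z * t)) * t `^ (alpha - 1) * (1 + t) `^ (beta - alpha - 1)).

Definition K1 q m z : R := z `^ m * expR (- z) * KummerM (q + 1) (m + 1) z.
Definition K2 q m z : R := z `^ m * expR (- z) * TricomiU (q + 1) (m + 1) z.

(* First normalization of the scale function with lower barrier [a], as an
   explicit function on all of (0, +oo), so that it can be differentiated at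
   z = a. *)
Definition W_closed q lam a z : R :=
  let n := q + lam in
  K1 q n z - lam / (n + 1) * (K1 q (n + 1) a / K2 q (n + 1) a) * K2 q n z.

Definition mx2 (a11 a12 a21 a22 : R) : 'M[R]_2 :=
  \matrix_(i < 2, j < 2)
    nth 0 (nth [::] [:: [:: a11; a12]; [:: a21; a22]] i) j.

Definition W_det q lam a z : R :=
  let n := q + lam in
  z `^ n * expR (- z) *
  \det (mx2 (KummerM (1 + q) (lam + 1 + q) z)
            (KummerM (1 + q) (lam + 2 + q) a)
            (lam * TricomiU (1 + q) (lam + 1 + q) z)
            ((lam + 1 + q) * TricomiU (1 + q) (lam + 2 + q) a)).

Definition D_fun q lam a u : R :=
  let n := q + lam in
  (lam + q + 1) * KummerM (q + 1) (n + 1) u * TricomiU (q + 1) (n + 2) a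
  - lam * TricomiU (q + 1) (n + 1) u * KummerM (q + 1) (n + 2) a.

Definition twice_derivable (f : R -> R) z : Prop :=
  (\forall x \near z, derivable f x 1) /\ derivable (derive1 f) z 1.

Definition increasing_on_pos (h : R -> R) : Prop :=
  {in `]0, +oo[ &, {homo h : x y / x < y}}.

Definition q_harmonic lam q (h : R -> R) : Prop :=
  forall z, 0 < z ->
  [/\ derivable h z 1,
      lebesgue_measure.-integrable `]0, z[
        (fun y => (h (z - y) * expR (- y))%:E) &
      z * derive1 h z
      + lam * \int[lebesgue_measure]_(y in `]0, z[) (h (z - y) * expR (- y))
      - (lam + q) * h z = 0].

End SpecialFunctions.

Section Process.
Context {R : realType} {d : measure_display} {T : measurableType d}.
Variable P : probability T R.

Definition mutual_independence (I : choiceType) (F : I -> set (set T)) : Prop :=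
  forall (J : {fset I}) (A : I -> set T),
    (forall i, i \in J -> F i (A i)) ->
    fine (P (\bigcap_(i in [set` J]) A i)) = \prod_(i <- J) fine (P (A i)).

Definition exponential_law (rate : R) (Y : {RV P >-> R}) : Prop :=
  forall B : set R, measurable B -> distribution P Y B = exponential_prob rate B.

(* Renewal definition: the interarrival times [tau 0, tau 1, ...] are i.i.d.
   exponential and [N t] is the number of k >= 1 such that the k-th arrival time
   [tau 0 + ... + tau (k - 1)] is at most [t]. *)
Definition poisson_process (rate : R) (N : R -> T -> nat) : Prop :=
  exists tau : nat -> {RV P >-> R},
    [/\ forall i, exponential_law rate (tau i),
        mutual_independence
          (fun i => preimage_set_system setT (tau i) measurable) &
        forall (t : R) (w : T) (k : nat), 0 <= t ->
          (k <= N t w)%N = (\sum_(i < k) tau i w <= t)].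

Definition process_sigma_algebra (N : R -> T -> nat) : set (set T) :=
  <<s \bigcup_(t in `[0, +oo[) preimage_set_system setT (N t) measurable >>.

(* The variables [C 0, C 1, ...] are mutually independent and the sequence is
   independent of the whole process [N]. *)
Definition independent_marks (N : R -> T -> nat) (C : nat -> {RV P >-> R}) :
    Prop :=
  mutual_independence (fun o : option nat =>
    if o is Some i then preimage_set_system setT (C i) measurable
    else process_sigma_algebra N).

Definition compound (N : R -> T -> nat) (C : nat -> {RV P >-> R}) (t : R)
    (w : T) : R := \sum_(i < N t w) C i w.

End Process.

(* dx = (c + r x) dt - dS in integrated form, started at [z]; only the values
   at times t >= 0 matter. *)
Definition segerdahl_path {R : realType} (c r : R) (S : R -> R) (z : R)
    (x : R -> R) : Prop :=
  forall t : R, 0 <= t ->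
    lebesgue_measure.-integrable `[0, t] (EFin \o x) /\
    x t = z + \int[lebesgue_measure]_(s in `[0, t]) (c + r * x s) - S t.

Section Passage.
Context {R : realType}.

Definition passage_above (b : R) (x : R -> R) : \bar R :=
  ereal_inf [set t%:E | t in [set t | 0 <= t /\ b < x t]].
Definition passage_below (a : R) (x : R -> R) : \bar R :=
  ereal_inf [set t%:E | t in [set t | 0 <= t /\ x t < a]].

Definition discount (q : R) (tau : \bar R) : R :=
  if tau is t%:E then expR (- (q * t)) else 0.

End Passage.

(* [X z t w] is the position at time [t] of the process started at [z], so that
   the expectation E_z of a functional of the path is its expectation under [P]
   along [X z]. *)
Section Functionals.
Context {R : realType} {d : measure_display} {T : measurableType d}.
Variables (P : probability T R) (X : R -> R -> T -> R) (q : R).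
Implicit Types (z a b theta : R).

Let path z (w : T) : R -> R := fun t => X z t w.

Definition upcross a b z : \bar R :=
  'E_P[fun w => let Tb := passage_above b (path z w) in
                let Ta := passage_below a (path z w) in
                discount q Tb * ((Tb < Ta)%E)%:R].

Definition Psi z a : \bar R :=
  'E_P[fun w => discount q (passage_below a (path z w))].

Definition Psi_theta z a theta : \bar R :=
  'E_P[fun w => if passage_below a (path z w) is t%:E
                then expR (- (q * t) + theta * (X z t w - a)) else 0].

Definition Psi_two_sided b z a : \bar R :=
  'E_P[fun w => let Tb := passage_above b (path z w) in
                let Ta := passage_below a (path z w) in
                discount q Ta * ((Ta < Tb)%E)%:R].

(* At z = b the left-hand side is 1, which forces [H b != 0]. *)
Definition is_H (H : R -> R) : Prop :=
  forall z b, 0 < z -> z <= b -> upcross 0 b z = (H z / H b)%:E.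

Definition is_scale a (W : R -> R) : Prop :=
  forall z b, a <= z -> z <= b -> upcross a b z = (W z / W b)%:E.

Definition W_of (H : R -> R) a z : R :=
  H z - fine (Psi z a) *
        \int[lebesgue_measure]_(y in `]0, a[) (expR (- y) * H (a - y)).

End Functionals.

(* Main.v *)
Require Import Defs.
From HB Require Import structures.
From mathcomp Require Import all_boot all_order all_algebra finmap.
From mathcomp Require Import all_classical all_reals all_analysis.
From mathcomp Require Import measurable_realfun ring lra.
Import Order.TTheory GRing.Theory Num.Theory.
Import numFieldNormedType.Exports.
Local Open Scope classical_set_scope.
Local Open Scope ring_scope.

(* Between jumps the process grows like exp t, so that a path is an alternation
   of exponential holding times and exponential jumps.  Conditioning on the next
   of these shows that any nonnegative solution (h, I) of
     z h' = (q + lam) h - lam I,   I' = h - I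
   (I z stands for the integral of h (z - y) exp (- y) over the jumps that do
   not cross 0) satisfies
     h z = h b * upcross a b z + I a * Psi_two_sided b z a,
   the weight on trajectories that have not yet left [a, b] decaying
   geometrically.  Both h = K1 q n with I = K1 q (n + 1) / (n + 1) and
   h = lam K2 q n with I = K2 q (n + 1) are such solutions, and the two resulting
   linear equations determine the two passage functionals.  Letting b tend to
   infinity, where K2 vanishes, gives the ruin function; memorylessness of the
   jumps makes the overshoot exponential.  Among solutions with I (0+) = 0, K1 is
   unique up to a factor because z^(-n) exp z * I * (h - I) has the nonnegative
   derivative z^(-n) exp z * ((h - I)^2 + q I^2 / z); this also yields Kummer's
   transformation.  The companion I of the scale function vanishes at a, whence
   a^2 W''(a) = ((n - 1) n - lam a) W(a). *)

(** * Chains driven by independent variables *)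

Section ae.
Context d (T : measurableType d) (R : realType).
Variable mu : {measure set T -> \bar R}.
Local Open Scope ereal_scope.
Import HBNNSimple.

Lemma ge0_ae_eq_integral_nomeas (f g : T -> \bar R) :
  (forall x, 0 <= f x) -> (forall x, 0 <= g x) -> measurable_fun [set: T] g ->
  {ae mu, forall x, f x = g x} -> \int[mu]_x f x = \int[mu]_x g x.
Proof.
move=> f0 g0 mg fg; apply/eqP; rewrite eq_le; apply/andP; split.
  rewrite (ge0_integralTE mu f0); apply: ge_ereal_sup => /= _ [h hf <-].
  rewrite -integralT_nnsfun; apply: ae_ge0_le_integral => //.
  - by move=> x _; rewrite lee_fin.
  - exact/measurable_EFinP.
  - by apply: filterS fg => x fgx _; rewrite -fgx hf.
case: fg => N [mN N0 fgN].
have -> : \int[mu]_x g x = \int[mu]_x (g \_ (~` N)) x.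
  apply: ge0_ae_eq_integral => //.
  - apply/(measurable_restrictT _ (measurableC mN)).
    exact: measurable_funTS.
  - by move=> x _; apply: erestrict_ge0.
  - exists N; split => // x /= H; apply: contrapT => Nx; apply: H => _.
    by rewrite patchE mem_set.
rewrite (ge0_integralTE mu f0) ge0_integralTE; last first.
  by move=> x; apply: erestrict_ge0.
apply: le_ereal_sup => /= _ [h hf <-]; exists h => // x.
apply: le_trans (hf x) _; rewrite patchE; case: ifPn => // /set_mem Nx.
by rewrite (_ : g x = f x)//; apply: contrapT => H; apply: Nx; apply: fgN => /= /esym.
Qed.

End ae.

Section joint.
Context d (T : measurableType d) (R : realType) (P : probability T R).
Context dE (E : measurableType dE) dF (F : measurableType dF).
Variables (X : {mfun T >-> E}) (Y : {mfun T >-> F}).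
Local Open Scope ereal_scope.

Lemma joint_law (Q : {measure set T -> \bar R}) :
  (forall A B, measurable A -> measurable B ->
    Q (X @^-1` A `&` Y @^-1` B) = P (X @^-1` A) * P (Y @^-1` B)) ->
  forall Z, measurable Z ->
    Q ((fun w => (X w, Y w)) @^-1` Z) = (distribution P X \x distribution P Y) Z.
Proof.
move=> QAB Z mZ.
have mXY : measurable_fun [set: T] (fun w => (X w, Y w)).
  exact: measurable_fun_pair.
pose XY : {mfun T >-> (E * F)%type} := HB.pack (fun w => (X w, Y w))
  (isMeasurableFun.Build _ _ _ _ _ mXY).
rewrite (@product_measure_unique _ _ _ _ _ _ _ (pushforward Q XY))//.
Qed.

Lemma ge0_integral_indep (f : E * F -> \bar R) :
  (forall A B, measurable A -> measurable B ->
    P (X @^-1` A `&` Y @^-1` B) = P (X @^-1` A) * P (Y @^-1` B)) ->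
  measurable_fun [set: E * F] f -> (forall z, 0 <= f z) ->
  \int[P]_w f (X w, Y w) = \int[P]_w \int[distribution P Y]_v f (X w, v).
Proof.
move=> PAB mf f0.
have mXY : measurable_fun [set: T] (fun w => (X w, Y w)).
  exact: measurable_fun_pair.
pose XY : {mfun T >-> (E * F)%type} := HB.pack (fun w => (X w, Y w))
  (isMeasurableFun.Build _ _ _ _ _ mXY).
transitivity (\int[distribution P XY]_z f z).
  by rewrite ge0_integral_distribution.
rewrite (@eq_measure_integral _ _ _ _ (distribution P X \x distribution P Y)).
  rewrite fubini_tonelli1// ge0_integral_distribution//.
    exact: measurable_fun_fubini_tonelli_F.
  by move=> x; apply: integral_ge0.
by move=> A mA _; exact: joint_law.
Qed.

End joint.

Section markov.
Context d (T : measurableType d) (R : realType) (P : probability T R).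
Context dE (E : measurableType dE).
Variables (V : nat -> {RV P >-> R}) (g : nat -> E * R -> E) (s0 : E).
Hypothesis mg : forall k, measurable_fun [set: E * R] (g k).

Fixpoint chain k w : E :=
  if k is j.+1 then g j (chain j w, V j w) else s0.

Lemma measurable_chain k : measurable_fun [set: T] (chain k).
Proof.
elim: k => [|k IH] /=; first exact: measurable_cst.
apply: (measurableT_comp (mg k)); exact: measurable_fun_pair.
Qed.

Hypothesis indepV : forall k (A : nat -> set R), (forall i, measurable (A i)) ->
  fine (P (\bigcap_(i < k) (V i @^-1` A i))) =
  \prod_(i < k) fine (P (V i @^-1` A i)).

Let fut j m (B : nat -> set R) : set T :=
  [set w | forall i, (j <= i < m)%N -> B i (V i w)].

Let mV i (B : set R) : measurable B -> measurable (V i @^-1` B).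
Proof.
by move=> mB; rewrite -[X in measurable X]setTI; exact: measurable_funP.
Qed.

Let mchain k (A : set E) : measurable A -> measurable (chain k @^-1` A).
Proof.
by move=> mA; rewrite -[X in measurable X]setTI; exact: measurable_chain.
Qed.

Let mfut j m B : (forall i, measurable (B i)) -> measurable (fut j m B).
Proof.
move=> mB; rewrite (_ : fut _ _ _ =
    \bigcap_(i in [set i | (j <= i < m)%N]) (V i @^-1` B i)) //.
by apply: bigcap_measurableType => // i _; exact: mV.
Qed.

Let p (A : set T) := fine (P A).

Let pE A : measurable A -> P A = (p A)%:E.
Proof. by move=> mA; rewrite fineK// fin_num_measure. Qed.

Let futS j m B : (j < m)%N -> fut j m B = V j @^-1` B j `&` fut j.+1 m B.
Proof.
move=> jm; apply/seteqP; split=> [w Bw|w [Bj Bw] i].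
  split; first by apply: Bw; rewrite leqnn.
  by move=> i /andP[ji im]; apply: Bw; rewrite im ltnW.
rewrite leq_eqVlt => /andP[/predU1P[<-//|ji im]]; apply: Bw; exact/andP.
Qed.

Lemma chain_indep k m (A : set E) (B : nat -> set R) : measurable A ->
  (forall i, measurable (B i)) -> (k <= m)%N ->
  p (chain k @^-1` A `&` fut k m B) =
    p (chain k @^-1` A) * \prod_(k <= i < m) p (V i @^-1` B i).
Proof.
elim: k m A B => [|k IH] m A B mA mB km.
  rewrite big_mkord -indepV//.
  have -> : fut 0 m B = \bigcap_(i < m) (V i @^-1` B i) by [].
  rewrite /preimage/=; have [As0|As0] := pselect (A s0).
    rewrite (_ : [set _ | A s0] = setT) ?setTI /p; first by rewrite probability_setT mul1r.
    by apply/seteqP; split.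
  rewrite (_ : [set _ | A s0] = set0) ?set0I /p ?measure0 ?mul0r//.
  by apply/seteqP; split.
set Q := fut k.+1 m B; pose c := \prod_(k.+1 <= i < m) p (V i @^-1` B i).
have mQ : measurable Q by exact: mfut.
have rect0 (A' : set E) (B' : set R) : measurable A' -> measurable B' ->
   p (chain k @^-1` A' `&` V k @^-1` B') = p (chain k @^-1` A') * p (V k @^-1` B').
  move=> mA' mB'; have := IH _ A' (fun=> B') mA' (fun=> mB') (leqnSn k).
  rewrite big_nat1 => <-; congr (p (_ `&` _)); apply/seteqP; split=> w.
    by move=> Bw i; rewrite ltnS -eqn_leq => /eqP <-.
  by apply; rewrite !leqnn.
have rect (A' : set E) (B' : set R) : measurable A' -> measurable B' ->
   p (chain k @^-1` A' `&` V k @^-1` B' `&` Q) =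
   p (chain k @^-1` A') * p (V k @^-1` B') * c.
  move=> mA' mB'.
  have := IH _ A' (fun i => if i == k then B' else B i) mA' _ (ltnW km).
  rewrite big_ltn// eqxx mulrA => IHk.
  rewrite (_ : c = \prod_(k.+1 <= i < m) p (V i @^-1` (if i == k then B' else B i))).
    rewrite -IHk; last by move=> i; case: ifP.
    rewrite futS// eqxx -setIA; congr (p (_ `&` (_ `&` _))).
    by apply/seteqP; split=> w H i /[dup] /H + /andP[ki _]; rewrite gtn_eqF.
  by apply: eq_big_nat => i /andP[ki _]; rewrite gtn_eqF.
have pQ : p Q = c.
  have := rect setT setT measurableT measurableT.
  by rewrite !preimage_setT !setTI /p probability_setT /= !mul1r.
pose Z := g k @^-1` A.
have mZ : measurable Z by rewrite -[Z]setTI; exact: mg.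
have -> : chain k.+1 @^-1` A = (fun w => (chain k w, V k w)) @^-1` Z by [].
have mSk := measurable_chain k.
pose S : {mfun T >-> E} := HB.pack (chain k)
  (isMeasurableFun.Build _ _ _ _ _ mSk).
have mZ' : measurable ((fun w => (chain k w, V k w)) @^-1` Z).
  by rewrite -[X in measurable X]setTI; apply: measurable_fun_pair => //.
rewrite -/c; have [c0|c0] := eqVneq c 0.
  rewrite c0 mulr0; apply/eqP; rewrite eq_le fine_ge0 ?andbT//.
  rewrite -c0 -pQ /p fine_le ?fin_num_measure//; first exact: measurableI.
  by apply: le_measure; rewrite ?inE//; exact: measurableI.
have c_ge0 : 0 <= c^-1 by rewrite invr_ge0 -pQ fine_ge0.
pose ci : {nonneg R} := NngNum c_ge0.
have LP := @joint_law _ _ _ P _ _ _ _ S (V k) P _ Z mZ.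
have LQ := @joint_law _ _ _ P _ _ _ _ S (V k) (mscale ci (mrestr P mQ)) _ Z mZ.
have : P ((fun w => (chain k w, V k w)) @^-1` Z) =
       mscale ci (mrestr P mQ) ((fun w => (chain k w, V k w)) @^-1` Z).
  rewrite LP ?LQ// => A' B' mA' mB' /=.
    rewrite /mscale/= /mrestr pE ?rect; last 3 first.
    - by [].
    - by [].
    - by do 2! apply: measurableI => //; [exact: mchain|exact: mV].
    rewrite !pE; [|exact: mV|exact: mchain].
    by rewrite -!EFinM mulrC mulfK.
  rewrite pE ?rect0//; last by apply: measurableI; [exact: mchain|exact: mV].
  by rewrite !pE//; [exact: mV|exact: mchain].
rewrite /mscale/= /mrestr [X in X = _]pE// [X in _ = (_ * X)%E]pE; last exact: measurableI.
by rewrite -EFinM => -[->]; rewrite mulrC mulVKf.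
Qed.

Lemma ge0_integral_chain k (f : E * R -> \bar R) :
  measurable_fun [set: E * R] f -> (forall z, 0 <= f z)%E ->
  (\int[P]_w f (chain k w, V k w) =
   \int[P]_w \int[distribution P (V k)]_v f (chain k w, v))%E.
Proof.
move=> mf f0.
have mSk := measurable_chain k.
pose S : {mfun T >-> E} := HB.pack (chain k)
  (isMeasurableFun.Build _ _ _ _ _ mSk).
apply: (@ge0_integral_indep _ _ _ P _ _ _ _ S (V k)) => // A B mA mB.
have := @chain_indep k k.+1 A (fun=> B) mA (fun=> mB) (leqnSn k).
rewrite big_nat1 futS// (_ : fut k.+1 k.+1 _ = setT) ?setIT; last first.
  by apply/seteqP; split=> // w _ i /andP[/leq_trans h /h]; rewrite ltnn.
move=> h; rewrite pE ?h; last by apply: measurableI; [exact: mchain|exact: mV].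
by rewrite !pE//; [exact: mV|exact: mchain].
Qed.

Lemma integral_chain k (f : E * R -> \bar R) :
  measurable_fun [set: E * R] f -> (forall w v, 0 <= f (chain k w, v))%E ->
  (\int[P]_w f (chain k w, V k w) =
   \int[P]_w \int[distribution P (V k)]_v f (chain k w, v))%E.
Proof.
move=> mf f0; have fE w v : f (chain k w, v) = (f^\+)%E (chain k w, v).
  by rewrite funeposE; apply/esym/max_idPl.
under eq_integral do rewrite fE.
rewrite ge0_integral_chain//; last exact: measurable_funepos.
by apply: eq_integral => w _; apply: eq_integral => v _; rewrite -fE.
Qed.

End markov.

(** * The interarrival times and the claims as one independent sequence *)

Section density.
Context d (T : measurableType d) (R : realType).
Variables (nu : {finite_measure set T -> \bar R})
  (mu : {sigma_finite_measure set T -> \bar R}) (p : T -> \bar R).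
Local Open Scope ereal_scope.
Hypotheses (mp : measurable_fun [set: T] p) (p0 : forall x, 0 <= p x)
  (nuE : forall A, measurable A -> nu A = \int[mu]_(x in A) p x).

Lemma ge0_integral_density (f : T -> \bar R) : measurable_fun [set: T] f ->
  (forall x, 0 <= f x) -> \int[nu]_x f x = \int[mu]_x (f x * p x).
Proof.
move=> mf f0.
have numu : nu `<< mu.
  apply/null_content_dominatesP => A mA A0; rewrite nuE//.
  by apply: null_set_integral => //; exact: measurable_funTS.
rewrite -(Radon_Nikodym_SigmaFinite.change_of_variables numu)//.
have ip : mu.-integrable setT p.
  apply/integrableP; split => //.
  under eq_integral do rewrite gee0_abs//.
  by rewrite -nuE// ltey_eq fin_num_measure.
apply: ge0_ae_eq_integral => //.
- apply: emeasurable_funM => //.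
  exact: measurable_int (Radon_Nikodym_SigmaFinite.f_integrable _).
- exact: emeasurable_funM.
- by move=> x _; rewrite mule_ge0// Radon_Nikodym_SigmaFinite.f_ge0.
- by move=> x _; rewrite mule_ge0.
apply: ae_eqe_mul2l; apply/ae_eq_sym; apply: integral_ae_eq => //.
  exact: measurable_int (Radon_Nikodym_SigmaFinite.f_integrable _).
by move=> E _ mE; rewrite -Radon_Nikodym_SigmaFinite.f_integral// nuE.
Qed.

End density.

Section exponential_law.
Context d (T : measurableType d) (R : realType) (P : probability T R).
Notation mu := (@lebesgue_measure R).

Lemma ge0_integral_exponential_law (rate : R) (Y : {RV P >-> R}) (f : R -> \bar R) :
  0 < rate -> exponential_law rate Y ->
  measurable_fun [set: R] f -> (forall x, 0 <= f x)%E ->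
  (\int[distribution P Y]_y f y =
   \int[mu]_(x in `[0%R, +oo[) (f x * (rate * expR (- (rate * x)))%:E))%E.
Proof.
move=> r0 Ylaw mf f0.
have mY : measurable_fun [set: T] (Y : T -> measurableTypeR R).
  exact: (measurable_funP Y).
pose Y' : {mfun T >-> measurableTypeR R} := HB.pack (Y : T -> measurableTypeR R)
  (isMeasurableFun.Build _ _ _ _ _ mY).
rewrite ge0_integral_distribution//.
transitivity (\int[distribution P Y']_y f y)%E.
  by rewrite ge0_integral_distribution.
rewrite (@ge0_integral_density _ (measurableTypeR R) R (distribution P Y') mu
  (EFin \o exponential_pdf rate))//; last 2 first.
- by apply/measurable_EFinP; exact: measurable_exponential_pdf.
- by move=> x; rewrite lee_fin exponential_pdf_ge0// ltW.
rewrite [RHS]integral_mkcond; apply: eq_integral => x _.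
rewrite /exponential_pdf /= !patchE; case: ifPn; rewrite ?mulNr//.
by rewrite mule0.
Qed.

Lemma exponential_law_le0 (rate : R) (Y : {RV P >-> R}) :
  exponential_law rate Y -> P (Y @^-1` `]-oo, 0]) = 0%E.
Proof.
move=> Ylaw; have := Ylaw _ (measurable_itv `]-oo, 0]).
rewrite /distribution /pushforward => ->; rewrite /exponential_prob.
rewrite -integral_itv_bndo_bndc; last first.
  by apply/measurable_EFinP/measurable_funTS; exact: measurable_exponential_pdf.
by apply: integral0_eq => x; rewrite /= in_itv/= => x0; rewrite lt0_exponential_pdf.
Qed.

Lemma measure_eq_null (A B D : set T) : measurable A -> measurable B -> 
  measurable D -> P D = 0%E -> A `\` D = B `\` D -> P A = P B.
Proof.
move=> mA mB mD D0 AB.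
have h (X : set T) : measurable X -> P X = P (X `\` D).
  move=> mX; rewrite (measureDI P mX mD).
  rewrite [X in (_ + X)%E](_ : _ = 0%E) ?adde0//.
  by apply: (@subset_measure0 _ _ _ _ _ D) => //; exact: measurableI.
by rewrite (h A)// (h B)// AB.
Qed.

End exponential_law.

Lemma prod_interleave (R : comPzRingType) (f : nat -> R) k :
  \prod_(j < k.*2) f j = \prod_(i < k) (f i.*2 * f i.*2.+1).
Proof.
elim: k => [|k IH]; first by rewrite !big_ord0.
by rewrite doubleS !big_ord_recr /= IH mulrA.
Qed.

Section marks.
Context d (T : measurableType d) (R : realType) (P : probability T R).
Variables (lam : R) (N : R -> T -> nat) (C : nat -> {RV P >-> R}).
Variable tau : nat -> {RV P >-> R}.
Hypotheses (tau_exp : forall i, exponential_law lam (tau i))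
  (tau_indep : mutual_independence P
     (fun i => preimage_set_system setT (tau i) measurable))
  (NE : forall (t : R) (w : T) (k : nat), 0 <= t ->
          (k <= N t w)%N = (\sum_(i < k) tau i w <= t))
  (C_indep : independent_marks N C).

Let p (A : set T) := fine (P A).

Lemma tau_prod k (A : nat -> set R) : (forall i, measurable (A i)) ->
  p (\bigcap_(i < k) (tau i @^-1` A i)) = \prod_(i < k) p (tau i @^-1` A i).
Proof.
move=> mA; pose J := seq_fset tt (iota 0 k).
have := tau_indep J (fun i => tau i @^-1` A i).
rewrite (_ : \bigcap_(i in [set` J]) _ = \bigcap_(i < k) (tau i @^-1` A i)).
  rewrite /p => ->; last by move=> i _; exists (A i) => //; rewrite setTI.
  rewrite (perm_big _ (seq_fset_perm _ _)) undup_id ?iota_uniq//.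
  by rewrite -[X in iota 0 X]subn0 -/(index_iota 0 k) big_mkord.
have JE i : (i \in J) = (i < k)%N by rewrite /J seq_fsetE mem_iota add0n.
by apply/seteqP; split=> w H i ik; apply: H; move: ik; rewrite /= JE.
Qed.

Let arrival k w := Order.max (\sum_(i < k) tau i w) 0.

Let G := \bigcup_(t in `[0%R, +oo[) preimage_set_system setT (N t) measurable.

Let marrival k : measurable_fun [set: g_sigma_algebraType G]
  (arrival k : g_sigma_algebraType G -> R).
Proof.
suff: measurable_fun [set: g_sigma_algebraType G]
  (arrival k : g_sigma_algebraType G -> measurableTypeR R) by [].
apply: (measurability _ (RGenOInfty.measurableE R)) => _ [_ [x ->] <-].
rewrite setTI; have [x0|x0] := ltP x 0.
  rewrite (_ : _ @^-1` _ = setT)//; apply/seteqP; split=> // w _ /=.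
  by rewrite in_itv/= andbT /arrival lt_max x0 orbT.
apply: sub_sigma_algebra; exists x; first by rewrite /= in_itv/= x0.
exists [set j | (j < k)%N] => //; rewrite setTI.
apply/seteqP; split=> w /=.
  by rewrite ltnNge NE// -ltNge in_itv/= andbT /arrival lt_max => ->.
rewrite in_itv/= andbT /arrival lt_max ltnNge NE// -ltNge => /orP[//|].
by rewrite ltNge x0.
Qed.

Let D0 := \bigcup_i (tau i @^-1` `]-oo, 0]).

Let mtau i (A : set R) : measurable A -> measurable (tau i @^-1` A).
Proof. by move=> mA; rewrite -[X in measurable X]setTI; exact: measurable_funP. Qed.

Let mC i (A : set R) : measurable A -> measurable (C i @^-1` A).
Proof. by move=> mA; rewrite -[X in measurable X]setTI; exact: measurable_funP. Qed.

Lemma mixed_prod k (A B : nat -> set R) :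
  (forall i, measurable (A i)) -> (forall i, measurable (B i)) ->
  p (\bigcap_(i < k) (tau i @^-1` A i) `&` \bigcap_(i < k) (C i @^-1` B i)) =
  \prod_(i < k) p (tau i @^-1` A i) * \prod_(i < k) p (C i @^-1` B i).
Proof.
move=> mA mB.
pose EN := \bigcap_(i < k) ((fun w => arrival i.+1 w - arrival i w) @^-1` A i).
have sEN : <<s G >> EN.
  suff: @measurable _ (g_sigma_algebraType G) EN by [].
  apply: bigcap_measurableType => // i _.
  rewrite -[X in measurable X]setTI.
  have /= := measurable_funB (marrival i.+1) (marrival i).
  by apply.
have marr i : measurable_fun [set: T] (arrival i).
  apply: measurable_maxr => //.
  rewrite (_ : (fun w => _) = (fun w => \sum_(j <- index_enum 'I_i) tau j w))//.
  exact: measurable_sum.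
have mEN : measurable EN.
  apply: bigcap_measurableType => // i _.
  rewrite -[X in measurable X]setTI.
  have /= := measurable_funB (marr i.+1) (marr i).
  by apply.
have mtA : measurable (\bigcap_(i < k) (tau i @^-1` A i)).
  by apply: bigcap_measurableType => // i _; exact: mtau.
have mCB : measurable (\bigcap_(i < k) (C i @^-1` B i)).
  by apply: bigcap_measurableType => // i _; exact: mC.
have mD : measurable D0.
  by apply: bigcup_measurable => i _; exact: mtau.
have D00 : P D0 = 0%E.
  apply: measure_negligible => //; apply: negligible_bigcup => i.
  by apply/negligibleP; [exact: mtau|exact: exponential_law_le0 (tau_exp i)].
have tau_gt0 w i : ~ D0 w -> 0 < tau i w.
  move=> nD; rewrite ltNge; apply/negP => ti; apply: nD.
  by exists i => //=; rewrite in_itv.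
have arrE w i : ~ D0 w -> arrival i w = \sum_(j < i) tau j w.
  move=> nD; rewrite /arrival; apply/max_idPl.
  by apply: sumr_ge0 => j _; exact/ltW/tau_gt0.
have ENE : EN `\` D0 = (\bigcap_(i < k) (tau i @^-1` A i)) `\` D0.
  apply/seteqP; split=> w [H nD]; split=> // i ik; have /= := H i ik.
    by rewrite !arrE// big_ord_recr/= addrAC subrr add0r.
  by rewrite !arrE// big_ord_recr/= addrAC subrr add0r.
have -> : p (\bigcap_(i < k) (tau i @^-1` A i) `&` \bigcap_(i < k) (C i @^-1` B i))
    = p (EN `&` \bigcap_(i < k) (C i @^-1` B i)).
  congr fine; apply: (@measure_eq_null _ _ _ _ _ _ D0) => //;
    [exact: measurableI..|].
  by rewrite !classical_sets.setDE ![_ `&` _ `&` ~` _]classical_sets.setIAC -!classical_sets.setDE ENE.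
rewrite -(tau_prod k)//.
have -> : p (\bigcap_(i < k) (tau i @^-1` A i)) = p EN.
  by congr fine; apply: (@measure_eq_null _ _ _ _ _ _ D0).
pose J := seq_fset tt (None :: [seq Some i | i <- iota 0 k]).
pose F o := if o is Some i then C i @^-1` B i else EN.
have := C_indep J F.
have uJ : uniq (None :: [seq Some i | i <- iota 0 k]).
  rewrite /= map_inj_uniq ?iota_uniq ?andbT; last by move=> ? ? [].
  by apply/mapP => -[].
rewrite (_ : \bigcap_(i in [set` J]) _ =
    EN `&` \bigcap_(i < k) (C i @^-1` B i)).
  rewrite /p => ->; last first.
    by move=> [i|] _ //=; exists (B i) => //; rewrite setTI.
  rewrite (perm_big _ (seq_fset_perm _ _)) undup_id// big_cons big_map.
  by rewrite -[X in iota 0 X]subn0 -/(index_iota 0 k) big_mkord.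
apply/seteqP; split=> w.
  move=> H; split; first by apply: (H None); rewrite /= seq_fsetE inE.
  move=> i /= ik; apply: (H (Some i)).
  by rewrite /= seq_fsetE inE/= map_f// mem_iota add0n.
move=> [H1 H2] [i|] //=; rewrite seq_fsetE inE/= => /mapP[j].
by rewrite mem_iota add0n => ij [->]; exact: H2.
Qed.

Definition driver (j : nat) : {RV P >-> R} :=
  if odd j then C j./2 else tau j./2.

Lemma driver_prod k (A : nat -> set R) : (forall i, measurable (A i)) ->
  fine (P (\bigcap_(j < k) (driver j @^-1` A j))) =
  \prod_(j < k) fine (P (driver j @^-1` A j)).
Proof.
move=> mA.
pose A' j := if (j < k)%N then A j else setT.
have mA' j : measurable (A' j) by rewrite /A'; case: ifP.
have driverD i : driver i.*2 = tau i by rewrite /driver odd_double doubleK.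
have driverS i : driver i.*2.+1 = C i.
  by rewrite /driver /= odd_double /= uphalf_double.
have := mixed_prod k (fun i => A' i.*2) (fun i => A' i.*2.+1)
  (fun i => mA' _) (fun i => mA' _).
rewrite -big_split/=.
rewrite (eq_bigr (fun i : 'I_k => p (driver i.*2 @^-1` A' i.*2) *
    p (driver i.*2.+1 @^-1` A' i.*2.+1))); last first.
  by move=> i _; rewrite driverD driverS.
rewrite -(prod_interleave _ (fun j => p (driver j @^-1` A' j))) => H.
transitivity (\prod_(j < k.*2) p (driver j @^-1` A' j)); last first.
  rewrite -!(big_mkord xpredT (fun j => p (driver j @^-1` _ j))).
  rewrite (big_cat_nat (n:=k))//=; last by rewrite -addnn leq_addr.
  rewrite [X in _ * X]big_nat [X in _ * X]big1 ?mulr1; last first.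
    by move=> i /andP[ki _]; rewrite /A' ltnNge ki /= preimage_setT /p probability_setT.
  by apply: eq_big_nat => i /andP[_ ik]; rewrite /A' ik.
rewrite -H; congr fine; congr (P _); apply/seteqP; split=> w.
  move=> Hw; split=> i /= ik.
    by rewrite /A'; case: ifP => // ik2; have := Hw _ ik2; rewrite /= driverD.
  by rewrite /A'; case: ifP => // ik2; have := Hw _ ik2; rewrite /= driverS.
move=> [H1 H2] j /= jk.
have j2k : (j./2 < k)%N.
  by rewrite (leq_ltn_trans _ jk)// leq_half_double -addnn -addnS leq_addr.
have := odd_double_half j; case: (odd j) => [|] /= jE.
  move: (j./2) j2k jE => i ik jE; rewrite -jE add1n in jk *.
  by have := H2 _ ik; rewrite /A' /= jk driverS.
move: (j./2) j2k jE => i ik jE; rewrite -jE add0n in jk *.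
by have := H1 _ ik; rewrite /A' /= jk driverD.
Qed.

End marks.

Set Implicit Arguments.
Unset Strict Implicit.
Unset Printing Implicit Defensive.

(** * The path between jumps *)

Section path.
Context {R : realType}.
Notation mu := (@lebesgue_measure R).

Lemma derive0_endpoints (f : R -> R) (a b : R) : a <= b ->
  (forall x, x \in `]a, b[ -> is_derive x 1 f 0) ->
  {within `[a, b], continuous f} -> f b = f a.
Proof.
move=> ab df cf; have [c _] := MVT_segment ab df cf.
by rewrite mul0r => /eqP; rewrite subr_eq0 => /eqP.
Qed.

Variables (z : R) (tau c : nat -> R) (Nt : R -> nat) (x : R -> R).
Hypothesis tau_gt0 : forall i, 0 < tau i.
Let sig k := \sum_(i < k) tau i.
Hypothesis NtE : forall k (t : R), 0 <= t -> (k <= Nt t)%N = (sig k <= t).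
Hypothesis xP : segerdahl_path 0 1 (fun t => \sum_(i < Nt t) c i) z x.

Lemma sigS k : sig k.+1 = sig k + tau k.
Proof. by rewrite /sig big_ord_recr. Qed.

Lemma sig_ge0 k : 0 <= sig k.
Proof. by apply: sumr_ge0 => i _; exact: ltW. Qed.

Lemma Nt_on k (t : R) : sig k <= t < sig k.+1 -> Nt t = k.
Proof.
move=> /andP[kt tk]; have t0 : 0 <= t := le_trans (sig_ge0 k) kt.
apply/eqP; rewrite eqn_leq NtE// kt andbT -ltnS ltnNge NtE//.
by rewrite -ltNge.
Qed.

Let F (t : R) := \int[mu]_(s in `[0, t]) x s.

Lemma xF (t : R) : 0 <= t -> x t = z + F t - \sum_(i < Nt t) c i.
Proof.
move=> t0; have [_ ->] := xP t0; congr (_ + _ - _).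
by apply: eq_Rintegral => s _; rewrite add0r mul1r.
Qed.

Lemma x_integrable (t : R) : 0 <= t -> mu.-integrable `[0, t] (EFin \o x).
Proof. by move=> t0; have [] := xP t0. Qed.

Lemma F_continuous (u : R) : 0 <= u -> {within `[0, u], continuous F}.
Proof.
move=> u0.
exact: (parameterized_integral_continuous u0 (x_integrable u0)).
Qed.

Lemma x_flow k (t : R) : sig k <= t <= sig k.+1 ->
  z + F t - \sum_(i < k) c i = x (sig k) * expR (t - sig k).
Proof.
move=> /andP[kt tk]; set s := sig k; set K := z - \sum_(i < k) c i.
have s0 : 0 <= s by exact: sig_ge0.
have ssk : s < sig k.+1 by rewrite sigS ltrDl.
have xsE : x s = F s + K.
  by rewrite xF// (@Nt_on k) ?lexx// /K addrAC [F s + _]addrC.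
rewrite xsE expRD -/s addrAC [_ + F t]addrC -/K.
have [<-|st] := eqVneq s t.
  by rewrite expRxMexpNx_1 mulr1.
have {}st : s < t by rewrite lt_neqAle st.
have u0 : 0 <= t := ltW (le_lt_trans s0 st).
pose g t := (F t + K) * expR (- t).
have Fct : {within `[s, t], continuous F}.
  apply: continuous_subspaceW (F_continuous u0).
  by apply: subset_itvScc; rewrite bnd_simp.
have /(continuous_within_itvP _ st)[Fin FL FR] := Fct.
have gE : g t = g s.
  apply: derive0_endpoints; first exact: ltW.
    move=> y yst; have := yst; rewrite in_itv/= => /andP[sy yt].
    have y0 : 0 < y := le_lt_trans s0 sy.
    have xE : \forall v \near y, F v + K = x v.
      near=> v; have sv : s < v by near: v; exact: lt_nbhsr.
      have vu : v < sig k.+1 by near: v; apply: lt_nbhsl; exact: lt_le_trans tk.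
      rewrite xF; last exact: ltW (le_lt_trans s0 sv).
      by rewrite (@Nt_on k) ?(ltW sv)// /K addrAC [F v + _]addrC.
    have xyE := nbhs_singleton xE.
    have Fc : {for y, continuous F} by exact: Fin.
    have xc : {for y, continuous x}.
      rewrite /prop_for /continuous_at -xyE.
      apply: cvg_trans (cvgD Fc (cvg_cst K)).
      exact: near_eq_cvg.
    have [dF F'] := continuous_FTC1_closed yt (x_integrable u0) y0 xc.
    have dF' : is_derive y 1 F (x y).
      by rewrite -F' derive1E; exact/derivableP.
    apply: is_derive_eq.
    by rewrite -xyE/= /GRing.scale/= addr0 mulrN1 mulrN [X in _ + X]mulrC addNr.
  have ec (v : R) : {for v, continuous (fun t : R => expR (- t))}.
    by apply: continuous_comp; [exact: opp_continuous|exact: continuous_expR].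
  apply/(continuous_within_itvP _ st); split.
  - move=> v vst; apply: cvgM (ec v).
    by apply: cvgD; [exact: Fin|exact: cvg_cst].
  - apply: cvgM; last by apply: cvg_at_right_filter; exact: ec.
    by apply: cvgD FL _; exact: cvg_cst.
  - apply: cvgM; last by apply: cvg_at_left_filter; exact: ec.
    by apply: cvgD FR _; exact: cvg_cst.
have -> : F t + K = g t * expR t.
  by rewrite /g -mulrA [X in _ * X]mulrC expRxMexpNx_1 mulr1.
by rewrite gE /g mulrAC mulrA.
Unshelve. all: end_near. Qed.

Lemma x_within k (t : R) : sig k <= t < sig k.+1 ->
  x t = x (sig k) * expR (t - sig k).
Proof.
move=> /[dup] tk /andP[t1 t2]; rewrite xF ?(le_trans (sig_ge0 k))//.
by rewrite (Nt_on tk) x_flow// t1 ltW.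
Qed.

Lemma x_jump k : x (sig k.+1) = x (sig k) * expR (tau k) - c k.
Proof.
rewrite xF ?sig_ge0// (@Nt_on k.+1) ?lexx ?sigS ?ltrDl//.
  rewrite big_ord_recr/= opprD addrA x_flow ?sigS ?lexx ?andbT ?lerDl ?ltW//.
  by rewrite addrAC subrr add0r.
by rewrite tau_gt0.
Qed.

Lemma x_start : x 0 = z.
Proof.
rewrite xF// /F set_itv1 Rintegral_set1 addr0 (@Nt_on 0%N) ?big_ord0 ?subr0//.
by rewrite /sig !big_ord_recr !big_ord0/= add0r lexx tau_gt0.
Qed.

Lemma sig_unbounded (t : R) : exists k, t < sig k.
Proof.
have [t0|t0] := leP 0 t; last first.
  by exists 0%N; rewrite /sig big_ord0.
by exists (Nt t).+1; rewrite ltNge -NtE// ltnn.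
Qed.

Lemma path_bounded k : exists B, forall t, 0 <= t -> t < sig k -> x t <= B.
Proof.
elim: k => [|k [B HB]].
  by exists 0 => t t0; rewrite /sig big_ord0 ltNge t0.
exists (Order.max B (`|x (sig k)| * expR (tau k))) => t t0 tS.
rewrite le_max; have [tk|kt] := ltP t (sig k); first by rewrite HB.
apply/orP; right; rewrite (@x_within k) ?kt//.
apply: le_trans (ler_norm _) _; rewrite normrM.
rewrite (ger0_norm (expR_ge0 _)) ler_wpM2l// ler_expR lerBlDl -sigS.
exact: ltW.
Qed.

End path.

(** * Passage times along the jump chain *)

Section passage.
Context {R : realType}.
Implicit Types (a b s : R) (x : R -> R).

Lemma passage_above_ge b s x : (forall t, 0 <= t -> t < s -> x t <= b) ->
  (s%:E <= passage_above b x)%E.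
Proof.
move=> H; apply: le_ereal_inf_tmp => _ [t [t0 bx] <-].
by rewrite lee_fin leNgt; apply/negP => /(H _ t0); rewrite leNgt bx.
Qed.

Lemma passage_below_ge a s x : (forall t, 0 <= t -> t < s -> a <= x t) ->
  (s%:E <= passage_below a x)%E.
Proof.
move=> H; apply: le_ereal_inf_tmp => _ [t [t0 bx] <-].
by rewrite lee_fin leNgt; apply/negP => /(H _ t0); rewrite leNgt bx.
Qed.

Lemma passage_below_eq a s x : (forall t, 0 <= t -> t < s -> a <= x t) ->
  0 <= s -> x s < a -> passage_below a x = s%:E.
Proof.
move=> H s0 xs; apply/eqP; rewrite eq_le passage_below_ge// andbT.
by apply: ereal_inf_lbound; exists s.
Qed.

Lemma passage_above_eq b s u x : (forall t, 0 <= t -> t < s -> x t <= b) ->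
  0 <= s -> s < u -> (forall t, s < t -> t < u -> b < x t) ->
  passage_above b x = s%:E.
Proof.
move=> H s0 su bx; apply/eqP; rewrite eq_le passage_above_ge// andbT.
apply/lee_addgt0Pr => e e0; set v := Order.min (s + e) u.
have sv : s < v by rewrite /v lt_min su ltrDl e0.
have m1 : s < (s + v) / 2 by rewrite ltr_pdivlMr//; lra.
have m2 : (s + v) / 2 < v by rewrite ltr_pdivrMr//; lra.
apply: (@le_trans _ _ ((s + v) / 2)%:E).
  apply: ereal_inf_lbound; exists ((s + v) / 2) => //; split; first lra.
  by apply: bx => //; rewrite (lt_le_trans m2)// /v ge_min lexx orbT.
by rewrite -EFinD lee_fin (le_trans (ltW m2))// /v ge_min lexx.
Qed.

Lemma passage_above_pinfty b x : (forall t, 0 <= t -> x t <= b) ->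
  passage_above b x = +oo%E.
Proof.
move=> H; apply/eqyP => r r0; apply: passage_above_ge => t t0 _; exact: H.
Qed.

Lemma passage_below_pinfty a x : (forall t, 0 <= t -> a <= x t) ->
  passage_below a x = +oo%E.
Proof.
move=> H; apply/eqyP => r r0; apply: passage_below_ge => t t0 _; exact: H.
Qed.

End passage.

(* A state [(y, D)] is the position [y] just before a jump or just after one,
   with the discount [D] accumulated so far, set to 0 once the path has left
   [[a, b]]. *)
Definition grow {R : realType} (q b : R) (sv : (R * R) * R) : R * R :=
  let: ((y, D), t) := sv in
  (y * expR t, D * expR (- (q * t)) * ((0 <= t) && (y * expR t <= b))%:R).

Definition claim {R : realType} (a : R) (sv : (R * R) * R) : R * R :=
  let: ((y, D), c) := sv in (y - c, D * ((0 <= c) && (a <= y - c))%:R).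

Definition up_gain {R : realType} (q b : R) (sv : (R * R) * R) : R :=
  let: ((y, D), t) := sv in D * (y / b) `^ q * ((b < y * expR t)%R)%:R.

Definition ruin_gain {R : realType} (a : R) (beta : R -> R)
    (sv : (R * R) * R) : R :=
  let: ((y, D), c) := sv in D * beta (y - c - a) * ((y - c < a)%R)%:R.

Definition up_payoff {R : realType} (q a b : R) (x : R -> R) : R :=
  discount q (passage_above b x)
  * ((passage_above b x < passage_below a x)%E)%:R.

Definition ruin_payoff {R : realType} (q a b : R) (beta : R -> R)
    (x : R -> R) : R :=
  (if passage_below a x is t%:E then expR (- (q * t)) * beta (x t - a) else 0)
  * ((passage_below a x < passage_above b x)%E)%:R.

Section pathwise.
Context {R : realType}.
Variables (a b q z : R) (beta : R -> R) (tau c : nat -> R) (Nt : R -> nat)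
  (x : R -> R) (st : nat -> R * R).
Hypotheses (a_ge0 : 0 <= a) (ab : a <= b) (b_gt0 : 0 < b)
  (az : a <= z) (zb : z <= b).
Hypothesis tau_gt0 : forall i, 0 < tau i.
Hypothesis c_gt0 : forall i, 0 < c i.
Let sig k := \sum_(i < k) tau i.
Hypothesis NtE : forall k (t : R), 0 <= t -> (k <= Nt t)%N = (sig k <= t).
Hypothesis xP : segerdahl_path 0 1 (fun t => \sum_(i < Nt t) c i) z x.
Hypothesis st0 : st 0 = (z, 1).
Hypothesis stT : forall k, st k.*2.+1 = grow q b (st k.*2, tau k).
Hypothesis stC : forall k, st k.*2.+2 = claim a (st k.*2.+1, c k).

Let U k := \sum_(j < k) up_gain q b (st j.*2, tau j).
Let Rn k := \sum_(j < k) ruin_gain a beta (st j.*2.+1, c j).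

Lemma stage k :
  (st k.*2 = (x (sig k), expR (- (q * sig k))) /\ a <= x (sig k) <= b /\
   (forall t, 0 <= t -> t < sig k -> a <= x t <= b) /\ U k = 0 /\ Rn k = 0) \/
  ((st k.*2).2 = 0 /\ U k = up_payoff q a b x /\
   Rn k = ruin_payoff q a b beta x).
Proof.
elim: k => [|k [[sE [yab [xab [U0 R0]]]]|[D0 [UE RE]]]].
- left; rewrite /U /Rn !big_ord0 /sig big_ord0 double0 st0.
  rewrite (x_start tau_gt0 NtE xP) mulr0 oppr0 expR0 az zb; do ! (split; first by []).
  by split => // t t0; rewrite ltNge t0.
- have sigSk : sig k.+1 = sig k + tau k by rewrite /sig big_ord_recr.
  have sig0 : 0 <= sig k by exact: sig_ge0.
  have := stC k; have := stT k; rewrite sE /=.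
  have xon t : sig k <= t < sig k.+1 -> x t = x (sig k) * expR (t - sig k).
    exact: (x_within tau_gt0 NtE xP).
  have := x_jump tau_gt0 NtE xP k; rewrite -/(sig k) -/(sig k.+1).
  move: yab; set y := x (sig k) => yab xS sT.
  have y0 : 0 <= y by case/andP: yab => /(le_trans a_ge0).
  rewrite doubleS sT /= (ltW (tau_gt0 k)) (ltW (c_gt0 k)) /= => sC.
  rewrite (ltW (tau_gt0 k)) /= in sT.
  have US : U k.+1 = up_gain q b ((y, expR (- (q * sig k))), tau k).
    by rewrite /U big_ord_recr/= -/(U k) U0 add0r sE.
  have RS : Rn k.+1 = ruin_gain a beta (st k.*2.+1, c k).
    by rewrite /Rn big_ord_recr/= -/(Rn k) R0 add0r.
  have xlow t : 0 <= t -> t < sig k.+1 -> a <= x t.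
    move=> t0 tS; have [tk|kt] := ltP t (sig k); first by case/andP: (xab t t0 tk).
    rewrite xon ?kt// (le_trans (proj1 (andP yab)))// ler_peMr//.
    by rewrite -expR0 ler_expR subr_ge0.
  have q_D (t : R) : expR (- (q * sig k)) * expR (- (q * t)) = expR (- (q * (sig k + t))).
    by rewrite -expRD mulrDr opprD.
  have [yb|by_] := leP (y * expR (tau k)) b; last first.
    right; have y_gt0 : 0 < y.
      rewrite lt_neqAle y0 andbT; apply/eqP => ye.
      by move: by_; rewrite -ye mul0r ltNge ltW.
    pose s := ln (b / y).
    have by0 : 0 < b / y by rewrite divr_gt0.
    have ys : y * expR s = b by rewrite lnK ?posrE// mulrC divfK ?gt_eqF.
    have s0 : 0 <= s by rewrite -ler_expR expR0 lnK ?posrE// ler_pdivlMr// mul1r; case/andP: yab.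
    have st_ : s < tau k by rewrite -ltr_expR -(ltr_pM2l y_gt0) ys.
    have TbE : passage_above b x = (sig k + s)%:E.
      apply: (@passage_above_eq _ _ _ (sig k.+1)).
      - move=> t t0 ts; have [tk|kt] := ltP t (sig k); first by case/andP: (xab t t0 tk).
        rewrite xon ?kt ?(lt_trans ts) ?sigSk ?ltrD2l// -ys ler_pM2l// ler_expR.
        by rewrite lerBlDl ltW.
      - by rewrite addr_ge0.
      - by rewrite sigSk ltrD2l.
      move=> t st' tS; rewrite xon ?tS ?andbT.
        by rewrite -ys ltr_pM2l// ltr_expR ltrBrDl.
      by rewrite (le_trans _ (ltW st'))// lerDl.
    have TaGt : (passage_above b x < passage_below a x)%E.
      rewrite TbE (@lt_le_trans _ _ (sig k.+1)%:E)//.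
        by rewrite lte_fin sigSk ltrD2l.
      by apply: passage_below_ge.
    have nb : (y * expR (tau k) <= b) = false by rewrite leNgt by_.
    have D0 : (st k.*2.+1).2 = 0 by rewrite sT /= nb mulr0.
    split; first by rewrite sC /= nb mulr0 mul0r.
    rewrite US RS /up_payoff /ruin_payoff TaGt ltNge (ltW TaGt) mulr0 mulr1.
    split.
      rewrite /= by_ mulr1 TbE /= -q_D; congr (_ * _).
      rewrite /powR gt_eqF ?divr_gt0//; congr expR.
      by rewrite /s !ln_div ?posrE// -mulrN opprB.
    by move: D0; case: (st _) => y' D' /= ->; rewrite !mul0r.
  have U0' : U k.+1 = 0 by rewrite US /= ltNge yb mulr0.
  have stE : st k.*2.+1 = (y * expR (tau k), expR (- (q * sig k.+1))).
    by rewrite sT yb mulr1 q_D sigSk.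
  have sig0S : 0 <= sig k.+1 by rewrite sigSk addr_ge0// ltW.
  have xup t : 0 <= t -> t < sig k.+1 -> x t <= b.
    move=> t0 tS; have [tk|kt] := ltP t (sig k); first by case/andP: (xab t t0 tk).
    rewrite xon ?kt// (le_trans _ yb)// ler_wpM2l// ler_expR lerBlDl -sigSk.
    exact: ltW.
  have xSb : x (sig k.+1) <= b by rewrite xS (le_trans _ yb)// gerBl ltW.
  have [ac|ca] := leP a (y * expR (tau k) - c k).
    left; split; first by rewrite sC yb ac !mulr1 xS q_D sigSk.
    split; first by rewrite xSb xS ac.
    split; first by move=> t t0 tS; rewrite xlow// xup.
    by split => //; rewrite RS stE /= ltNge ac mulr0.
  have TaE : passage_below a x = (sig k.+1)%:E.
    by apply: passage_below_eq; rewrite // xS.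
  have TbGt : (passage_below a x < passage_above b x)%E.
    have [e e0 He] : exists2 e, 0 < e & forall t, t < sig k.+1 + e ->
        sig k.+1 <= t -> x t <= b.
      have xon' t : sig k.+1 <= t < sig k.+2 -> x t = x (sig k.+1) * expR (t - sig k.+1).
        exact: (x_within tau_gt0 NtE xP).
      have sigSSk : sig k.+2 = sig k.+1 + tau k.+1 by rewrite {1}/sig big_ord_recr.
      have [y'0|y'0] := leP (x (sig k.+1)) 0.
        exists (tau k.+1) => // t tS St; rewrite xon' ?St ?sigSSk//.
        by rewrite (le_trans _ (ltW b_gt0))// pmulr_lle0 ?expR_gt0.
      have y'b : x (sig k.+1) < b by rewrite xS (lt_le_trans ca).
      exists (Order.min (tau k.+1) (ln (b / x (sig k.+1)))).
        by rewrite lt_min tau_gt0 ln_gt0// ltr_pdivlMr// mul1r.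
      move=> t tS St; have [t1 t2] : t < sig k.+1 + tau k.+1 /\ t < sig k.+1 + ln (b / x (sig k.+1)).
        by split; rewrite (lt_le_trans tS)// lerD2l ge_min lexx ?orbT.
      rewrite xon' ?St ?sigSSk// -ler_pdivlMl// mulrC -(@lnK _ (b / _)) ?posrE ?divr_gt0//.
      by rewrite ler_expR lerBlDl ltW.
    rewrite TaE (@lt_le_trans _ _ (sig k.+1 + e)%:E) ?lte_fin ?ltrDl//.
    apply: passage_above_ge => t t0 te; have [tS|St] := ltP t (sig k.+1); first exact: xup.
    exact: He.
  right; split; first by rewrite sC /= (leNgt a) ca mulr0.
  rewrite U0' RS /up_payoff /ruin_payoff TbGt ltNge (ltW TbGt) mulr0 mulr1.
  by split => //; rewrite stE /= ca mulr1 TaE xS.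
right; have D0' : (st k.*2.+1).2 = 0.
  by rewrite stT; move: D0; case: (st _) => y D /= ->; rewrite !mul0r.
split; first by rewrite doubleS stC; move: D0'; case: (st _) => y D /= ->; rewrite mul0r.
rewrite /U /Rn !big_ord_recr/= -/(U k) -/(Rn k) UE RE.
move: D0 D0'; case: (st _) => y D /= ->; case: (st _) => y' D' /= ->.
by rewrite !mul0r !addr0.
Qed.

Lemma stage_limit : exists2 k0, (0 < k0)%N & forall k, (k0 <= k)%N ->
  U k = up_payoff q a b x /\ Rn k = ruin_payoff q a b beta x.
Proof.
have [[k0 k00 D0]|nD] := pselect (exists2 k0, (0 < k0)%N & (st k0.*2).2 = 0).
  exists k0 => // k; elim: k => [|k IH].
    by rewrite leqn0 => /eqP k0E; rewrite k0E in k00.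
  have Dk j : (st (k0 + j).*2).2 = 0.
    elim: j => [|j]; first by rewrite addn0.
    rewrite addnS doubleS stC stT; case: (st _) => y D /= ->.
    by rewrite !mul0r.
  move=> kk; have := stage k.+1; case => [[sE _]|[_ []]//].
  have := Dk (k.+1 - k0)%N; rewrite subnKC// sE /= => /eqP.
  by rewrite gt_eqF ?expR_gt0.
have alive k : (forall t, 0 <= t -> t < sig k -> a <= x t <= b) /\ U k = 0 /\ Rn k = 0.
  have [[_ [_ []]]//|[Dk _]] := stage k.
  case: k Dk => [|k Dk]; first by rewrite double0 st0 /= => /eqP; rewrite oner_eq0.
  by exfalso; apply: nD; exists k.+1.
have xab t : 0 <= t -> a <= x t <= b.
  move=> t0; have [k kt] := sig_unbounded NtE t.
  by have [+ _] := alive k; apply.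
exists 1%N => // k _; have [_ [-> ->]] := alive k.
rewrite /up_payoff /ruin_payoff.
rewrite passage_above_pinfty; last by move=> t /xab/andP[].
rewrite passage_below_pinfty; last by move=> t /xab/andP[].
by rewrite /= !mul0r.
Qed.

End pathwise.

(** * The two-sided passage problem *)

Section measurability.
Context {R : realType}.
Implicit Types (a b q : R).

Lemma measurable_natb d (T : measurableType d) (f : T -> bool) :
  measurable_fun [set: T] f -> measurable_fun [set: T] (fun x => (f x)%:R : R).
Proof. by move=> mf; apply: (measurableT_comp (f := fun c : bool => c%:R : R)). Qed.

Let my : measurable_fun [set: (R * R) * R] (fun s : (R * R) * R => s.1.1).
Proof. by apply: measurableT_comp => //; exact: measurable_fst. Qed.
Let mD : measurable_fun [set: (R * R) * R] (fun s : (R * R) * R => s.1.2).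
Proof.
by apply: (measurableT_comp measurable_snd); exact: measurable_fst.
Qed.
Let mt : measurable_fun [set: (R * R) * R] (fun s : (R * R) * R => s.2).
Proof. exact: measurable_snd. Qed.

Let myt : measurable_fun [set: (R * R) * R] (fun s : (R * R) * R => s.1.1 * expR s.2).
Proof. by apply: measurable_funM => //; exact: measurableT_comp. Qed.
Let myc : measurable_fun [set: (R * R) * R] (fun s : (R * R) * R => s.1.1 - s.2).
Proof. exact: measurable_funB. Qed.

Lemma measurable_grow q b : measurable_fun [set: (R * R) * R] (grow q b).
Proof.
rewrite (_ : grow q b = fun s => (s.1.1 * expR s.2,
  s.1.2 * expR (- (q * s.2)) * ((0 <= s.2) && (s.1.1 * expR s.2 <= b))%:R)).
  apply: measurable_fun_pair => //; apply: measurable_funM.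
    apply: measurable_funM => //; apply: measurableT_comp => //.
    by apply: measurableT_comp => //; exact: measurable_funM.
  apply: measurable_natb; apply: measurable_and; apply: measurable_fun_ler => //.
by apply/funext => -[[]].
Qed.

Lemma measurable_claim a : measurable_fun [set: (R * R) * R] (claim a).
Proof.
rewrite (_ : claim a = fun s => (s.1.1 - s.2,
  s.1.2 * ((0 <= s.2) && (a <= s.1.1 - s.2))%:R)).
  apply: measurable_fun_pair => //; apply: measurable_funM => //.
  apply: measurable_natb; apply: measurable_and; apply: measurable_fun_ler => //.
by apply/funext => -[[]].
Qed.

Lemma measurable_up_gain q b : measurable_fun [set: (R * R) * R] (up_gain q b).
Proof.
rewrite (_ : up_gain q b = fun s =>
  s.1.2 * (s.1.1 / b) `^ q * ((b < s.1.1 * expR s.2)%R)%:R).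
  apply: measurable_funM.
    apply: measurable_funM => //; apply: (measurableT_comp (measurable_powR q)).
    exact: measurable_funM.
  by apply: measurable_natb; apply: measurable_fun_ltr.
by apply/funext => -[[]].
Qed.

Lemma measurable_ruin_gain a (beta : R -> R) : measurable_fun [set: R] beta ->
  measurable_fun [set: (R * R) * R] (ruin_gain a beta).
Proof.
move=> mb; rewrite (_ : ruin_gain a beta = fun s =>
  s.1.2 * beta (s.1.1 - s.2 - a) * ((s.1.1 - s.2 < a)%R)%:R).
  apply: measurable_funM.
    apply: measurable_funM => //; apply: measurableT_comp => //.
    exact: measurable_funB.
  by apply: measurable_natb; apply: measurable_fun_ltr.
by apply/funext => -[[]].
Qed.

End measurability.

Section helper.
Context {R : realType}.
Notation mu := (@lebesgue_measure R).

Lemma integral_natb (D A : set R) (c : R -> bool) (f : R -> R) :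
  (forall t, A t <-> D t /\ c t) ->
  (\int[mu]_(t in D) ((c t)%:R * f t)%:E = \int[mu]_(t in A) (f t)%:E)%E.
Proof.
move=> AE; rewrite integral_mkcond [RHS]integral_mkcond.
apply: eq_integral => t _; rewrite !patchE.
have [/set_mem At|At] := boolP (t \in A).
  have [Dt ct] := (AE t).1 At; rewrite (mem_set Dt).
  by rewrite ct mul1r.
case: ifPn => // /set_mem Dt; case ct : (c t); last by rewrite mul0r.
by move/negP: At; case; apply/mem_set/AE.
Qed.

Lemma measurable_exp_density (r : R) :
  measurable_fun [set: R] (fun t : R => r * expR (- (r * t))).
Proof.
apply: measurable_funM => //; apply: (measurableT_comp (@measurable_expR R)).
apply: (measurableT_comp (f := @GRing.opp R)) => //; exact: measurable_funM.
Qed.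

Lemma exp_tail (r m : R) : 0 < r ->
  (\int[mu]_(t in `]m, +oo[) (r * expR (- (r * t)))%:E = (expR (- (r * m)))%:E)%E.
Proof.
move=> r0.
have ce : continuous (fun t : R => expR (- (r * t))).
  move=> t; apply: (@continuous_comp _ _ _ (fun t => - (r * t)) expR).
    by apply: continuousN; apply: continuousM => //; exact: cst_continuous.
  exact: continuous_expR.
have cf : continuous (fun t : R => r * expR (- (r * t))).
  by move=> t; apply: cvgM; [exact: cvg_cst|exact: ce].
rewrite integral_itv_obnd_cbnd; last first.
  by apply/measurable_EFinP/measurable_funTS; exact: continuous_measurable_fun.
rewrite (@ge0_continuous_FTC2y _ _ (fun t => - expR (- (r * t))) _ 0).
- by rewrite EFinN oppeK add0e.
- by move=> t _; rewrite mulr_ge0 ?expR_ge0// ltW.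
- by apply: continuous_subspaceT => t; exact: cf.
- rewrite -oppr0; apply: cvgN.
  apply: (@cvg_comp _ _ _ (fun t => r * t) (fun z => expR (- z)) _ (pinfty_nbhs R)).
    exact: gt0_cvgMry.
  exact: cvgr_expR.
- by move=> t _; exact: ex_derive.
- by apply: cvgN; apply: cvg_at_right_filter; exact: ce.
- move=> t _; rewrite derive1E; apply: derive_val; apply: is_derive_eq.
  by rewrite /GRing.scale/=; ring.
Qed.

End helper.

Section stopping.
Context d (T : measurableType d) (R : realType) (P : probability T R).
Variables (lam q : R) (N : R -> T -> nat) (C tau : nat -> {RV P >-> R})
  (X : R -> R -> T -> R).
Hypotheses (lam_gt0 : 0 < lam) (q_ge0 : 0 <= q)
  (tau_exp : forall i, exponential_law lam (tau i))
  (tau_indep : mutual_independence P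
     (fun i => preimage_set_system setT (tau i) measurable))
  (NE : forall (t : R) (w : T) (k : nat), 0 <= t ->
          (k <= N t w)%N = (\sum_(i < k) tau i w <= t))
  (C_exp : forall i, exponential_law 1 (C i))
  (C_indep : independent_marks N C)
  (X_segerdahl : forall z w,
     segerdahl_path 0 1 (fun t => compound N C t w) z (fun t => X z t w)).
Notation mu := (@lebesgue_measure R).

Variables (a b z : R).
Hypotheses (a_ge0 : 0 <= a) (ab : a <= b) (b_gt0 : 0 < b)
  (az : a <= z) (zb : z <= b).

Let V := driver d T R P C tau.
Let step j : (R * R) * R -> R * R := if odd j then claim a else grow q b.

Let mstep j : measurable_fun [set: (R * R) * R] (step j).
Proof.
by rewrite /step; case: ifP => _; [exact: measurable_claim|exact: measurable_grow].
Qed.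

Definition st := chain d T R P _ (R * R)%type V step (z, 1).

Let V_even k : V k.*2 = tau k.
Proof. by rewrite /V /driver odd_double doubleK. Qed.
Let V_odd k : V k.*2.+1 = C k.
Proof. by rewrite /V /driver /= odd_double /= uphalf_double. Qed.

Let stT k w : st k.*2.+1 w = grow q b (st k.*2 w, tau k w).
Proof. by rewrite /st /= -/st /step odd_double V_even. Qed.
Let stC k w : st k.*2.+2 w = claim a (st k.*2.+1 w, C k w).
Proof.
have -> : st k.*2.+2 w = step k.*2.+1 (st k.*2.+1 w, V k.*2.+1 w) by [].
by rewrite V_odd /step /= odd_double.
Qed.

Lemma mst k : measurable_fun [set: T] (st k).
Proof. exact: measurable_chain. Qed.

Lemma st_inv k w : 0 <= (st k w).2 <= 1 /\
  ((st k w).2 = 0 \/ a <= (st k w).1 <= b).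
Proof.
elim: k => [|k [/andP[D0 D1] yD]].
  by rewrite /st /= ler01 lexx; split => //; right; rewrite az zb.
rewrite /st /= -/(st k w) /step; case: (odd k).
  move: D0 D1 yD; case: (st k w) => y D /= D0 D1 yD.
  case: (boolP ((0 <= V k w) && (a <= y - V k w))) => [/andP[c0 ac]|_]; last by rewrite mulr0 lexx ler01; split=> //; left.
  rewrite mulr1 D0 D1; split => //; case: yD => [->|/andP[ay yb]]; [by left|right].
  by rewrite ac (le_trans _ yb)// gerBl.
move: D0 D1 yD; case: (st k w) => y D /= D0 D1 yD.
case: (boolP ((0 <= V k w) && (y * expR (V k w) <= b))) => [/andP[t0 yb]|_]; last by rewrite mulr0 lexx ler01; split=> //; left.
rewrite mulr1 mulr_ge0 ?expR_ge0//=; split.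
  by rewrite mulr_ile1 ?expR_ge0// -expR0 ler_expR oppr_le0 mulr_ge0.
case: yD => [->|/andP[ay yb']]; [by left; rewrite mul0r|right].
rewrite yb andbT (le_trans ay)// ler_peMr ?(le_trans a_ge0)//.
by rewrite -expR0 ler_expR.
Qed.

Let indepV := driver_prod d T R P lam N C tau tau_exp tau_indep NE C_indep.

Lemma integral_step k (f : (R * R) * R -> R) :
  measurable_fun [set: (R * R) * R] f -> (forall w v, 0 <= f (st k w, v)) ->
  (\int[P]_w (f (st k w, V k w))%:E =
   \int[P]_w \int[distribution P (V k)]_v (f (st k w, v))%:E)%E.
Proof.
move=> mf f0.
apply: (integral_chain d T R P _ (R * R)%type V step (z, 1) mstep indepV k
  (EFin \o f)); first exact/measurable_EFinP.
by move=> w v; rewrite lee_fin f0.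
Qed.

Let msv (s : R * R) : measurable_fun [set: R] (fun t : R => (s, t)).
Proof. by apply: measurable_fun_pair => //; exact: measurable_cst. Qed.

Section harmonic.
Variables (h I : R -> R) (A B : R).
Hypotheses (mh : measurable_fun [set: R] h) (mI : measurable_fun [set: R] I)
  (h_ge0 : forall y, 0 <= h y) (I_ge0 : forall y, 0 <= I y)
  (A_ge0 : 0 <= A) (B_ge0 : 0 <= B).
Let FT sv := (grow q b sv).2 * I (grow q b sv).1 + A * up_gain q b sv.
Let FC sv := (claim a sv).2 * h (claim a sv).1
  + B * ruin_gain a (fun=> 1) sv.

Hypothesis harmT : forall y, a <= y <= b ->
  (\int[mu]_(t in `[0%R, +oo[)
    (FT ((y, 1), t) * (lam * expR (- (lam * t))))%:E = (h y)%:E)%E.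
Hypothesis harmC : forall y, a <= y <= b ->
  (\int[mu]_(c in `[0%R, +oo[)
    (FC ((y, 1), c) * (1 * expR (- (1 * c))))%:E = (I y)%:E)%E.

Let mFT : measurable_fun [set: (R * R) * R] FT.
Proof.
apply: measurable_funD; last first.
  by apply: measurable_funM => //; exact: measurable_up_gain.
apply: measurable_funM.
  by apply: (measurableT_comp measurable_snd); exact: measurable_grow.
apply: measurableT_comp => //.
by apply: (measurableT_comp measurable_fst); exact: measurable_grow.
Qed.

Let mFC : measurable_fun [set: (R * R) * R] FC.
Proof.
apply: measurable_funD; last first.
  by apply: measurable_funM => //; exact: measurable_ruin_gain.
apply: measurable_funM.
  by apply: (measurableT_comp measurable_snd); exact: measurable_claim.
apply: measurableT_comp => //.
by apply: (measurableT_comp measurable_fst); exact: measurable_claim.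
Qed.

Let up_ge0 y D t : 0 <= D -> 0 <= up_gain q b ((y, D), t).
Proof. by move=> D0; rewrite /up_gain !mulr_ge0// powR_ge0. Qed.

Let ruin_ge0 (beta : R -> R) y D t : (forall v, 0 <= beta v) -> 0 <= D ->
  0 <= ruin_gain a beta ((y, D), t).
Proof. by move=> b0 D0; rewrite /ruin_gain !mulr_ge0. Qed.

Let FT_ge0 y D t : 0 <= D -> 0 <= FT ((y, D), t).
Proof.
move=> D0; rewrite /FT addr_ge0//; last by rewrite mulr_ge0// up_ge0.
by rewrite /grow/= !mulr_ge0// expR_ge0.
Qed.

Let FC_ge0 y D t : 0 <= D -> 0 <= FC ((y, D), t).
Proof.
move=> D0; rewrite /FC addr_ge0//; last by rewrite mulr_ge0// ruin_ge0.
by rewrite /claim/= !mulr_ge0.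
Qed.

Let FT_D y D t : FT ((y, D), t) = D * FT ((y, 1), t).
Proof. by rewrite /FT /grow /up_gain/=; ring. Qed.

Let FC_D y D t : FC ((y, D), t) = D * FC ((y, 1), t).
Proof. by rewrite /FC /claim /ruin_gain/=; ring. Qed.

Let kernel (F : (R * R) * R -> R) (r : R) (Y : {RV P >-> R}) (f : R -> R) y D :
  0 < r -> exponential_law r Y -> measurable_fun [set: (R * R) * R] F ->
  (forall y D t, 0 <= D -> 0 <= F ((y, D), t)) ->
  (forall y D t, F ((y, D), t) = D * F ((y, 1), t)) ->
  (forall y, a <= y <= b -> (\int[mu]_(t in `[0%R, +oo[)
    (F ((y, 1), t) * (r * expR (- (r * t))))%:E = (f y)%:E)%E) ->
  0 <= D -> D = 0 \/ a <= y <= b ->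
  (\int[distribution P Y]_t (F ((y, D), t))%:E = (D * f y)%:E)%E.
Proof.
move=> r0 Yr mF F0 FD Ff D0 yD.
have mFy D' : measurable_fun [set: R] (fun t => (F ((y, D'), t))).
  by apply: (measurableT_comp mF); exact: msv.
have mFyE D' : measurable_fun [set: R] (fun t => (F ((y, D'), t))%:E).
  exact/measurable_EFinP.
rewrite (ge0_integral_exponential_law _ _ _ _ r)//; last first.
  by move=> t; rewrite lee_fin F0.
case: yD => [->|yab].
  by rewrite mul0r; apply: integral0_eq => t _; rewrite FD mul0r mul0e.
rewrite EFinM -Ff// -ge0_integralZl_EFin//; last 2 first.
- by move=> t _; rewrite lee_fin !mulr_ge0 ?F0 ?expR_ge0 ?(ltW r0).
- have mall : measurable_fun [set: R]
      (fun t : R => F ((y, 1), t) * (r * expR (- (r * t)))).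
    by apply: measurable_funM => //; exact: measurable_exp_density.
  by apply/measurable_EFinP/measurable_funTS; exact: mall.
by apply: eq_integral => t _; rewrite -!EFinM [in LHS]FD -mulrA.
Qed.

Let M k := (\int[P]_w ((st k.*2 w).2 * h (st k.*2 w).1)%:E)%E.
Let M' k := (\int[P]_w ((st k.*2.+1 w).2 * I (st k.*2.+1 w).1)%:E)%E.
Definition mean_up k := (\int[P]_w (up_gain q b (st k.*2 w, tau k w))%:E)%E.
Definition mean_ruin beta k :=
  (\int[P]_w (ruin_gain a beta (st k.*2.+1 w, C k w))%:E)%E.

Let st_ge0 k w : 0 <= (st k w).2. Proof. by have [/andP[]] := st_inv k w. Qed.

Let mstfst k : measurable_fun [set: T] (fun w => (st k w).1).
Proof. by apply: (measurableT_comp measurable_fst); exact: mst. Qed.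
Let mstsnd k : measurable_fun [set: T] (fun w => (st k w).2).
Proof. by apply: (measurableT_comp measurable_snd); exact: mst. Qed.

Let mpair k (Y : {RV P >-> R}) : measurable_fun [set: T] (fun w => (st k w, Y w)).
Proof. by apply: measurable_fun_pair => //; exact: mst. Qed.

Lemma one_step_T k : (M k = M' k + A%:E * mean_up k)%E.
Proof.
transitivity (\int[P]_w (FT (st k.*2 w, tau k w))%:E)%E.
  have F0 w v : 0 <= FT (st k.*2 w, v).
    by have := st_ge0 k.*2 w; case: (st _ w) => y D /= D0; exact: FT_ge0.
  have := integral_step mFT F0; rewrite V_even => ->.
  apply: eq_integral => w _; have [/andP[D0 _] yD] := st_inv k.*2 w.
  move: D0 yD; case: (st k.*2 w) => y D /= D0 yD.
  by rewrite (kernel lam_gt0 (tau_exp k) mFT FT_ge0 FT_D harmT).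
rewrite /mean_up /M' -ge0_integralZl_EFin//; last 2 first.
- move=> w _; rewrite lee_fin; have := st_ge0 k.*2 w.
  by case: (st _ w) => y D /=; exact: up_ge0.
- apply/measurable_EFinP; apply: (measurableT_comp (measurable_up_gain q b)).
  exact: mpair.
rewrite -ge0_integralD//.
- by apply: eq_integral => w _; rewrite stT /FT EFinD.
- by move=> w _; rewrite lee_fin mulr_ge0.
- apply/measurable_EFinP; apply: measurable_funM => //; exact: measurableT_comp.
- move=> w _; rewrite mule_ge0// lee_fin; have := st_ge0 k.*2 w.
  by case: (st _ w) => y D /=; exact: up_ge0.
- apply: measurable_funeM; apply/measurable_EFinP.
  by apply: (measurableT_comp (measurable_up_gain q b)); exact: mpair.
Qed.

Lemma one_step_C k : (M' k = M k.+1 + B%:E * mean_ruin (fun=> 1%R) k)%E.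
Proof.
transitivity (\int[P]_w (FC (st k.*2.+1 w, C k w))%:E)%E.
  have F0 w v : 0 <= FC (st k.*2.+1 w, v).
    by have := st_ge0 k.*2.+1 w; case: (st _ w) => y D /= D0; exact: FC_ge0.
  have := integral_step mFC F0; rewrite V_odd => ->.
  apply: eq_integral => w _; have [/andP[D0 _] yD] := st_inv k.*2.+1 w.
  move: D0 yD; case: (st k.*2.+1 w) => y D /= D0 yD.
  by rewrite (kernel ltr01 (C_exp k) mFC FC_ge0 FC_D harmC).
have mr := @measurable_ruin_gain R a (fun=> 1) (measurable_cst _).
rewrite /mean_ruin /M doubleS -ge0_integralZl_EFin//; last 2 first.
- move=> w _; rewrite lee_fin; have := st_ge0 k.*2.+1 w.
  by case: (st _ w) => y D D0; exact: (@ruin_ge0 (fun=> 1) _ _ _ (fun=> ler01) D0).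
- by apply/measurable_EFinP; apply: (measurableT_comp mr); exact: mpair.
rewrite -ge0_integralD//.
- by apply: eq_integral => w _; rewrite stC /FC EFinD.
- by move=> w _; rewrite lee_fin mulr_ge0.
- apply/measurable_EFinP; apply: measurable_funM => //; exact: measurableT_comp.
- move=> w _; rewrite mule_ge0// lee_fin; have := st_ge0 k.*2.+1 w.
  by case: (st _ w) => y D D0; exact: (@ruin_ge0 (fun=> 1) _ _ _ (fun=> ler01) D0).
- apply: measurable_funeM; apply/measurable_EFinP.
  by apply: (measurableT_comp mr); exact: mpair.
Qed.

Let mup k : measurable_fun [set: T] (fun w => up_gain q b (st k.*2 w, tau k w)).
Proof. by apply: (measurableT_comp (measurable_up_gain q b)); exact: mpair. Qed.

Let mruin k (beta : R -> R) : measurable_fun [set: R] beta ->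
  measurable_fun [set: T] (fun w => ruin_gain a beta (st k.*2.+1 w, C k w)).
Proof.
move=> mb; apply: (measurableT_comp (measurable_ruin_gain a mb)); exact: mpair.
Qed.

Lemma up_gain_ge0 k w t : 0 <= up_gain q b (st k w, t).
Proof. by have := st_ge0 k w; case: (st _ w) => y D /=; exact: up_ge0. Qed.

Lemma ruin_gain_ge0 (beta : R -> R) k w t : (forall v, 0 <= beta v) ->
  0 <= ruin_gain a beta (st k w, t).
Proof.
by move=> b0; have := st_ge0 k w; case: (st _ w) => y D D0; exact: (@ruin_ge0 beta _ _ _ b0 D0).
Qed.

Lemma mean_up_ge0 k : (0 <= mean_up k)%E.
Proof. by apply: integral_ge0 => w _; rewrite lee_fin up_gain_ge0. Qed.

Lemma mean_ruin_ge0 (beta : R -> R) k : (forall v, 0 <= beta v) ->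
  (0 <= mean_ruin beta k)%E.
Proof. by move=> b0; apply: integral_ge0 => w _; rewrite lee_fin ruin_gain_ge0. Qed.

Lemma harmonic_sum k : ((h z)%:E =
  A%:E * (\sum_(0 <= j < k) mean_up j)%E
  + B%:E * (\sum_(0 <= j < k) mean_ruin (fun=> 1%R) j)%E + M k)%E.
Proof.
elim: k => [|k ->].
  rewrite !big_geq// !mule0 !add0e /M /=.
  under eq_integral do rewrite mul1r.
  by rewrite integral_cst//= probability_setT mule1.
rewrite one_step_T one_step_C !big_nat_recr//=.
have SU0 : (0 <= \sum_(0 <= j < k) mean_up j)%E.
  by apply: sume_ge0 => i _; exact: mean_up_ge0.
have SR0 : (0 <= \sum_(0 <= j < k) mean_ruin (fun=> 1%R) j)%E.
  by apply: sume_ge0 => i _; apply: mean_ruin_ge0.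
have u0 := mean_up_ge0 k.
have r0 := @mean_ruin_ge0 (fun=> 1) k (fun=> ler01).
move: (mean_up k) (mean_ruin _ k) (M k.+1) SU0 SR0 u0 r0.
move: (\sum_(0 <= j < k) _)%E (\sum_(0 <= j < k) _)%E => s1 s2 x1 x2 m s10 s20 x10 x20.
rewrite (ge0_muleDr _ s10 x10) (ge0_muleDr _ s20 x20) -!addeA.
congr (_ + _)%E; rewrite [RHS]addeCA; congr (_ + _)%E.
by rewrite [RHS]addeCA addeC -addeA.
Qed.

Let mass k := (\int[P]_w ((st k w).2)%:E)%E.

Lemma mass_even k : (mass k.*2.+1 <= mass k.*2)%E.
Proof.
have ti0 (w : T) : 0 <= (st k.*2.+1 w).2 by exact: st_ge0.
apply: ge0_le_integral => //.
- by move=> w _; rewrite lee_fin.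
- by apply/measurable_EFinP; exact: mstsnd.
- by apply/measurable_EFinP; exact: mstsnd.
move=> w _; rewrite lee_fin stT; have := st_ge0 k.*2 w.
case: (st _ w) => y D /= D0; case: (boolP (_ && _)) => [/andP[t0 _]|_]; last by rewrite mulr0.
by rewrite mulr1 ler_piMr// -expR0 ler_expR oppr_le0 mulr_ge0.
Qed.

Lemma exp_le_prob k :
  (\int[distribution P (C k)]_v (((v <= b)%R)%:R : R)%:E = (1 - expR (- b))%:E)%E.
Proof.
have mle : measurable_fun [set: R] (fun v : R => ((v <= b)%R)%:R : R).
  by apply: measurable_natb; exact: measurable_fun_ler.
have mlt : measurable_fun [set: R] (fun v : R => ((b < v)%R)%:R : R).
  by apply: measurable_natb; exact: measurable_fun_ltr.
have H1 : (\int[distribution P (C k)]_v (((b < v)%R)%:R : R)%:E = (expR (- b))%:E)%E.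
  rewrite (ge0_integral_exponential_law _ _ _ _ 1)//; last exact/measurable_EFinP.
  under eq_integral do rewrite -EFinM.
  rewrite (@integral_natb _ _ `]b, +oo[%classic).
    by rewrite (exp_tail b ltr01) mul1r.
  move=> t /=; rewrite !in_itv/= !andbT; split => [bt|[]//].
  by split => //; rewrite ltW// (lt_trans b_gt0).
have : (\int[distribution P (C k)]_v (((v <= b)%R)%:R : R)%:E +
   \int[distribution P (C k)]_v (((b < v)%R)%:R : R)%:E = 1)%E.
  rewrite -ge0_integralD//; last 2 first.
  - exact/measurable_EFinP.
  - exact/measurable_EFinP.
  rewrite -(@probability_setT _ _ _ (distribution P (C k))).
  rewrite -[RHS]mul1e -[RHS]integral_cst//.
  by apply: eq_integral => v _; rewrite /= ltNge; case: (v <= b); rewrite /= ?adde0 ?add0e.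
rewrite H1 => /(congr1 (fun e => e - (expR (- b))%:E)%E).
by rewrite addeK.
Qed.

Lemma mass_odd k : (mass k.*2.+2 <= (1 - expR (- b))%:E * mass k.*2.+1)%E.
Proof.
pose F (sv : (R * R) * R) := `|(claim a sv).2|.
have mF : measurable_fun [set: (R * R) * R] F.
  apply: measurableT_comp => //.
  by apply: (measurableT_comp measurable_snd); exact: measurable_claim.
have F0 w v : 0 <= F (st k.*2.+1 w, v) by rewrite /F.
have := integral_step mF F0; rewrite V_odd => IS.
have -> : mass k.*2.+2 = (\int[P]_w (F (st k.*2.+1 w, C k w))%:E)%E.
  by apply: eq_integral => w _; rewrite /F -stC ger0_norm.
rewrite IS -ge0_integralZl_EFin//; last 3 first.
- by move=> w _; rewrite lee_fin.
- by apply/measurable_EFinP; exact: mstsnd.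
- by rewrite subr_ge0 -expR0 ler_expR oppr_le0 ltW.
apply: ge0_le_integral => //.
- by move=> w _; apply: integral_ge0 => v _; rewrite lee_fin.
- have mFE : measurable_fun [set: (R * R) * R] (EFin \o F) by exact/measurable_EFinP.
  have FE0 (sv : (R * R) * R) : (0 <= (EFin \o F) sv)%E by rewrite lee_fin /F.
  have mFF := @measurable_fun_fubini_tonelli_F _ _ _ _ _ (distribution P (C k)) _ mFE FE0.
  by apply: (measurableT_comp mFF); exact: mst.
- by apply: measurable_funeM; apply/measurable_EFinP; exact: mstsnd.
move=> w _; have [/andP[D0 _] yD] := st_inv k.*2.+1 w.
move: D0 yD {F0 IS}; rewrite /F; case: (st _ w) => y D /= D0 yD.
have mle : measurable_fun [set: R] (fun v : R => ((v <= b)%R)%:R : R).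
  by apply: measurable_natb; exact: measurable_fun_ler.
rewrite -(exp_le_prob k) muleC -ge0_integralZl_EFin//; last exact/measurable_EFinP.
apply: ge0_le_integral => //.
- apply/measurable_EFinP; apply: (measurableT_comp mF (msv (y, D))).
- by apply: measurable_funeM; exact/measurable_EFinP.
move=> v _; rewrite -EFinM lee_fin ger0_norm ?mulr_ge0//.
case: yD => [->|/andP[ay yb]]; first by rewrite !mul0r.
rewrite ler_wpM2l// ler_nat; case: (boolP (_ && _)) => // /andP[v0 av].
by rewrite (le_trans _ yb)//; move: av; rewrite lerBrDr; apply: le_trans; rewrite lerDr.
Qed.

Lemma mass_le k : (mass k.*2 <= ((1 - expR (- b)) ^+ k)%:E)%E.
Proof.
have r0 : 0 <= 1 - expR (- b) by rewrite subr_ge0 -expR0 ler_expR oppr_le0 ltW.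
elim: k => [|k IH].
  by rewrite /mass /= integral_cst//= probability_setT mul1e.
rewrite doubleS (le_trans (mass_odd k))// exprS EFinM lee_wpmul2l ?lee_fin//.
exact: le_trans (mass_even k) IH.
Qed.

Definition degenerate : set T :=
  (\bigcup_i (tau i @^-1` `]-oo, 0])) `|` (\bigcup_i (C i @^-1` `]-oo, 0])).
Let Nul := degenerate.

Lemma measurable_degenerate : measurable degenerate.
Proof.
have m (Y : {RV P >-> R}) : measurable (Y @^-1` `]-oo, 0]).
  by rewrite -[X in measurable X]setTI; exact: measurable_funP.
by apply: measurableU; apply: bigcup_measurable => i _; exact: m.
Qed.

Let mNul := measurable_degenerate.

Lemma degenerate_null : P degenerate = 0%E.
Proof.
have m (Y : {RV P >-> R}) : measurable (Y @^-1` `]-oo, 0]).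
  by rewrite -[X in measurable X]setTI; exact: measurable_funP.
apply: measure_negligible => //; apply: negligibleU; apply: negligible_bigcup => i.
  by apply/negligibleP; [exact: m|exact: exponential_law_le0 (tau_exp i)].
by apply/negligibleP; [exact: m|exact: exponential_law_le0 (C_exp i)].
Qed.

Let nneseries_eventually (f : nat -> R) (l : R) k0 :
  (forall k, (k0 <= k)%N -> \sum_(j < k) f j = l) ->
  (\sum_(0 <= j <oo) (f j)%:E = l%:E)%E.
Proof.
move=> H; apply/cvg_lim => //; apply: cvg_near_cst.
by exists k0 => // k /= kk; rewrite sumEFin big_mkord H.
Qed.

Let path w := fun t => X z t w.

Lemma payoff_series (beta : R -> R) w : ~ degenerate w ->
  (up_payoff q a b (path w))%:E =
    (\sum_(0 <= j <oo) (up_gain q b (st j.*2 w, tau j w))%:E)%E /\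
  (ruin_payoff q a b beta (path w))%:E =
    (\sum_(0 <= j <oo) (ruin_gain a beta (st j.*2.+1 w, C j w))%:E)%E.
Proof.
move=> nNul.
have t0 i : 0 < tau i w.
  by rewrite ltNge; apply/negP => ti; apply: nNul; left; exists i; rewrite //= in_itv.
have c0 i : 0 < C i w.
  by rewrite ltNge; apply/negP => ti; apply: nNul; right; exists i; rewrite //= in_itv.
have [k0 _ Hk] := @stage_limit R a b q z beta (fun i => tau i w) (fun i => C i w)
  (fun t => N t w) (path w) (fun k => st k w) a_ge0 ab b_gt0 az zb t0 c0
  (fun k t => @NE t w k) (X_segerdahl z w) erefl (fun k => stT k w)
  (fun k => stC k w).
by split; apply/esym; apply: (@nneseries_eventually _ _ k0) => k /Hk[].
Qed.

Lemma ae_payoff (beta : R -> R) : {ae P, forall w,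
  (up_payoff q a b (path w))%:E =
    (\sum_(0 <= j <oo) (up_gain q b (st j.*2 w, tau j w))%:E)%E /\
  (ruin_payoff q a b beta (path w))%:E =
    (\sum_(0 <= j <oo) (ruin_gain a beta (st j.*2.+1 w, C j w))%:E)%E}.
Proof.
exists Nul; split => //; first exact: degenerate_null.
by move=> w /= H; apply: contrapT => nNul; apply: H; exact: payoff_series.
Qed.

Let ge0_expectation_ae (f : T -> R) (g : T -> \bar R) : (forall w, 0 <= f w) ->
  (forall w, (0 <= g w)%E) -> measurable_fun [set: T] g ->
  {ae P, forall w, (f w)%:E = g w} -> ('E_P[f] = \int[P]_w g w)%E.
Proof.
move=> f0 g0 mg fg; rewrite unlock.
by apply: ge0_ae_eq_integral_nomeas => // w; rewrite lee_fin.
Qed.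

Lemma up_payoff_ge0 x : 0 <= up_payoff q a b x.
Proof.
by rewrite /up_payoff /discount mulr_ge0//; case: (passage_above b x) => //= r.
Qed.

Lemma ruin_payoff_ge0 (beta : R -> R) x : (forall v, 0 <= beta v) ->
  0 <= ruin_payoff q a b beta x.
Proof.
move=> b0; rewrite /ruin_payoff mulr_ge0//; case: (passage_below a x) => //= r.
by rewrite mulr_ge0// expR_ge0.
Qed.

Lemma measurable_ruin_payoff (beta : R -> R) : measurable_fun [set: R] beta ->
  (forall v, 0 <= beta v) -> measurable_fun [set: T]
    ((fun w => (ruin_payoff q a b beta (path w))%:E) \_ (~` degenerate)).
Proof.
move=> mb b0; apply/(measurable_restrictT _ (measurableC mNul)).
apply: (@eq_measurable_fun _ _ _ _ _ (fun w =>
  (\sum_(0 <= j <oo) (ruin_gain a beta (st j.*2.+1 w, C j w))%:E)%E)).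
  by move=> w /set_mem nw; have [_ ->] := payoff_series beta nw.
apply: ge0_emeasurable_sum => //.
  by move=> j w _ _; rewrite lee_fin ruin_gain_ge0.
by move=> j _; apply/measurable_EFinP/measurable_funTS; exact: mruin.
Qed.

Lemma expectation_up : ('E_P[fun w => up_payoff q a b (path w)] =
  \sum_(0 <= j <oo) mean_up j)%E.
Proof.
have up0 j w : (0 <= (up_gain q b (st j.*2 w, tau j w))%:E)%E.
  by rewrite lee_fin up_gain_ge0.
have mE j : measurable_fun [set: T] (fun w => (up_gain q b (st j.*2 w, tau j w))%:E).
  by apply/measurable_EFinP; exact: mup.
rewrite (@ge0_expectation_ae _ (fun w =>
  (\sum_(0 <= j <oo) (up_gain q b (st j.*2 w, tau j w))%:E)%E)).
- by rewrite integral_nneseries.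
- by move=> w; exact: up_payoff_ge0.
- by move=> w; apply: nneseries_ge0.
- by apply: ge0_emeasurable_sum.
- by apply: filterS (ae_payoff (fun=> 1)) => w [].
Qed.

Lemma expectation_ruin (beta : R -> R) : measurable_fun [set: R] beta ->
  (forall v, 0 <= beta v) ->
  ('E_P[fun w => ruin_payoff q a b beta (path w)] =
  \sum_(0 <= j <oo) mean_ruin beta j)%E.
Proof.
move=> mb b0.
have r0 j w : (0 <= (ruin_gain a beta (st j.*2.+1 w, C j w))%:E)%E.
  by rewrite lee_fin ruin_gain_ge0.
have mE j : measurable_fun [set: T] (fun w => (ruin_gain a beta (st j.*2.+1 w, C j w))%:E).
  by apply/measurable_EFinP; exact: mruin.
rewrite (@ge0_expectation_ae _ (fun w =>
  (\sum_(0 <= j <oo) (ruin_gain a beta (st j.*2.+1 w, C j w))%:E)%E)).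
- by rewrite integral_nneseries.
- by move=> w; exact: ruin_payoff_ge0.
- by move=> w; apply: nneseries_ge0.
- by apply: ge0_emeasurable_sum.
- by apply: filterS (ae_payoff beta) => w [].
Qed.

Lemma mean_ruin_overshoot (beta : R -> R) (kap : R) k :
  measurable_fun [set: R] beta -> (forall v, 0 <= beta v) -> 0 <= kap ->
  (forall m, 0 <= m -> (\int[mu]_(c in `[0%R, +oo[)
    ((1 * beta (m - c) * ((m - c < 0)%R)%:R) * (1 * expR (- (1 * c))))%:E
    = (kap * expR (- m))%:E)%E) ->
  (mean_ruin beta k =
   kap%:E * \int[P]_w ((st k.*2.+1 w).2 * expR (- ((st k.*2.+1 w).1 - a)))%:E)%E.
Proof.
move=> mb b0 kap0 Hov.
have F0 w v : 0 <= ruin_gain a beta (st k.*2.+1 w, v) by exact: ruin_gain_ge0.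
have := integral_step (measurable_ruin_gain a mb) F0; rewrite V_odd => IS.
rewrite /mean_ruin IS -ge0_integralZl_EFin//; last 2 first.
- by move=> w _; rewrite lee_fin mulr_ge0 ?expR_ge0.
- apply/measurable_EFinP; apply: measurable_funM => //.
  apply: (measurableT_comp (@measurable_expR R)).
  by apply: (measurableT_comp (f := @GRing.opp R)) => //; exact: measurable_funB.
apply: eq_integral => w _; have [/andP[D0 _] yD] := st_inv k.*2.+1 w.
move: D0 yD {F0 IS}; case: (st _ w) => y D D0 yD; rewrite -EFinM.
rewrite (kernel ltr01 (C_exp k) (measurable_ruin_gain a mb)
  (f := fun y => kap * expR (- (y - a))))//; last 3 first.
- by move=> y' D' t D'0; exact: ruin_ge0.
- by move=> y' D' t; rewrite /ruin_gain; ring.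
- move=> y' /andP[ay' yb']; rewrite -Hov ?subr_ge0//.
  by apply: eq_integral => c _; rewrite /ruin_gain/= -(subr_lt0 a (y' - c)) [y' - c - a]addrAC.
by rewrite /= mulrCA.
Qed.

Lemma ruin_overshoot (beta : R -> R) (kap : R) :
  measurable_fun [set: R] beta -> (forall v, 0 <= beta v) -> 0 <= kap ->
  (forall m, 0 <= m -> (\int[mu]_(c in `[0%R, +oo[)
    ((1 * beta (m - c) * ((m - c < 0)%R)%:R) * (1 * expR (- (1 * c))))%:E
    = (kap * expR (- m))%:E)%E) ->
  ('E_P[fun w => ruin_payoff q a b beta (path w)] =
   kap%:E * 'E_P[fun w => ruin_payoff q a b (fun=> 1%R) (path w)])%E.
Proof.
move=> mb b0 kap0 Hov; rewrite !expectation_ruin//.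
have one_ov m : 0 <= m -> (\int[mu]_(c in `[0%R, +oo[)
    ((1 * 1 * ((m - c < 0)%R)%:R) * (1 * expR (- (1 * c))))%:E
    = (1 * expR (- m))%:E)%E.
  move=> m0; under eq_integral do rewrite !mul1r.
  rewrite (@integral_natb _ _ `]m, +oo[%classic) => [|t /=].
    rewrite mul1r -[in RHS](mul1r m) -(exp_tail m ltr01).
    by apply: eq_integral => t _; rewrite !mul1r.
  rewrite !in_itv/= !andbT subr_lt0; split => [mt|[]//].
  by split => //; rewrite (le_trans m0)// ltW.
rewrite -nneseriesZl; last by move=> j _; apply: mean_ruin_ge0.
apply: eq_eseriesr => j _.
rewrite (mean_ruin_overshoot j mb b0 kap0 Hov).
by rewrite (mean_ruin_overshoot j (measurable_cst _) (fun=> ler01) ler01 one_ov) mul1e.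
Qed.

Variable K : R.
Hypothesis h_le : forall y, a <= y <= b -> h y <= K.

Let M_cvg0 : M k @[k --> \oo] --> 0%E.
Proof.
have K0 : 0 <= K by rewrite (le_trans (h_ge0 z))// h_le// az zb.
have r0 : 0 <= 1 - expR (- b) by rewrite subr_ge0 -expR0 ler_expR oppr_le0 ltW.
have M_ge0 k : (0 <= M k)%E.
  by apply: integral_ge0 => w _; rewrite lee_fin mulr_ge0.
have M_le k : (M k <= (K * (1 - expR (- b)) ^+ k)%:E)%E.
  apply: (@le_trans _ _ (K%:E * mass k.*2)%E); last first.
    by rewrite EFinM lee_wpmul2l ?lee_fin// mass_le.
  rewrite /mass -ge0_integralZl_EFin//; last 2 first.
  - by move=> w _; rewrite lee_fin.
  - by apply/measurable_EFinP; exact: mstsnd.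
  apply: ge0_le_integral => //.
  - by move=> w _; rewrite lee_fin mulr_ge0.
  - apply/measurable_EFinP; apply: measurable_funM => //.
    exact: measurableT_comp.
  - by apply: measurable_funeM; apply/measurable_EFinP; exact: mstsnd.
  move=> w _; rewrite -EFinM lee_fin mulrC.
  have [/andP[D0 _] yD] := st_inv k.*2 w.
  case: yD => [->|yab]; first by rewrite !mulr0.
  by rewrite ler_wpM2r// h_le.
apply: (squeeze_cvge (f := fun=> 0%E) (h := fun k => (K * (1 - expR (- b)) ^+ k)%:E)).
- by near=> k; rewrite M_ge0 M_le.
- exact: cvg_cst.
- apply: cvg_EFin; first exact: nearW.
  rewrite -[X in _ --> X](mulr0 K); apply: cvgM; first exact: cvg_cst.
  apply: cvg_expr; rewrite ger0_norm// ltrBlDr ltrDl expR_gt0.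
Unshelve. all: by end_near. Qed.

Lemma harmonic_series : ((h z)%:E =
  A%:E * (\sum_(0 <= j <oo) mean_up j)%E
  + B%:E * (\sum_(0 <= j <oo) mean_ruin (fun=> 1%R) j)%E)%E.
Proof.
set u := (\sum_(0 <= j <oo) mean_up j)%E.
set v := (\sum_(0 <= j <oo) mean_ruin (fun=> 1%R) j)%E.
have mr0 j : (0 <= mean_ruin (fun=> 1%R) j)%E by apply: mean_ruin_ge0.
have u0 : (0 <= u)%E by apply: nneseries_ge0 => j _ _; exact: mean_up_ge0.
have v0 : (0 <= v)%E by apply: nneseries_ge0 => j _ _; exact: mr0.
have cu : (\sum_(0 <= j < k) mean_up j)%E @[k --> \oo] --> u.
  by apply: is_cvg_nneseries => j _ _; exact: mean_up_ge0.
have cv : (\sum_(0 <= j < k) mean_ruin (fun=> 1%R) j)%E @[k --> \oo] --> v.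
  by apply: is_cvg_nneseries => j _ _; exact: mr0.
have H : (A%:E * (\sum_(0 <= j < k) mean_up j)%E
   + B%:E * (\sum_(0 <= j < k) mean_ruin (fun=> 1%R) j)%E + M k)%E
   @[k --> \oo] --> (A%:E * u + B%:E * v + 0)%E.
  apply: cvgeD; first by rewrite ge0_adde_def// inE ?adde_ge0// mule_ge0.
    apply: cvgeD.
    - by rewrite ge0_adde_def// inE mule_ge0.
    - by apply: cvgeZl.
    - by apply: cvgeZl.
  exact: M_cvg0.
have H2 : (fun k => (A%:E * (\sum_(0 <= j < k) mean_up j)%E
   + B%:E * (\sum_(0 <= j < k) mean_ruin (fun=> 1%R) j)%E + M k)%E) = fun=> (h z)%:E.
  by apply/funext => k; rewrite -harmonic_sum.
rewrite H2 adde0 in H.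
exact: (cvg_unique _ (cvg_cst _) H).
Qed.

Lemma two_sided_identity : ((h z)%:E =
  A%:E * upcross P X q a b z + B%:E * Psi_two_sided P X q b z a)%E.
Proof.
rewrite harmonic_series -expectation_up -expectation_ruin//.
congr (_ + _ * _)%E; rewrite /Psi_two_sided; congr ('E_P[_])%E.
apply/funext => w; rewrite /ruin_payoff /discount.
by congr (_ * _); case: (passage_below _ _) => // r; rewrite mulr1.
Qed.

End harmonic.

End stopping.

(** * The one-sided ruin problem *)

Definition ruin_reward {R : realType} (q a : R) (beta : R -> R) (x : R -> R) : R :=
  if passage_below a x is t%:E then expR (- (q * t)) * beta (x t - a) else 0.

Section one_sided.
Context d (T : measurableType d) (R : realType) (P : probability T R).
Variables (lam q : R) (N : R -> T -> nat) (C tau : nat -> {RV P >-> R})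
  (X : R -> R -> T -> R).
Hypotheses (lam_gt0 : 0 < lam) (q_ge0 : 0 <= q)
  (tau_exp : forall i, exponential_law lam (tau i))
  (tau_indep : mutual_independence P
     (fun i => preimage_set_system setT (tau i) measurable))
  (NE : forall (t : R) (w : T) (k : nat), 0 <= t ->
          (k <= N t w)%N = (\sum_(i < k) tau i w <= t))
  (C_exp : forall i, exponential_law 1 (C i))
  (C_indep : independent_marks N C)
  (X_segerdahl : forall z w,
     segerdahl_path 0 1 (fun t => compound N C t w) z (fun t => X z t w)).
Notation mu := (@lebesgue_measure R).

Variables (a z : R).
Hypotheses (a_ge0 : 0 <= a) (az : a <= z).

Let path w := fun t => X z t w.
Let lev (n : nat) : R := z + n.+1%:R.
Let lev_gt0 n : 0 < lev n.
Proof. by rewrite /lev ltr_wpDl// (le_trans a_ge0). Qed.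
Let z_lev n : z <= lev n. Proof. by rewrite /lev lerDl. Qed.
Let a_lev n : a <= lev n. Proof. exact: le_trans az (z_lev n). Qed.

Let D0 := degenerate C tau.

Let tau_pos w : ~ D0 w -> forall i, 0 < tau i w.
Proof.
move=> nD i; rewrite ltNge; apply/negP => ti; apply: nD; left.
by exists i; rewrite //= in_itv.
Qed.

Lemma passage_above_homo (b b' : R) x : b <= b' ->
  (passage_above b x <= passage_above b' x)%E.
Proof.
move=> bb; apply: le_ereal_inf_tmp => _ [t [t0 bx] <-].
by apply: ereal_inf_lbound; exists t => //; split => //; exact: le_lt_trans bx.
Qed.

Lemma ruin_payoff_reward beta w : ~ D0 w ->
  exists n0, forall n, (n0 <= n)%N ->
    ruin_payoff q a (lev n) beta (path w) = ruin_reward q a beta (path w).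
Proof.
move=> nD; rewrite /ruin_payoff /ruin_reward.
case E : (passage_below a (path w)) => [t| |]; last 2 first.
- by exists 0%N => n _; rewrite mul0r.
- by exists 0%N => n _; rewrite mul0r.
have t0 : 0 <= t.
  rewrite -lee_fin -E; apply: passage_below_ge => u u0 /(le_lt_trans u0).
  by rewrite ltxx.
have [k tk] := sig_unbounded (tau := fun i => tau i w) (Nt := fun t => N t w)
  (fun k t => @NE t w k) t.
have [B HB] := @path_bounded R z (fun i => tau i w) (fun i => C i w)
  (fun t => N t w) (path w) (tau_pos nD) (fun k t => @NE t w k)
  (X_segerdahl z w) k.
exists (Num.trunc `|B|) => n kn.
rewrite (_ : (_ < passage_above _ _)%E) ?mulr1//.
apply: (@lt_le_trans _ _ (\sum_(i < k) tau i w)%:E); first by rewrite lte_fin.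
apply: passage_above_ge => u u0 uk; rewrite (le_trans (HB u u0 uk))//.
rewrite (le_trans (ler_norm _))// /lev.
have : `|B| < (Num.trunc `|B|).+1%:R by rewrite truncnS_gt.
have : (Num.trunc `|B|).+1%:R <= n.+1%:R :> R by rewrite ler_nat.
have := le_trans a_ge0 az; lra.
Qed.

Lemma expectation_reward (beta : R -> R) : measurable_fun [set: R] beta ->
  (forall v, 0 <= beta v) ->
  ('E_P[fun w => ruin_payoff q a (lev n) beta (path w)] @[n --> \oo] -->
  'E_P[fun w => ruin_reward q a beta (path w)])%E.
Proof.
move=> mb b0.
pose g n : T -> \bar R := (fun w => (ruin_payoff q a (lev n) beta (path w))%:E) \_ (~` D0).
pose g' : T -> \bar R := (fun w => (ruin_reward q a beta (path w))%:E) \_ (~` D0).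
have mD0 : measurable D0 by exact: measurable_degenerate.
have D00 : P D0 = 0%E by exact: (degenerate_null tau_exp C_exp).
have mg n : measurable_fun [set: T] (g n).
  exact: (measurable_ruin_payoff q_ge0 NE X_segerdahl a_ge0 (a_lev n)
    (lev_gt0 n) az (z_lev n) mb b0).
have reward_ge0 x : 0 <= ruin_reward q a beta x.
  rewrite /ruin_reward; case: (passage_below a x) => // r.
  by rewrite mulr_ge0// expR_ge0.
have Eg n : ('E_P[fun w => ruin_payoff q a (lev n) beta (path w)] = \int[P]_w g n w)%E.
  rewrite unlock; apply: ge0_ae_eq_integral_nomeas => //.
  - by move=> w; rewrite lee_fin ruin_payoff_ge0.
  - by move=> w; apply: erestrict_ge0 => u _; rewrite lee_fin ruin_payoff_ge0.
  exists D0; split => // w /= H; apply: contrapT => nD; apply: H.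
  by rewrite /g patchE mem_set.
have gcvg w : g n w @[n --> \oo] --> g' w.
  rewrite /g /g'; have [Dw|nD] := pselect (D0 w).
    have pD (f : T -> \bar R) : (f \_ (~` D0)) w = 0%E.
      by rewrite patchE memNset//= => nDw; exact: (nDw Dw).
    by apply: cvg_near_cst; exists 0%N => // n _; rewrite !pD.
  have pN (f : T -> \bar R) : (f \_ (~` D0)) w = f w by rewrite patchE mem_set.
  have [n0 Hn] := ruin_payoff_reward beta nD.
  by apply: cvg_near_cst; exists n0 => // n /= nn; rewrite !pN Hn.
have limg w : limn (g ^~ w) = g' w by apply/cvg_lim => //; exact: gcvg.
have mg' : measurable_fun [set: T] g'.
  by apply: emeasurable_fun_cvg mg _ => w _; exact: gcvg.
have Eg' : ('E_P[fun w => ruin_reward q a beta (path w)] = \int[P]_w g' w)%E.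
  rewrite unlock; apply: ge0_ae_eq_integral_nomeas => //.
  - by move=> w; rewrite lee_fin.
  - by move=> w; apply: erestrict_ge0 => u _; rewrite lee_fin.
  exists D0; split => // w /= H; apply: contrapT => nD; apply: H.
  by rewrite /g' patchE mem_set.
rewrite Eg'; under eq_cvg do rewrite Eg.
have -> : (\int[P]_w g' w = \int[P]_w limn (g ^~ w))%E.
  by apply: eq_integral => w _; rewrite limg.
apply: cvg_monotone_convergence => //.
- by move=> n w _; apply: erestrict_ge0 => u _; rewrite lee_fin ruin_payoff_ge0.
- move=> w _ n m nm; rewrite /g !patchE; case: ifP => // _.
  rewrite lee_fin /ruin_payoff ler_wpM2l//; first exact: reward_ge0.
  rewrite ler_nat; have : (passage_above (lev n) (path w) <= passage_above (lev m) (path w))%E.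
    by apply: passage_above_homo; rewrite /lev lerD2l ler_nat.
  by case: (ltP _ (passage_above (lev n) _)) => //= h1 h2; rewrite (lt_le_trans h1 h2).
Qed.

Lemma Psi_limit : Psi_two_sided P X q (lev n) z a @[n --> \oo] --> Psi P X q z a.
Proof.
have H := @expectation_reward (fun=> 1) (measurable_cst _) (fun=> ler01).
have -> : Psi P X q z a = 'E_P[fun w => ruin_reward q a (fun=> 1%R) (path w)]%E.
  congr ('E_P[_])%E; apply/funext => w; rewrite /ruin_reward /discount.
  by case: (passage_below _ _) => // r; rewrite mulr1.
apply: cvg_trans H; apply: near_eq_cvg; near=> n.
congr ('E_P[_])%E; apply/funext => w; rewrite /ruin_payoff /discount.
by congr (_ * _); case: (passage_below _ _) => // r; rewrite mulr1.
Unshelve. all: by end_near. Qed.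

Lemma overshoot_exp (theta m : R) : -1 < theta -> 0 <= m ->
  (\int[mu]_(c in `[0%R, +oo[)
    ((1 * expR (theta * (m - c)) * ((m - c < 0)%R)%:R) * (1 * expR (- (1 * c))))%:E
    = ((1 + theta)^-1 * expR (- m))%:E)%E.
Proof.
move=> theta1 m0; have th0 : 0 < 1 + theta by lra.
transitivity (\int[mu]_(c in `[0%R, +oo[) (((m - c < 0)%R)%:R *
   ((1 + theta)^-1 * expR (theta * m) * ((1 + theta) * expR (- ((1 + theta) * c)))))%:E)%E.
  apply: eq_integral => c _; congr EFin.
  have -> : expR (- ((1 + theta) * c)) = expR (- (theta * c)) * expR (- (1 * c)).
    by rewrite -expRD; congr expR; ring.
  rewrite mulrBr expRD; field; lra.
rewrite (@integral_natb _ _ `]m, +oo[%classic) => [|t /=]; last first.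
  rewrite !in_itv/= !andbT subr_lt0; split => [mt|[]//].
  by split => //; rewrite (le_trans m0)// ltW.
under eq_integral do rewrite EFinM.
rewrite ge0_integralZl_EFin//; last 3 first.
- by move=> t _; rewrite lee_fin mulr_ge0 ?expR_ge0// ltW.
- by apply/measurable_EFinP/measurable_funTS; exact: measurable_exp_density.
- by rewrite mulr_ge0 ?expR_ge0// invr_ge0 ltW.
rewrite exp_tail// -EFinM -mulrA -expRD; congr (_ * expR _)%:E; ring.
Qed.

Lemma Psi_theta_overshoot theta : -1 < theta ->
  Psi_theta P X q z a theta = (Psi P X q z a * ((1 + theta)^-1)%:E)%E.
Proof.
move=> theta1.
have mb : measurable_fun [set: R] (fun v : R => expR (theta * v)).
  by apply: (measurableT_comp (@measurable_expR R)); exact: measurable_funM.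
have b0 (v : R) : 0 <= expR (theta * v) by exact: expR_ge0.
have k0 : 0 <= (1 + theta)^-1 by rewrite invr_ge0; lra.
have H := expectation_reward mb b0.
have -> : Psi_theta P X q z a theta =
    'E_P[fun w => ruin_reward q a (fun v => expR (theta * v)) (path w)]%E.
  congr ('E_P[_])%E; apply/funext => w; rewrite /ruin_reward.
  by case: (passage_below _ _) => // r; rewrite expRD.
have H2 : (((1 + theta)^-1)%:E * Psi_two_sided P X q (lev n) z a)%E @[n --> \oo]
    --> (((1 + theta)^-1)%:E * Psi P X q z a)%E.
  by apply: cvgeZl => //; exact: Psi_limit.
rewrite muleC; apply: (cvg_unique _ _ H2) => //.
apply: cvg_trans H; apply: near_eq_cvg; near=> n.
rewrite (ruin_overshoot q_ge0 tau_exp tau_indep NE C_exp C_indep X_segerdahl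
  a_ge0 (a_lev n) (lev_gt0 n) az (z_lev n) mb b0 k0 (fun m => overshoot_exp theta1)).
congr (_ * 'E_P[_])%E; apply/funext => w; rewrite /ruin_payoff /discount.
by congr (_ * _); case: (passage_below _ _) => // r; rewrite mulr1.
Unshelve. all: by end_near. Qed.

End one_sided.

(** * Harmonic pairs *)

Section ftc.
Context {R : realType}.
Notation mu := (@lebesgue_measure R).
Implicit Types (f F : R -> R) (a b : R).

Lemma is_derive_continuous f (x l : R) : is_derive x 1 f l -> {for x, continuous f}.
Proof. by move=> [df _]; exact/differentiable_continuous/derivable1_diffP. Qed.

Lemma FTC_cc f F a b : a < b -> (forall x, a <= x <= b -> {for x, continuous f}) ->
  (forall x : R, a <= x <= b -> is_derive x 1 F (f x)) ->
  (\int[mu]_(x in `[a, b]) (f x)%:E = (F b - F a)%:E)%E.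
Proof.
move=> ab cf dF; rewrite EFinB (@continuous_FTC2 _ f F)//.
- apply: continuous_in_subspaceT => x /set_mem; rewrite /= in_itv/=; exact: cf.
- split.
  + move=> x; rewrite in_itv/= => /andP[ax xb].
    by apply: (@ex_derive _ _ _ _ _ _ _ (dF x _)); rewrite !ltW.
  + apply: cvg_at_right_filter; apply: is_derive_continuous (dF a _).
    by rewrite lexx ltW.
  + apply: cvg_at_left_filter; apply: is_derive_continuous (dF b _).
    by rewrite lexx ltW.
- move=> x; rewrite in_itv/= => /andP[ax xb]; rewrite derive1E.
  by apply: derive_val; apply: dF; rewrite !ltW.
Qed.

Lemma ge0_FTC_oo f F a b (Fa Fb : R) : a < b ->
  (forall x, a < x < b -> 0 <= f x) ->
  (forall x, a < x < b -> {for x, continuous f}) ->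
  (forall x : R, a < x < b -> is_derive x 1 F (f x)) ->
  F x @[x --> a^'+] --> Fa -> F x @[x --> b^'-] --> Fb ->
  (\int[mu]_(x in `]a, b[) (f x)%:E = (Fb - Fa)%:E)%E.
Proof.
move=> ab f0 cf dF FFa FFb.
pose e (n : nat) : R := (b - a) / 3%:R * n.+1%:R^-1.
have e0 n : 0 < e n by rewrite /e !mulr_gt0// ?subr_gt0// invr_gt0.
have e3 n : e n <= (b - a) / 3%:R.
  rewrite /e ler_piMr ?divr_ge0 ?subr_ge0 ?(ltW ab)//.
  by rewrite invf_le1// ler1n.
have ecv : e n @[n --> \oo] --> 0.
  rewrite -[X in _ --> X](mulr0 ((b - a) / 3%:R)).
  by apply: cvgM; [exact: cvg_cst|exact: cvg_harmonic].
pose S n : set R := `[a + e n, b - e n]%classic.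
have aebe n : a + e n < b - e n by have := e3 n; lra.
have SE : `]a, b[%classic = \bigcup_n S n.
  apply/seteqP; split=> x /=.
    rewrite in_itv/= => /andP[ax xb].
    have m0 : 0 < Order.min (x - a) (b - x) by rewrite lt_min !subr_gt0 ax.
    have [n _ Hn] := cvgr_lt 0 ecv _ m0.
    exists n => //; rewrite /S /= in_itv/=.
    have := Hn n (leqnn n); rewrite /= lt_min => /andP[h1 h2].
    by apply/andP; split; lra.
  move=> [n _]; rewrite /S /= !in_itv/= => /andP[h1 h2].
  by apply/andP; split; have := e0 n; lra.
have SI n x : S n x -> a < x < b.
  rewrite /S /= in_itv/= => /andP[h1 h2].
  by apply/andP; split; have := e0 n; lra.
have H : (\int[mu]_(x in S n) (f x)%:E)%E @[n --> \oo] -->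
    (\int[mu]_(x in `]a, b[) (f x)%:E)%E.
  rewrite SE; apply: ge0_nondecreasing_set_cvg_integral.
  - apply/nondecreasing_seqP => n; rewrite subsetEset => x.
    rewrite /S /= !in_itv/= => /andP[h1 h2].
    have : e n.+1 <= e n.
      rewrite /e ler_wpM2l ?divr_ge0 ?subr_ge0 ?(ltW ab)//.
      by rewrite lef_pV2 ?posrE// ler_nat.
    by move=> h3; apply/andP; split; lra.
  - by move=> n; exact: measurable_itv.
  - move=> n; apply/measurable_EFinP.
    apply: (@measurable_funS _ _ _ _ `]a, b[%classic) => //; first by move=> x /SI.
    apply: open_continuous_measurable_fun => // x /set_mem.
    by rewrite /= in_itv/=; exact: cf.
  - by move=> n x /SI xab; rewrite lee_fin f0.
have Eint n : (\int[mu]_(x in S n) (f x)%:E = (F (b - e n) - F (a + e n))%:E)%E.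
  by apply: FTC_cc => // x xe; [apply: cf|apply: dF]; apply: (SI n); rewrite /S /= in_itv.
have H2 : (F (b - e n) - F (a + e n))%:E @[n --> \oo] --> (Fb - Fa)%:E.
  apply: cvg_EFin; first exact: nearW.
  apply: cvgB.
    apply: (cvg_at_leftP F b Fb).1 => //; split; first by move=> n; rewrite gtrBl.
    by rewrite -[X in _ --> X]subr0; apply: cvgB => //; exact: cvg_cst.
  apply: (cvg_at_rightP F a Fa).1 => //; split; first by move=> n; rewrite ltrDl.
  by rewrite -[X in _ --> X]addr0; apply: cvgD => //; exact: cvg_cst.
by rewrite (eq_cvg _ _ Eint) in H; exact: (cvg_unique _ H H2).
Qed.

End ftc.

Lemma is_derive_ge0_le {R : realType} (f f' : R -> R) (a b : R) : a <= b ->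
  (forall x : R, a <= x <= b -> is_derive x 1 f (f' x)) ->
  (forall x, a <= x <= b -> 0 <= f' x) -> f a <= f b.
Proof.
move=> ab df f'0; rewrite -subr_ge0.
have dfo (x : R) : x \in `]a, b[ -> is_derive x 1 f (f' x).
  by rewrite in_itv/= => /andP[/ltW ax /ltW xb]; apply: df; rewrite ax.
have [|x] := MVT_segment ab dfo.
  apply: continuous_in_subspaceT => x /set_mem; rewrite /= in_itv/= => xab.
  by apply: is_derive_continuous; exact: df.
by rewrite in_itv/= => xab ->; rewrite mulr_ge0 ?f'0 ?subr_ge0.
Qed.

Lemma continuous_expRN {R : realType} : continuous (fun t : R => expR (- t)).
Proof.
move=> t; apply: (@continuous_comp _ _ _ (fun t : R => - t) expR).
  exact: oppr_continuous.
exact: continuous_expR.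
Qed.

Lemma continuous_expRNM {R : realType} (r : R) : continuous (fun t : R => expR (- (r * t))).
Proof.
move=> t; apply: (@continuous_comp _ _ _ (fun t : R => r * t) (fun t => expR (- t))).
  exact: mulrl_continuous.
exact: continuous_expRN.
Qed.

(* [I x] is the integral of [h (x - y) * exp (- y)] over the jump sizes
   [0 < y < x], up to a boundary term at 0. *)
Definition harmonic_pair {R : realType} (lam q : R) (h I : R -> R) :=
  forall x : R, 0 < x -> is_derive x 1 I (h x - I x) /\
    is_derive x 1 h (((q + lam) * h x - lam * I x) / x).

Section pair.
Context {R : realType}.
Notation mu := (@lebesgue_measure R).
Variables (lam q : R) (h I : R -> R).
Hypotheses (lam_gt0 : 0 < lam) (q_ge0 : 0 <= q) (hI : harmonic_pair lam q h I)
  (h_ge0 : forall x : R, 0 < x -> 0 <= h x) (I_ge0 : forall x : R, 0 < x -> 0 <= I x).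
Let n := q + lam.
Let n_gt0 : 0 < n. Proof. by rewrite /n; have := lam_gt0; have := q_ge0; lra. Qed.

Let dI (x : R) : 0 < x -> is_derive x 1 I (h x - I x).
Proof. by move=> /hI[]. Qed.
Let dh (x : R) : 0 < x -> is_derive x 1 h ((n * h x - lam * I x) / x).
Proof. by move=> /hI[]. Qed.

Let cI (x : R) : 0 < x -> {for x, continuous I}.
Proof. by move=> x0; apply: is_derive_continuous (dI x0). Qed.
Let ch (x : R) : 0 < x -> {for x, continuous h}.
Proof. by move=> x0; apply: is_derive_continuous (dh x0). Qed.

Lemma pair_expI_le x y : 0 < x -> x <= y -> expR x * I x <= expR y * I y.
Proof.
move=> x0 xy; apply: (@is_derive_ge0_le _ (fun x => expR x * I x) (fun x => expR x * h x)) => //.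
  move=> u /andP[xu _]; have u0 : 0 < u := lt_le_trans x0 xu.
  have du := dI u0.
  by apply: is_derive_eq; rewrite /GRing.scale/=; ring.
by move=> u /andP[xu _]; rewrite mulr_ge0 ?expR_ge0// h_ge0// (lt_le_trans x0 xu).
Qed.

Variables (a b h0 I0 : R).
Hypotheses (a_ge0 : 0 <= a) (ab : a <= b) (b_gt0 : 0 < b)
  (h0_ge0 : 0 <= h0) (I0_ge0 : 0 <= I0)
  (at0 : a = 0 -> I x @[x --> 0^'+] --> I0 /\ lam * I0 = n * h0).

Let ext (f : R -> R) (f0 x : R) := if 0 < x then f x else f0.

Let mext (f : R -> R) f0 : (forall x : R, 0 < x -> {for x, continuous f}) ->
  measurable_fun [set: R] (ext f f0).
Proof.
move=> cf; apply: measurable_fun_if => //.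
- by apply: measurable_fun_ltr.
- rewrite setTI (_ : _ @^-1` _ = `]0, +oo[%classic); last first.
    by apply/seteqP; split=> x /=; rewrite in_itv/= andbT.
  apply: open_continuous_measurable_fun => // x /set_mem.
  by rewrite /= in_itv/= andbT; exact: cf.
Qed.

Let ext_ge0 (f : R -> R) f0 : 0 <= f0 -> (forall x : R, 0 < x -> 0 <= f x) ->
  forall x : R, 0 <= ext f f0 x.
Proof. by move=> f00 f0' x; rewrite /ext; case: ifPn => // /f0'. Qed.

Let hx := ext h h0.
Let Ix := ext I I0.
Let FT sv := (grow q b sv).2 * Ix (grow q b sv).1 + h b * up_gain q b sv.
Let FC sv := (claim a sv).2 * hx (claim a sv).1 + Ix a * ruin_gain a (fun=> 1) sv.

Let mslice (y : R) (f : (R * R) * R -> R) : measurable_fun [set: (R * R) * R] f ->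
  measurable_fun [set: R] (fun t : R => f ((y, 1), t)).
Proof. by move=> mf; apply: measurableT_comp => //; exact: measurable_fun_pair. Qed.

Let mFT y : measurable_fun [set: R] (fun t : R => FT ((y, 1), t)).
Proof.
apply: mslice; apply: measurable_funD; last first.
  by apply: measurable_funM => //; exact: measurable_up_gain.
apply: measurable_funM.
  by apply: (measurableT_comp measurable_snd); exact: measurable_grow.
apply: measurableT_comp; first exact: (mext I0 cI).
by apply: (measurableT_comp measurable_fst); exact: measurable_grow.
Qed.

Let mFC y : measurable_fun [set: R] (fun t : R => FC ((y, 1), t)).
Proof.
apply: mslice; apply: measurable_funD; last first.
  by apply: measurable_funM => //; exact: measurable_ruin_gain.
apply: measurable_funM.
  by apply: (measurableT_comp measurable_snd); exact: measurable_claim.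
apply: measurableT_comp; first exact: (mext h0 ch).
by apply: (measurableT_comp measurable_fst); exact: measurable_claim.
Qed.

Let FT_ge0 y t : 0 <= FT ((y, 1), t).
Proof.
rewrite /FT /= !mul1r addr_ge0 ?mulr_ge0 ?expR_ge0 ?powR_ge0 ?h_ge0//.
exact: ext_ge0.
Qed.

Let FC_ge0 y t : 0 <= FC ((y, 1), t).
Proof.
rewrite /FC /= !mul1r addr_ge0 ?mulr_ge0//; [exact: ext_ge0|exact: ext_ge0].
Qed.

Let split_tail (r m : R) (F : R -> R) (K : R) : 0 < r -> 0 <= m -> 0 <= K ->
  measurable_fun [set: R] F -> (forall t, 0 <= F t) ->
  (forall t, m < t -> F t = K) ->
  (\int[mu]_(t in `[0%R, +oo[) (F t * (r * expR (- (r * t))))%:E =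
   \int[mu]_(t in `]0%R, m[) (F t * (r * expR (- (r * t))))%:E
     + (K * expR (- (r * m)))%:E)%E.
Proof.
move=> r0 m0 K0 mF F0 FK.
have mf : measurable_fun [set: R] (fun t => (F t * (r * expR (- (r * t))))%:E).
  by apply/measurable_EFinP; apply: measurable_funM => //; exact: measurable_exp_density.
rewrite (@itv_bndbnd_setU _ _ (BLeft 0) (BRight m) +oo%O); last 2 first.
- by rewrite bnd_simp.
- by [].
rewrite ge0_integral_setU//=; last 3 first.
- by apply: measurable_funS mf.
- by move=> t _; rewrite lee_fin !mulr_ge0 ?expR_ge0// ltW.
- apply/disj_setPS => t []/=; rewrite !in_itv/= andbT => /andP[_ tm] mt.
  by move: tm; rewrite leNgt mt.
congr (_ + _)%E.
  rewrite integral_itv_bndo_bndc; last by apply: measurable_funS mf.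
  by rewrite integral_itv_obnd_cbnd//; apply: measurable_funS mf.
transitivity (\int[mu]_(t in `]m, +oo[) (K%:E * (r * expR (- (r * t)))%:E))%E.
  by apply: eq_integral => t /set_mem; rewrite /= in_itv/= andbT => /FK ->.
rewrite ge0_integralZl//.
- by rewrite exp_tail.
- apply/measurable_EFinP; apply: measurable_funS (measurable_exp_density r) => //.
- by move=> t _; rewrite lee_fin !mulr_ge0 ?expR_ge0// ltW.
Qed.

Let harmT y : a <= y <= b ->
  (\int[mu]_(t in `[0%R, +oo[)
    (FT ((y, 1), t) * (lam * expR (- (lam * t))))%:E = (hx y)%:E)%E.
Proof.
move=> /andP[ay yb].
have [y0|y0] := ltP 0 y; last first.
  have {ay y0}[y0 a0] : y = 0 /\ a = 0 by split; move: a_ge0; lra.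
  have [_ I0h0] := at0 a0.
  have key (t : R) : expR (- (q * t)) * I0 * (lam * expR (- (lam * t))) =
      h0 * (n * expR (- (n * t))).
    rewrite [RHS]mulrA [h0 * _]mulrC -I0h0 /n mulrDl opprD expRD; ring.
  rewrite y0 /hx /ext ltxx.
  transitivity (\int[mu]_(t in `[0%R, +oo[) ((h0)%:E * (n * expR (- (n * t)))%:E))%E.
    apply: eq_integral => t /set_mem; rewrite /= in_itv/= andbT => t0.
    have -> : FT ((0, 1), t) = expR (- (q * t)) * I0.
      rewrite /FT /= /Ix /ext !mul0r t0 (ltW b_gt0)/= ltxx ltNge (ltW b_gt0)/=.
      by rewrite !mul1r mulr0 mulr0 addr0 mulr1.
    by rewrite -EFinM key.
  rewrite ge0_integralZl//.
  - rewrite -integral_itv_obnd_cbnd; last first.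
      by apply: measurable_funS (_ : measurable_fun setT _) => //; apply/measurable_EFinP; exact: measurable_exp_density.
    by rewrite exp_tail// mulr0 oppr0 expR0 mule1.
  - apply/measurable_EFinP; apply: measurable_funS (measurable_exp_density n) => //.
  - by move=> t _; rewrite lee_fin !mulr_ge0 ?expR_ge0// ltW.
pose m := ln (b / y).
have by1 : 1 <= b / y by rewrite ler_pdivlMr// mul1r.
have by0 : 0 < b / y by rewrite divr_gt0.
have m0 : 0 <= m by exact: ln_ge0.
have em : expR m = b / y by rewrite lnK.
have yem : y * expR m = b by rewrite em; field; exact: lt0r_neq0.
have lebm t : (y * expR t <= b) = (t <= m).
  by rewrite -yem ler_pM2l// ler_expR.
rewrite (split_tail (m := m) (K := (y / b) `^ q * h b)) //; last 2 first.
- by rewrite mulr_ge0 ?powR_ge0 ?h_ge0.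
- move=> t mt; have tm : (t <= m) = false by rewrite leNgt mt.
  rewrite /FT /= ltNge lebm tm/=.
  by rewrite andbF mulr0 mul0r add0r mul1r mulr1 mulrC.
have -> : (y / b) `^ q * h b * expR (- (lam * m)) = expR (- (n * m)) * h b.
  rewrite /powR ifF; last by apply/negbTE; rewrite mulf_neq0 ?invr_eq0 ?lt0r_neq0.
  have -> : ln (y / b) = - m.
    by rewrite /m -lnV ?posrE// invf_div.
  by rewrite mulrAC -expRD /n; congr (expR _ * _); ring.
have hxy : hx y = h y by rewrite /hx /ext y0.
have [m0'|m0'] := ltP 0 m; last first.
  have mE : m = 0 by apply/eqP; rewrite eq_le m0 m0'.
  have yb' : y = b by rewrite -yem mE expR0 mulr1.
  by rewrite mE set_itv_ge ?bnd_simp ?ltxx// integral_set0 add0e mulr0 oppr0 expR0 mul1r hxy yb'.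
pose G t := - (expR (- (n * t)) * h (y * expR t)).
have yt0 (t : R) : 0 < y * expR t by rewrite mulr_gt0 ?expR_gt0.
have dG (t : R) : is_derive t 1 G (lam * (expR (- (n * t)) * I (y * expR t))).
  have d1 : is_derive t 1 (fun t : R => y * expR t) (y * expR t).
    by apply: is_derive_eq; rewrite /GRing.scale/=; ring.
  have d2 : is_derive t 1 (fun t : R => h (y * expR t)) _ :=
    @is_derive1_comp _ h (fun t : R => y * expR t) t _ _ (dh (yt0 t)) d1.
  rewrite /G; apply: is_derive_eq; rewrite /GRing.scale/=.
  by rewrite divfK ?lt0r_neq0//; ring.
have cG (t : R) : {for t, continuous (fun t : R => lam * (expR (- (n * t)) * I (y * expR t)))}.
  apply: cvgM; first exact: cvg_cst.
  apply: cvgM; first exact: continuous_expRNM.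
  have d1 : is_derive t 1 (fun t : R => y * expR t) (y * expR t).
    by apply: is_derive_eq; rewrite /GRing.scale/=; ring.
  apply: (@is_derive_continuous _ (fun t : R => I (y * expR t))).
  exact: (@is_derive1_comp _ I (fun t : R => y * expR t) t _ _ (dI (yt0 t)) d1).
transitivity (\int[mu]_(t in `]0%R, m[)
    (lam * (expR (- (n * t)) * I (y * expR t)))%:E + (expR (- (n * m)) * h b)%:E)%E.
  congr (_ + _)%E; apply: eq_integral => t /set_mem; rewrite /= in_itv/= => /andP[t0 tm].
  rewrite /FT /= lebm (ltW t0) (ltW tm)/= ltNge lebm (ltW tm)/= !mulr0 addr0 mul1r mulr1.
  rewrite /Ix /ext yt0; congr (_%:E); rewrite /n mulrDl opprD expRD; ring.
rewrite (ge0_FTC_oo (F := G) (Fa := G 0) (Fb := G m))//.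
- by rewrite /G mulr0 oppr0 expR0 mulr1 mul1r yem hxy -EFinD; congr (_%:E); ring.
- by move=> t _; rewrite !mulr_ge0 ?expR_ge0 ?I_ge0// ltW.
- by apply: cvg_at_right_filter; apply: is_derive_continuous (dG 0).
- by apply: cvg_at_left_filter; apply: is_derive_continuous (dG m).
Qed.

Let harmC y : a <= y <= b ->
  (\int[mu]_(c in `[0%R, +oo[)
    (FC ((y, 1), c) * (1 * expR (- (1 * c))))%:E = (Ix y)%:E)%E.
Proof.
move=> /andP[ay yb].
rewrite (split_tail (m := y - a) (K := Ix a)) ?subr_ge0//; last 2 first.
- exact: ext_ge0.
- move=> t; rewrite ltrBlDr => yt; rewrite /FC /=.
  have -> : (a <= y - t) = false by apply/negbTE; rewrite -ltNge ltrBlDr addrC.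
  have -> : y - t < a by rewrite ltrBlDr addrC.
  by rewrite andbF mulr0 mul0r add0r mul1r !mulr1.
have [ay'|ay'] := ltP a y; last first.
  have yE : y = a by apply/eqP; rewrite eq_le ay' ay.
  rewrite yE set_itv_ge ?bnd_simp ?subrr ?ltxx// integral_set0 add0e.
  by rewrite mulr0 oppr0 expR0 mulr1.
have y0 : 0 < y := le_lt_trans a_ge0 ay'.
pose G c := - (expR (- c) * I (y - c)).
have yc0 (c : R) : 0 < c < y - a -> 0 < y - c.
  by move=> /andP[_]; move: a_ge0; lra.
have dy (c : R) : is_derive c 1 (fun c : R => y - c) (-1).
  have -> : -1 = 0 - 1 :> R by rewrite sub0r.
  exact: is_deriveB.
have dG (c : R) : 0 < y - c -> is_derive c 1 G (expR (- c) * h (y - c)).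
  move=> ycp; have d2 : is_derive c 1 (fun c : R => I (y - c)) _ :=
    @is_derive1_comp _ I (fun c : R => y - c) c _ _ (dI ycp) (dy c).
  by rewrite /G; apply: is_derive_eq; rewrite /GRing.scale/=; ring.
have cG (c : R) : 0 < y - c -> {for c, continuous (fun c : R => expR (- c) * h (y - c))}.
  move=> ycp; apply: cvgM; first exact: continuous_expRN.
  apply: (@is_derive_continuous _ (fun t : R => h (y - t))).
  exact: (@is_derive1_comp _ h (fun c : R => y - c) c _ _ (dh ycp) (dy c)).
transitivity (\int[mu]_(c in `]0%R, (y - a)%R[)
    (expR (- c) * h (y - c))%:E + (Ix a * expR (- (1 * (y - a))))%:E)%E.
  congr (_ + _)%E; apply: eq_integral => c /set_mem; rewrite /= in_itv/= => /andP[c0 cya].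
  have yc : 0 < y - c by apply: yc0; rewrite c0.
  rewrite /FC /= (ltW c0)/=.
  have -> : (a <= y - c) by lra.
  have -> : (y - c < a) = false by apply/negbTE; rewrite -leNgt; lra.
  by rewrite /= !mulr0 addr0 !mul1r /hx /ext yc mulrC.
have Iy : Ix y = I y by rewrite /Ix /ext y0.
rewrite (ge0_FTC_oo (F := G) (Fa := - I y) (Fb := - (expR (- (y - a)) * Ix a))
  _ _ _ (fun c hc => dG c (yc0 c hc))).
- by rewrite mul1r -EFinD Iy; congr (_%:E); ring.
- by rewrite subr_gt0.
- by move=> c /yc0 yc; rewrite mulr_ge0 ?expR_ge0 ?h_ge0.
- by move=> c /yc0; exact: cG.

- apply: cvg_at_right_filter.
  have := is_derive_continuous (dG 0 _); rewrite subr0 => /(_ y0).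
  suff -> : - I y = G 0 by [].
  by rewrite /G oppr0 expR0 mul1r addr0.
- have [a0|a0] := ltP 0 a.
    rewrite /Ix /ext a0; apply: cvg_at_left_filter.
    have yya : y - (y - a) = a by ring.
    have := is_derive_continuous (dG (y - a) _); rewrite yya => /(_ a0).
    by suff -> : - (expR (- (y - a)) * I a) = G (y - a) by []; rewrite /G yya.
  have aE : a = 0 by apply/eqP; rewrite eq_le a_ge0 a0.
  have [I00 _] := at0 aE.
  rewrite aE subr0 /Ix /ext ltxx.
  apply: cvgN; apply: cvgM.
    apply: cvg_at_left_filter.
    exact: continuous_expRN.
  apply: (@cvg_comp _ _ _ (fun c : R => y - c) I _ _ _ _ I00) => A [e e0 He].
  exists e => // c /= cy; rewrite -subr_gt0 => yc0'.
  by apply: He => //=; rewrite sub0r normrN.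
Qed.

Let h_bounded y : a <= y <= b -> hx y <= expR b * I b + I0 + h b.
Proof.
move=> yab.
have e1 : (\int[mu]_(t in `[0%R, +oo[) (lam * expR (- (lam * t)))%:E = 1)%E.
  rewrite -integral_itv_obnd_cbnd; last first.
    by apply: (measurable_funS _ (@subsetT _ _)) => //; apply/measurable_EFinP; exact: measurable_exp_density.
  by rewrite exp_tail// mulr0 oppr0 expR0.
have Ib0 : 0 <= I b by exact: I_ge0.
have hb0 : 0 <= h b by exact: h_ge0.
have M0 : 0 <= expR b * I b + I0 + h b by rewrite !addr_ge0// mulr_ge0// expR_ge0.
have IM x : x <= b -> Ix x <= expR b * I b + I0.
  move=> xb; rewrite /Ix /ext; case: ifPn => x0; last by rewrite lerDr mulr_ge0// expR_ge0.
  apply: ler_wpDr => //; apply: le_trans (pair_expI_le x0 xb).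
  by rewrite ler_peMl ?I_ge0// ltW// expR_gt1.
rewrite -lee_fin -harmT//.
rewrite -[leRHS]mule1 -e1 -ge0_integralZl//; last 2 first.
- by apply/measurable_EFinP; apply: measurable_funS (measurable_exp_density lam).
- by move=> t _; rewrite lee_fin mulr_ge0 ?expR_ge0// ltW.
have mF : measurable_fun [set: R] (fun t : R => FT ((y, 1), t) * (lam * expR (- (lam * t)))).
  by apply: measurable_funM => //; exact: measurable_exp_density.
have mE : measurable_fun [set: R] (fun t : R =>
    (expR b * I b + I0 + h b) * (lam * expR (- (lam * t)))).
  by apply: measurable_funM => //; exact: measurable_exp_density.
apply: ge0_le_integral => //.
- by move=> t _; rewrite lee_fin !mulr_ge0 ?expR_ge0// ltW.
- by apply/measurable_EFinP; apply: measurable_funS mF.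
- by apply/measurable_EFinP; apply: measurable_funS mE.
move=> t; rewrite /= in_itv/= andbT => t0; rewrite lee_fin ler_wpM2r ?mulr_ge0 ?expR_ge0//; first exact: ltW.
have y0 : 0 <= y by apply: le_trans a_ge0 _; case/andP: yab.
have yb : y / b <= 1 by rewrite ler_pdivrMr// mul1r; case/andP: yab.
have yb0 : 0 <= y / b by rewrite divr_ge0// ltW.
apply: lerD; rewrite /= !mul1r.
  have [ytb|_] := leP (y * expR t) b; last by rewrite andbF mulr0 mul0r addr_ge0// mulr_ge0// expR_ge0.
  rewrite t0 mulr1; apply: le_trans (IM _ ytb).
  rewrite ler_piMl//; first exact: ext_ge0.
  by rewrite -expR0 ler_expR oppr_le0 mulr_ge0.
rewrite ler_piMr// mulr_ile1 ?powR_ge0//; last by case: (_ < _).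
have -> : (1 : R) = 1 `^ q by rewrite powR1.
by rewrite ge0_ler_powR ?nnegrE.
Qed.

Context d (T : measurableType d) (P : probability T R).
Variables (N : R -> T -> nat) (C tau : nat -> {RV P >-> R}) (X : R -> R -> T -> R).
Hypotheses (tau_exp : forall i, exponential_law lam (tau i))
  (tau_indep : mutual_independence P
     (fun i => preimage_set_system setT (tau i) measurable))
  (NE : forall (t : R) (w : T) (k : nat), 0 <= t ->
          (k <= N t w)%N = (\sum_(i < k) tau i w <= t))
  (C_exp : forall i, exponential_law 1 (C i))
  (C_indep : independent_marks N C)
  (X_segerdahl : forall z w,
     segerdahl_path 0 1 (fun t => compound N C t w) z (fun t => X z t w)).

Lemma pair_two_sided z : 0 < z -> a <= z <= b ->
  ((h z)%:E = (h b)%:E * upcross P X q a b z +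
     (if (0 < a)%R then I a else I0)%:E * Psi_two_sided P X q b z a)%E.
Proof.
move=> z0 /andP[az zb].
have -> : h z = hx z by rewrite /hx /ext z0.
apply: (two_sided_identity lam_gt0 q_ge0 tau_exp tau_indep NE C_exp C_indep
  X_segerdahl a_ge0 ab b_gt0 az zb (mext h0 ch) (mext I0 cI) _ _ _ _ harmT harmC h_bounded).
- exact: ext_ge0.
- exact: ext_ge0.
- exact: h_ge0.
- exact: ext_ge0.
Qed.

End pair.

(** * The Kummer function *)

Section entire_series.
Context {R : realType}.
Implicit Types (c : nat -> R) (x z : R).

Definition pseries_lim c x : R := limn (pseries c x).

Definition entire c := exists M r : R,
  [/\ 0 <= M, 0 <= r & forall k, `|c k| <= M * (r ^+ k / k`!%:R)].

Lemma entire_diffs c : entire c -> entire (pseries_diffs c).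
Proof.
move=> [M [r [M0 r0 cM]]]; exists (M * r), r; split=> //; first exact: mulr_ge0.
move=> k; rewrite /pseries_diffs normrM ger0_norm//.
apply: le_trans (ler_wpM2l _ (cM k.+1)) _ => //.
rewrite factS natrM exprS invfM.
have k0 : k.+1%:R != 0 :> R by rewrite pnatr_eq0.
rewrite [leLHS](_ : _ = (k.+1%:R / k.+1%:R) * (M * r * (r ^+ k / k`!%:R))); last by ring.
by rewrite divff// mul1r.
Qed.

Lemma entire_cvg c x : entire c -> cvgn (pseries c x).
Proof.
move=> [M [r [M0 r0 cM]]]; apply: normed_cvg.
apply: (@series_le_cvg _ _ (fun k => M * exp_coeff (r * `|x|) k)) => [k|k|k|].
- exact: normr_ge0.
- by rewrite mulr_ge0// exp_coeff_ge0// mulr_ge0.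
- rewrite /= /exp_coeff /= exprMn normrM normrX.
  rewrite [leRHS](_ : _ = M * (r ^+ k / k`!%:R) * `|x| ^+ k); last by ring.
  by rewrite ler_wpM2r// exprn_ge0.
- by apply: is_cvg_seriesZ; exact: is_cvg_series_exp_coeff.
Qed.

Lemma is_derive_pseries_lim c x : entire c ->
  is_derive x 1 (pseries_lim c) (pseries_lim (pseries_diffs c) x).
Proof.
move=> ec; apply: (@pseries_snd_diffs _ c (`|x| + 1)).
- exact: entire_cvg.
- exact/entire_cvg/entire_diffs.
- exact/entire_cvg/entire_diffs/entire_diffs.
- by rewrite [ltRHS]ger0_norm ?ltrDl// addr_ge0.
Qed.

Lemma cvg_pseries c x : entire c -> pseries c x @ \oo --> pseries_lim c x.
Proof. exact: entire_cvg. Qed.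

Lemma cvg_pseriesD c1 c2 x (l1 l2 : R) : pseries c1 x @ \oo --> l1 ->
  pseries c2 x @ \oo --> l2 -> pseries (fun k => c1 k + c2 k) x @ \oo --> l1 + l2.
Proof.
move=> e1 e2; rewrite (_ : pseries _ x = pseries c1 x \+ pseries c2 x); first exact: cvgD.
apply/funext => m; rewrite /pseries /series /= -big_split/=.
by apply: eq_bigr => i _; rewrite mulrDl.
Qed.

Lemma cvg_pseriesZ c a x (l : R) : pseries c x @ \oo --> l ->
  pseries (fun k => a * c k) x @ \oo --> a * l.
Proof.
move=> e1; rewrite (_ : pseries _ x = (fun m => a * pseries c x m)).
  by apply: cvgM => //; exact: cvg_cst.
apply/funext => m; rewrite /pseries /series /= mulr_sumr.
by apply: eq_bigr => i _; rewrite mulrA.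
Qed.

Definition pshift c k : R := if k is j.+1 then c j else 0.

Lemma cvg_pseriesX c x (l : R) : pseries c x @ \oo --> l ->
  pseries (pshift c) x @ \oo --> x * l.
Proof.
move=> e1; rewrite -cvg_shiftS.
rewrite (_ : (fun m => _) = (fun m => x * pseries c x m)).
  by apply: cvgM => //; exact: cvg_cst.
apply/funext => m; rewrite /pseries /series /= big_nat_recl//= mul0r add0r mulr_sumr.
by apply: eq_bigr => i _; rewrite exprS; ring.
Qed.

Lemma eq_pseries_lim c1 c2 x (l1 l2 : R) : c1 =1 c2 ->
  pseries c1 x @ \oo --> l1 -> pseries c2 x @ \oo --> l2 -> l1 = l2.
Proof. by move=> /funext -> c1l c2l; exact: cvg_unique c1l c2l. Qed.

Lemma pseries_lim_ge1 c x : entire c -> (forall k, 0 <= c k) -> c 0%N = 1 ->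
  0 <= x -> 1 <= pseries_lim c x.
Proof.
move=> ec c0 c1 x0; apply: limr_ge; first exact: entire_cvg.
near=> m; rewrite /pseries /series /=.
have -> : m = m.-1.+1 by rewrite prednK//; near: m; exact: nbhs_infty_gt.
rewrite big_nat_recl//= c1 expr0 mulr1 lerDl sumr_ge0// => i _.
by rewrite mulr_ge0// exprn_ge0.
Unshelve. all: by end_near. Qed.

Lemma pseries_lim0 c : entire c -> pseries_lim c 0 = c 0%N.
Proof.
move=> ec; apply: cvg_lim => //; rewrite -cvg_shiftS.
rewrite [X in X @ _ --> _](_ : _ = (fun=> c 0%N)); first exact: cvg_cst.
apply/funext => m; rewrite /pseries /series /= big_nat_recl//= expr0 mulr1.
by rewrite big1 ?addr0// => i _; rewrite exprS mul0r mulr0.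
Qed.

End entire_series.

Section kummer.
Context {R : realType}.
Implicit Types (al be z : R).

Lemma pochhammerS al k : pochhammer al k.+1 = pochhammer al k * (al + k%:R).
Proof. by rewrite /pochhammer big_ord_recr. Qed.

Lemma pochhammer0 al : pochhammer al 0 = 1.
Proof. by rewrite /pochhammer big_ord0. Qed.

Lemma pochhammerSl al k : pochhammer al k.+1 = al * pochhammer (al + 1) k.
Proof.
rewrite /pochhammer big_ord_recl/= addr0; congr (_ * _).
by apply: eq_bigr => i _; rewrite /= /bump leq0n natrD addrA.
Qed.

Lemma pochhammer_gt0 al k : 0 < al -> 0 < pochhammer al k.
Proof. by move=> a0; apply: prodr_gt0 => i _; rewrite ltr_wpDr. Qed.

Definition kummer_coef al be k : R := pochhammer al k / pochhammer be k / k`!%:R.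

Lemma kummer_coef0 al be : kummer_coef al be 0 = 1.
Proof. by rewrite /kummer_coef !pochhammer0 fact0 !divr1. Qed.

Lemma kummer_coef_ge0 al be k : 0 < al -> 0 < be -> 0 <= kummer_coef al be k.
Proof.
by move=> a0 b0; rewrite /kummer_coef !mulr_ge0 ?invr_ge0// ltW// pochhammer_gt0.
Qed.

Lemma entire_kummer al be : 0 < al -> 0 < be -> entire (kummer_coef al be).
Proof.
move=> a0 b0; exists 1, (1 + al / be); split => //.
  by rewrite addr_ge0// divr_ge0// ltW.
move=> k; rewrite ger0_norm ?kummer_coef_ge0// mul1r /kummer_coef.
rewrite ler_wpM2r ?invr_ge0// ler_pdivrMr ?pochhammer_gt0//.
elim: k => [|k IH]; first by rewrite !pochhammer0 expr0 mulr1.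
rewrite !pochhammerS exprS.
rewrite [leRHS](_ : _ = ((1 + al / be) ^+ k * pochhammer be k) *
  ((1 + al / be) * (be + k%:R))); last by ring.
apply: ler_pM => //.
- by rewrite ltW// pochhammer_gt0.
- by rewrite addr_ge0// ltW.
rewrite [leRHS](_ : _ = al + k%:R + be + al / be * k%:R); last first.
  by field; exact: lt0r_neq0.
have : 0 <= al / be * k%:R by rewrite mulr_ge0// divr_ge0// ltW.
by move: b0; lra.
Qed.

Lemma KummerME al be z : KummerM al be z = pseries_lim (kummer_coef al be) z.
Proof.
rewrite /KummerM /pseries_lim /pseries; congr (limn (series _)).
by apply/funext => k /=; rewrite /kummer_coef mulrA mulrAC.
Qed.

Lemma is_derive_KummerM al be z : 0 < al -> 0 < be ->
  is_derive z 1 (KummerM al be) (al / be * KummerM (al + 1) (be + 1) z).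
Proof.
move=> a0 b0.
have -> : KummerM al be = pseries_lim (kummer_coef al be).
  by apply/funext => u; rewrite KummerME.
suff <- : pseries_lim (pseries_diffs (kummer_coef al be)) z =
    al / be * KummerM (al + 1) (be + 1) z.
  exact/is_derive_pseries_lim/entire_kummer.
have c1 : entire (kummer_coef (al + 1) (be + 1)).
  by apply: entire_kummer; rewrite addr_gt0.
rewrite KummerME; apply: cvg_lim => //.
rewrite (_ : pseries_diffs _ = (fun k => al / be * kummer_coef (al + 1) (be + 1) k)).
  exact/cvg_pseriesZ/cvg_pseries.
apply/funext => k; rewrite /pseries_diffs /kummer_coef !pochhammerSl factS natrM.
have := lt0r_neq0 b0.
have := lt0r_neq0 (pochhammer_gt0 k (addr_gt0 b0 ltr01)).
have : k.+1%:R != 0 :> R by rewrite pnatr_eq0.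
have : k`!%:R != 0 :> R by rewrite pnatr_eq0 -lt0n fact_gt0.
by move=> *; field; apply/and4P; split.
Qed.

Lemma KummerM0 al be : 0 < al -> 0 < be -> KummerM al be 0 = 1.
Proof.
by move=> a0 b0; rewrite KummerME pseries_lim0 ?kummer_coef0//; exact: entire_kummer.
Qed.

Lemma KummerM_ge1 al be z : 0 < al -> 0 < be -> 0 <= z -> 1 <= KummerM al be z.
Proof.
move=> a0 b0 z0; rewrite KummerME pseries_lim_ge1 ?kummer_coef0//.
- exact: entire_kummer.
- by move=> k; exact: kummer_coef_ge0.
Qed.

Let kcvg (al be z : R) : 0 < al -> 0 < be ->
  pseries (kummer_coef al be) z @ \oo --> KummerM al be z.
Proof. by move=> a0 b0; rewrite KummerME; exact/cvg_pseries/entire_kummer. Qed.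

Let dcvg (al be z : R) : 0 < al -> 0 < be ->
  pseries (pseries_diffs (kummer_coef al be)) z @ \oo --> 'D_1 (KummerM al be) z.
Proof.
move=> a0 b0; have := is_derive_pseries_lim z (entire_kummer a0 b0).
rewrite (_ : pseries_lim _ = KummerM al be); last by apply/funext => u; rewrite KummerME.
by move=> H; rewrite derive_val; exact/cvg_pseries/entire_diffs/entire_kummer.
Qed.

Lemma KummerM_derive_raise_be al be z : 0 < al -> 0 < be ->
  z * 'D_1 (KummerM al (be + 1)) z = be * (KummerM al be z - KummerM al (be + 1) z).
Proof.
move=> a0 b0; have b1 : 0 < be + 1 by rewrite addr_gt0.
have H1 := cvg_pseriesX (@dcvg _ _ z a0 b1).
have H2 := cvg_pseriesD (cvg_pseriesZ (a := be) (@kcvg _ _ z a0 b0))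
  (cvg_pseriesZ (a := - be) (@kcvg _ _ z a0 b1)).
rewrite mulrBr -mulNr; apply: (eq_pseries_lim _ H1 H2) => -[|k].
  by rewrite /= !kummer_coef0; ring.
rewrite /= /pseries_diffs /kummer_coef.
rewrite (pochhammerSl be) [pochhammer (be + 1) k.+1]pochhammerS pochhammerS factS natrM.
have := lt0r_neq0 b0; have : be + 1 + k%:R != 0 by rewrite lt0r_neq0// ltr_wpDr.
have := lt0r_neq0 (pochhammer_gt0 k b1).
have : k.+1%:R != 0 :> R by rewrite pnatr_eq0.
have : k`!%:R != 0 :> R by rewrite pnatr_eq0 -lt0n fact_gt0.
rewrite -addn1 natrD => *; field; do ?[apply/andP; split] => //.
Qed.

Lemma KummerM_sub_derive al be z : 0 < al -> 0 < be ->
  KummerM al be z - 'D_1 (KummerM al be) z =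
  (be - al) / be * KummerM al (be + 1) z.
Proof.
move=> a0 b0; have b1 : 0 < be + 1 by rewrite addr_gt0.
have H1 := cvg_pseriesD (@kcvg _ _ z a0 b0) (cvg_pseriesZ (a := -1) (@dcvg _ _ z a0 b0)).
have H2 := cvg_pseriesZ (a := (be - al) / be) (@kcvg _ _ z a0 b1).
rewrite -mulN1r; apply: (eq_pseries_lim _ H1 H2) => k.
rewrite /pseries_diffs /kummer_coef pochhammerS.
have pE : pochhammer (be + 1) k = pochhammer be k * (be + k%:R) / be.
  by rewrite -pochhammerS pochhammerSl mulrAC divff ?mul1r// lt0r_neq0.
rewrite pE pochhammerS factS natrM.
have := lt0r_neq0 b0; have : be + k%:R != 0 by rewrite lt0r_neq0// ltr_wpDr.
have := lt0r_neq0 (pochhammer_gt0 k b0).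
have : k.+1%:R != 0 :> R by rewrite pnatr_eq0.
have : k`!%:R != 0 :> R by rewrite pnatr_eq0 -lt0n fact_gt0.
by move=> *; field; do ?[apply/andP; split].
Qed.

Lemma KummerM_raise_al_be al be z : 0 < al -> 0 < be ->
  be * KummerM (al + 1) (be + 1) z + z * 'D_1 (KummerM (al + 1) (be + 1)) z =
  be * KummerM al be z + z * KummerM (al + 1) (be + 1) z.
Proof.
move=> a0 b0; have b1 : 0 < be + 1 by rewrite addr_gt0.
have a1 : 0 < al + 1 by rewrite addr_gt0.
have H1 := cvg_pseriesD (cvg_pseriesZ (a := be) (@kcvg _ _ z a1 b1))
  (cvg_pseriesX (@dcvg _ _ z a1 b1)).
have H2 := cvg_pseriesD (cvg_pseriesZ (a := be) (@kcvg _ _ z a0 b0)) (cvg_pseriesX (@kcvg _ _ z a1 b1)).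
apply: (eq_pseries_lim _ H1 H2) => -[|k].
  by rewrite /= !kummer_coef0.
rewrite /= /pseries_diffs /kummer_coef.
rewrite (pochhammerSl be) (pochhammerSl al) !pochhammerS factS natrM.
have := lt0r_neq0 b0; have : be + 1 + k%:R != 0 by rewrite lt0r_neq0// ltr_wpDr.
have := lt0r_neq0 (pochhammer_gt0 k b1).
have : k.+1%:R != 0 :> R by rewrite pnatr_eq0.
have : k`!%:R != 0 :> R by rewrite pnatr_eq0 -lt0n fact_gt0.
rewrite -addn1 natrD => *; field; do ?[apply/andP; split] => //.
Qed.

End kummer.

(** * Uniqueness of harmonic pairs *)

Section pair_theory.
Context {R : realType}.
Implicit Types (h I : R -> R).

Lemma is_derive_powR (r x : R) : 0 < x ->
  is_derive x 1 (fun y : R => y `^ r) (r * x `^ r / x).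
Proof.
move=> x0; have xin : x \in `]0, +oo[ by rewrite in_itv/= x0.
have -> : r * x `^ r / x = r * x `^ (r - 1).
  by rewrite powRB ?powRr1 ?ltW// ?mulrA// lt0r_neq0 ?implybT.
apply: DeriveDef; first exact: derivable_powR.
by rewrite -derive1E powR_derive1.
Qed.

Lemma powR_succ (x r : R) : 0 < x -> x `^ (r + 1) = x * x `^ r.
Proof. by move=> x0; rewrite powRD ?lt0r_neq0 ?implybT// powRr1 ?ltW// mulrC. Qed.

Lemma pair_lin (lam q c : R) h I h1 I1 : harmonic_pair lam q h I ->
  harmonic_pair lam q h1 I1 ->
  harmonic_pair lam q (fun x => h x - c * h1 x) (fun x => I x - c * I1 x).
Proof.
move=> H H1 x x0; have [dI dh] := H x x0; have [dI1 dh1] := H1 x x0.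
by split; apply: is_derive_eq; rewrite /GRing.scale/=; ring.
Qed.

Lemma pair_unique (lam q : R) h I z0 : 0 <= q -> harmonic_pair lam q h I ->
  I x @[x --> 0^'+] --> 0 -> 0 < z0 -> I z0 = 0 ->
  forall x, 0 < x < z0 -> I x = 0 /\ h x = 0.
Proof.
move=> q0 H I00 z00 Iz0.
pose n := q + lam.
pose p x : R := x `^ (- n) * expR x.
pose V x := p x * (I x * (h x - I x)).
have p0 x : 0 < x -> 0 < p x by move=> x0; rewrite mulr_gt0 ?powR_gt0 ?expR_gt0.
have dp (x : R) : 0 < x -> is_derive x 1 p (p x * (1 - n / x)).
  move=> x0; have d := is_derive_powR (- n) x0.
  by rewrite /p; apply: is_derive_eq; rewrite /GRing.scale/=; ring.
have dV (x : R) : 0 < x -> is_derive x 1 V (p x * ((h x - I x) ^+ 2 + q * I x ^+ 2 / x)).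
  move=> x0; have [dI dh] := H x x0; have d := dp x x0.
  rewrite /V; apply: is_derive_eq; rewrite /GRing.scale/= /n.
  by field; exact: lt0r_neq0.
have V_le0 x : 0 < x -> x <= z0 -> V x <= 0.
  move=> x0 xz; have -> : 0 = V z0 by rewrite /V Iz0 mul0r mulr0.
  apply: (is_derive_ge0_le xz (f' := fun x => p x * ((h x - I x) ^+ 2 + q * I x ^+ 2 / x))).
    by move=> y /andP[xy _]; apply: dV; exact: lt_le_trans xy.
  move=> y /andP[xy _]; have y0 : 0 < y := lt_le_trans x0 xy.
  apply: mulr_ge0; first exact/ltW/p0.
  by rewrite addr_ge0 ?sqr_ge0// divr_ge0 ?(ltW y0)// mulr_ge0 ?sqr_ge0.
have I2_le (x y : R) : 0 < x -> x <= y -> y <= z0 -> I y ^+ 2 <= I x ^+ 2.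
  move=> x0 xy yz; rewrite -lerN2 !expr2.
  apply: (is_derive_ge0_le xy (f := fun x : R => - (I x * I x)) (f' := fun x : R => - (2 * (I x * (h x - I x))))).
    move=> u /andP[xu _]; have [dI _] := H u (lt_le_trans x0 xu).
    by apply: is_derive_eq; rewrite /GRing.scale/=; ring.
  move=> u /andP[xu uy]; have u0 := lt_le_trans x0 xu.
  rewrite oppr_ge0 pmulr_rle0//.
  by have := V_le0 u u0 (le_trans uy yz); rewrite /V pmulr_rle0// p0.
have I0 x : 0 < x -> x <= z0 -> I x = 0.
  move=> x0 xz; apply/eqP; rewrite -sqrf_eq0 eq_le sqr_ge0 andbT.
  have cI2 : I y ^+ 2 @[y --> 0^'+] --> 0.
    by rewrite -[X in _ --> X](expr0n R 2); under eq_fun do rewrite expr2; rewrite expr2; exact: cvgM.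
  apply: (cvgr_to_ge cI2); near=> y; apply: I2_le => //; near: y.
  exact: nbhs_right_le.
move=> x /andP[x0 xz]; split; first by rewrite I0// ltW.
have [dI _] := H x x0.
have d0 : is_derive x 1 I 0.
  apply: near_eq_is_derive (is_derive_cst (0 : R) x (1 : R)); near=> y.
  apply/esym/I0.
    by near: y; exact: lt_nbhsr.
  by apply/ltW; near: y; exact: lt_nbhsl.
have := @derive_val _ _ _ _ _ _ _ dI; rewrite (@derive_val _ _ _ _ _ _ _ d0) I0 ?ltW// subr0.
by move=> <-.
Unshelve. all: by end_near. Qed.

Lemma pair_proportional (lam q : R) h I h1 I1 : 0 <= q ->
  harmonic_pair lam q h I -> harmonic_pair lam q h1 I1 ->
  I x @[x --> 0^'+] --> 0 -> I1 x @[x --> 0^'+] --> 0 ->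
  (forall x, 0 < x -> I1 x != 0) ->
  exists c, forall x, 0 < x -> I x = c * I1 x /\ h x = c * h1 x.
Proof.
move=> q0 H H1 I0 I10 I1n0; exists (I 1 / I1 1) => x x0.
pose z := x + 1.
have xz : x < z by rewrite /z ltrDl.
have z1 : 1 < z by rewrite /z ltrDr.
have z0 : 0 < z by exact: lt_trans z1.
have cI0 : I y - I z / I1 z * I1 y @[y --> 0^'+] --> 0.
  rewrite -[X in _ --> X]subr0; apply: cvgB => //.
  by rewrite -[X in _ --> X](mulr0 (I z / I1 z)); apply: cvgM => //; exact: cvg_cst.
have Iz : I z - I z / I1 z * I1 z = 0 by rewrite divfK ?subrr// I1n0.
have U y (yz : 0 < y < z) := pair_unique q0 (pair_lin (I z / I1 z) H H1) cI0 z0 Iz yz.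
have -> : I 1 / I1 1 = I z / I1 z.
  have [] := U 1; first by rewrite ltr01.
  by move/eqP; rewrite subr_eq0 => /eqP -> _; rewrite mulfK// I1n0.
have [] := U x; first by rewrite x0.
by move=> /eqP; rewrite subr_eq0 => /eqP -> /eqP; rewrite subr_eq0 => /eqP ->.
Qed.

End pair_theory.

Section K1_pair.
Context {R : realType}.
Variables (lam q : R).
Hypotheses (lam_gt0 : 0 < lam) (q_ge0 : 0 <= q).
Let n := q + lam.
Let n_gt0 : 0 < n. Proof. by rewrite /n; have := lam_gt0; have := q_ge0; lra. Qed.
Let n1_gt0 : 0 < n + 1. Proof. by rewrite addr_gt0. Qed.
Let q1_gt0 : 0 < q + 1. Proof. by rewrite ltr_wpDl. Qed.

Let M1 := KummerM (q + 1) (n + 1).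
Let M2 := KummerM (q + 1) (n + 1 + 1).

Let dM1 (z : R) : is_derive z 1 M1 (M1 z - lam / (n + 1) * M2 z).
Proof.
have d := is_derive_KummerM z q1_gt0 n1_gt0.
suff -> : M1 z - lam / (n + 1) * M2 z = 'D_1 M1 z by apply/derivableP.
have := KummerM_sub_derive z q1_gt0 n1_gt0.
have -> : n + 1 - (q + 1) = lam by rewrite /n; ring.
by rewrite -/M1 -/M2 => <-; ring.
Qed.

Let dM2 (z : R) : 0 < z -> is_derive z 1 M2 ((n + 1) * (M1 z - M2 z) / z).
Proof.
move=> z0; have d := is_derive_KummerM z q1_gt0 (addr_gt0 n1_gt0 ltr01).
suff -> : (n + 1) * (M1 z - M2 z) / z = 'D_1 M2 z by apply/derivableP.
by rewrite -(KummerM_derive_raise_be z q1_gt0 n1_gt0) mulrAC divff ?mul1r// lt0r_neq0.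
Qed.

Lemma K1_pair : harmonic_pair lam q (K1 q n) (fun z => K1 q (n + 1) z / (n + 1)).
Proof.
move=> z z0; have d1 := dM1 z; have d2 := dM2 z0.
have p1 := is_derive_powR n z0; have p2 := is_derive_powR (n + 1) z0.
have zn := lt0r_neq0 z0; have nn := lt0r_neq0 n1_gt0.
split; rewrite /K1 -/M1 -/M2; apply: is_derive_eq; rewrite /GRing.scale/= (powR_succ _ z0).
  by field; rewrite zn nn.
by rewrite -/n; field; rewrite zn nn.
Qed.

Let E z := M1 z - z * M2 z / (n + 1).

Let M1_ge1 z : 0 <= z -> 1 <= M1 z.
Proof. exact: KummerM_ge1. Qed.
Let M2_ge1 z : 0 <= z -> 1 <= M2 z.
Proof. by apply: KummerM_ge1 => //; rewrite addr_gt0. Qed.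

Let cM1 : continuous M1.
Proof. by move=> z; exact: is_derive_continuous (dM1 z). Qed.
Let cM2 : continuous M2.
Proof.
move=> z; apply: is_derive_continuous.
by apply: is_derive_KummerM => //; rewrite addr_gt0.
Qed.

Let E_ge1 z : 0 <= z -> 1 <= E z.
Proof.
rewrite le_eqVlt => /orP[/eqP <-|z0].
  by rewrite /E !mul0r subr0 M1_ge1.
have E0 : E y @[y --> 0^'+] --> (1 : R).
  have -> : (1 : R) = M1 0 - 0 * M2 0 / (n + 1) by rewrite !mul0r subr0 /M1 KummerM0.
  apply: cvg_at_right_filter; apply: cvgB; first exact: cM1.
  apply: cvgM; last exact: cvg_cst.
  by apply: cvgM; [exact: cvg_id|exact: cM2].
apply: (cvgr_to_le E0); near=> y.
have y0 : 0 < y by near: y; exact: nbhs_right_gt.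
have yz : y <= z by near: y; exact: nbhs_right_le.
apply: (@is_derive_ge0_le _ E (fun y => M2 y * (q / (n + 1))) _ _ yz).
- move=> u /andP[yu _]; have u0 := lt_le_trans y0 yu.
  have d1 := dM1 u; have d2 := dM2 u0.
  have zn := lt0r_neq0 u0; have nn := lt0r_neq0 n1_gt0.
  rewrite /E; apply: is_derive_eq; rewrite /GRing.scale/=.
  have -> : lam = n - q by rewrite /n; ring.
  by field; rewrite zn nn.
- move=> u /andP[yu _]; have u0 := lt_le_trans y0 yu.
  by rewrite mulr_ge0 ?divr_ge0 ?(ltW n1_gt0)// (le_trans ler01)// M2_ge1// ltW.
Unshelve. all: by end_near. Qed.

Lemma K1_gt0 z : 0 < z -> 0 < K1 q n z.
Proof.
move=> z0; rewrite /K1 !mulr_gt0 ?powR_gt0 ?expR_gt0//.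
by rewrite (lt_le_trans ltr01)// M1_ge1// ltW.
Qed.

Lemma K1_succ_gt0 z : 0 < z -> 0 < K1 q (n + 1) z.
Proof.
move=> z0; rewrite /K1 !mulr_gt0 ?powR_gt0 ?expR_gt0//.
by rewrite (lt_le_trans ltr01)// M2_ge1// ltW.
Qed.

Lemma K1_gt_succ z : 0 < z -> K1 q (n + 1) z / (n + 1) < K1 q n z.
Proof.
move=> z0; rewrite -subr_gt0.
rewrite [ltRHS](_ : _ = z `^ n * expR (- z) * E z); last first.
  by rewrite /K1 (powR_succ _ z0) /E -/M1 -/M2; ring.
by rewrite !mulr_gt0 ?powR_gt0 ?expR_gt0// (lt_le_trans ltr01)// E_ge1// ltW.
Qed.

Lemma K1_lt x y : 0 < x -> x < y -> K1 q n x < K1 q n y.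
Proof.
move=> x0 xy; have y0 := lt_trans x0 xy.
have dK (u : R) : 0 < u -> is_derive u 1 (K1 q n)
    ((n * K1 q n u - lam * (K1 q (n + 1) u / (n + 1))) / u).
  by move=> u0; have [_] := K1_pair u0.
have dfo (u : R) : u \in `]x, y[ -> is_derive u 1 (K1 q n)
    ((n * K1 q n u - lam * (K1 q (n + 1) u / (n + 1))) / u).
  by rewrite in_itv/= => /andP[xu _]; apply: dK; exact: lt_trans xu.
have [|u] := MVT xy dfo.
  apply: continuous_in_subspaceT => u /set_mem; rewrite /= in_itv/= => /andP[xu _].
  by apply: is_derive_continuous (dK u _); exact: lt_le_trans xu.
rewrite in_itv/= => /andP[xu _]; have u0 := lt_trans x0 xu.
rewrite -subr_gt0 => ->; rewrite mulr_gt0 ?subr_gt0// divr_gt0//.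
have g1 := K1_gt_succ u0; have g2 := K1_gt0 u0.
have : 0 < lam * (K1 q n u - K1 q (n + 1) u / (n + 1)) by rewrite mulr_gt0 ?subr_gt0.
have : 0 <= q * K1 q n u by rewrite mulr_ge0// ltW.
by rewrite /n; lra.
Qed.

Lemma K1_succ_cvg0 : K1 q (n + 1) z / (n + 1) @[z --> 0^'+] --> 0.
Proof.
have cf : expR (- z) * M2 z / (n + 1) @[z --> 0^'+] --> expR (- 0) * M2 0 / (n + 1).
  apply: cvg_at_right_filter; apply: cvgM; last exact: cvg_cst.
  by apply: cvgM; [exact: continuous_expRN|exact: cM2].
have H : z `^ (n + 1) * (expR (- z) * M2 z / (n + 1)) @[z --> 0^'+] --> (0 : R).
  rewrite -[X in _ --> X](mul0r (expR (- 0) * M2 0 / (n + 1))).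
  by apply: cvgM => //; exact: powR_cvg0.
by apply: cvg_trans H; apply: near_eq_cvg; near=> z; rewrite /K1 -/M2; ring.
Unshelve. all: by end_near. Qed.

Let N1 := KummerM lam (n + 1).
Let N2 := KummerM (lam + 1) (n + 1 + 1).
Let lam1_gt0 : 0 < lam + 1. Proof. by rewrite addr_gt0. Qed.

Let dN1 (z : R) : is_derive z 1 (fun z : R => N1 (- z)) (- (lam / (n + 1) * N2 (- z))).
Proof.
have d := is_derive_KummerM (- z) lam_gt0 n1_gt0.
have := @is_derive1_comp _ N1 (fun z : R => - z) z _ _ d (is_deriveNid z 1).
by rewrite mulrN1.
Qed.

Let dN2 (z : R) : 0 < z -> is_derive z 1 (fun z : R => N2 (- z))
  (((n + 1) * (N1 (- z) - N2 (- z)) - z * N2 (- z)) / z).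
Proof.
move=> z0; have d := is_derive_KummerM (- z) lam1_gt0 (addr_gt0 n1_gt0 ltr01).
have d' : is_derive (- z) 1 N2 ('D_1 N2 (- z)) by apply/derivableP.
have := @is_derive1_comp _ N2 (fun z : R => - z) z _ _ d' (is_deriveNid z 1).
rewrite mulrN1; suff -> : - 'D_1 N2 (- z) =
  ((n + 1) * (N1 (- z) - N2 (- z)) - z * N2 (- z)) / z by [].
have E2 := KummerM_raise_al_be (- z) lam_gt0 n1_gt0.
apply: (mulIf (lt0r_neq0 z0)); rewrite divfK ?lt0r_neq0// -/N1 -/N2.
by move: E2; rewrite -/N1 -/N2; lra.
Qed.

Let transformed_pair : harmonic_pair lam q (fun z => z `^ n * N1 (- z))
  (fun z => z `^ (n + 1) * N2 (- z) / (n + 1)).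
Proof.
move=> z z0; have d1 := dN1 z; have d2 := dN2 z0.
have p1 := is_derive_powR n z0; have p2 := is_derive_powR (n + 1) z0.
have zn := lt0r_neq0 z0; have nn := lt0r_neq0 n1_gt0.
split; apply: is_derive_eq; rewrite /GRing.scale/= (powR_succ _ z0).
  by field; rewrite zn nn.
by rewrite -/n; field; rewrite zn nn.
Qed.

Let cN1 : {for 0, continuous (fun z : R => N1 (- z))}.
Proof. by apply: is_derive_continuous (dN1 0). Qed.
Let cN2 : {for 0, continuous (fun z : R => N2 (- z))}.
Proof.
have d := is_derive_KummerM (- 0) lam1_gt0 (addr_gt0 n1_gt0 ltr01).
have d2 := @is_derive1_comp _ N2 (fun z : R => - z) 0 _ _ d (is_deriveNid (0 : R) (1 : R)).
exact: (@is_derive_continuous _ (N2 \o (fun z : R => - z)) _ _ d2).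
Qed.

Lemma K1_transformation z : 0 < z -> K1 q n z = z `^ n * KummerM lam (n + 1) (- z).
Proof.
move=> z0.
have I20 : z `^ (n + 1) * N2 (- z) / (n + 1) @[z --> 0^'+] --> 0.
  have H : u `^ (n + 1) * (N2 (- u) / (n + 1)) @[u --> 0^'+] --> (0 : R).
    rewrite -[X in _ --> X](mul0r (N2 (- 0) / (n + 1))).
    apply: cvgM; first exact: powR_cvg0.
    by apply: cvgM; [exact: cvg_at_right_filter cN2|exact: cvg_cst].
  by apply: cvg_trans H; apply: near_eq_cvg; near=> u; rewrite mulrA.
have I1n0 u : 0 < u -> K1 q (n + 1) u / (n + 1) != 0.
  by move=> u0; rewrite lt0r_neq0// divr_gt0// K1_succ_gt0.
have [c Hc] := pair_proportional q_ge0 transformed_pair K1_pair I20 K1_succ_cvg0 I1n0.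
suff c1 : c = 1 by have [_ ->] := Hc z z0; rewrite c1 mul1r.
have e1 : c * (expR (- u) * M1 u) @[u --> 0^'+] --> c * (expR (- 0) * M1 0).
  apply: cvgM; first exact: cvg_cst.
  by apply: cvg_at_right_filter; apply: cvgM; [exact: continuous_expRN|exact: cM1].
have e2 := cvg_at_right_filter cN1.
have M10 : M1 0 = 1 by rewrite /M1 KummerM0.
have N10 : N1 (- 0) = 1 by rewrite oppr0 /N1 KummerM0.
rewrite oppr0 expR0 mul1r M10 mulr1 in e1; rewrite /= N10 in e2.
suff e3 : c * (expR (- u) * M1 u) @[u --> 0^'+] --> (1 : R) by exact: cvg_unique e1 e3.
apply: cvg_trans e2; apply: near_eq_cvg; near=> u.
have u0 : 0 < u by near: u; exact: nbhs_right_gt.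
have [_] := Hc u u0; rewrite /K1 -/M1 => /eqP; rewrite -mulrA mulrCA.
by rewrite (inj_eq (mulfI (lt0r_neq0 (powR_gt0 n u0)))) => /eqP ->.
Unshelve. all: by end_near. Qed.

End K1_pair.

Section q_harmonic.
Context {R : realType}.
Notation mu := (@lebesgue_measure R).
Variables (lam q : R).
Implicit Types (h I : R -> R).

Let dsub (z c : R) : is_derive c 1 (fun c : R => z - c) (-1).
Proof. have -> : -1 = 0 - 1 :> R by rewrite sub0r. exact: is_deriveB. Qed.

Lemma pair_q_harmonic h I : harmonic_pair lam q h I ->
  (forall x, 0 < x -> 0 <= h x) -> I x @[x --> 0^'+] --> 0 -> q_harmonic lam q h.
Proof.
move=> hI h0 I0 z z0.
pose f (c : R) := h (z - c) * expR (- c).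
pose G (c : R) := - (expR (- c) * I (z - c)).
have dG (c : R) : c < z -> is_derive c 1 G (f c).
  rewrite -subr_gt0 => zc; have [dI _] := hI _ zc.
  have d2 := @is_derive1_comp _ I (fun c : R => z - c) c _ _ dI (dsub z c).
  have d3 : is_derive c 1 (fun c : R => I (z - c)) _ := d2.
  by rewrite /G /f; apply: is_derive_eq; rewrite /GRing.scale/=; ring.
have cf (c : R) : 0 < c < z -> {for c, continuous f}.
  move=> /andP[_]; rewrite -subr_gt0 => zc; have [_ dh] := hI _ zc.
  apply: cvgM; last exact: continuous_expRN.
  have d2 := @is_derive1_comp _ h (fun c : R => z - c) c _ _ dh (dsub z c).
  exact: (@is_derive_continuous _ (h \o (fun c : R => z - c)) _ _ d2).
have f0 (c : R) : 0 < c < z -> 0 <= f c.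
  by move=> /andP[_]; rewrite -subr_gt0 => zc; rewrite mulr_ge0 ?expR_ge0 ?h0.
have If : (\int[mu]_(c in `]0%R, z%R[) (f c)%:E = (I z)%:E)%E.
  have dGo (c : R) : 0 < c < z -> is_derive c 1 G (f c) by move=> /andP[_ /dG].
  rewrite (ge0_FTC_oo (F := G) (Fa := - I z) (Fb := 0) z0 f0 cf dGo).
  - by rewrite sub0r opprK.
  - apply: cvg_at_right_filter.
    have G0 : G 0 = - I z by rewrite /G oppr0 expR0 mul1r addr0.
    by rewrite -G0; apply: is_derive_continuous (dG 0 z0).
  - have e1 : expR (- c) @[c --> z^'-] --> expR (- z).
      by apply: cvg_at_left_filter; exact: continuous_expRN.
    have e2 : I (z - c) @[c --> z^'-] --> 0.
      apply: (@cvg_comp _ _ _ (fun c : R => z - c) I _ _ _ _ I0) => A [e e0 He].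
      exists e => // c /= cz; rewrite -subr_gt0 => zc.
      by apply: He => //=; rewrite sub0r normrN.
    have -> : (0 : R) = - (expR (- z) * 0) by rewrite mulr0 oppr0.
    by apply: cvgN; apply: cvgM.
have [_ dh] := hI z z0.
split=> //.
- apply/integrableP; split.
    apply/measurable_EFinP; apply: open_continuous_measurable_fun => // c /set_mem.
    by rewrite /= in_itv/=; exact: cf.
  rewrite (_ : (\int[mu]_(x in _) _)%E = (I z)%:E) ?ltry// -If.
  apply: eq_integral => c /set_mem; rewrite /= in_itv/= => /f0 fc0.
  by rewrite ger0_norm.
- rewrite derive1E derive_val /Rintegral If /= mulrC divfK ?lt0r_neq0//.
  by rewrite [lam + q]addrC; ring.
Qed.

Lemma derive_eq_increment (F G f : R -> R) (a b Fa Fb Ga Gb : R) : a < b ->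
  (forall x : R, a < x < b -> is_derive x 1 F (f x) /\ is_derive x 1 G (f x)) ->
  F x @[x --> a^'+] --> Fa -> F x @[x --> b^'-] --> Fb ->
  G x @[x --> a^'+] --> Ga -> G x @[x --> b^'-] --> Gb -> Fb - Fa = Gb - Ga.
Proof.
move=> ab dFG cFa cFb cGa cGb.
pose K x := F x - G x.
have dK (x : R) : a < x < b -> is_derive x 1 K 0.
  by move=> /dFG[dF dG]; rewrite /K; apply: is_derive_eq; rewrite subrr.
pose m := (a + b) / 2.
have am : a < m by rewrite /m; lra.
have mb : m < b by rewrite /m; lra.
have Km x : a < x < b -> K x = K m.
  have le_K (u v : R) : a < u -> v < b -> u <= v -> K u = K v.
    move=> au vb uv; apply/eqP; rewrite eq_le; apply/andP; split.
      apply: (@is_derive_ge0_le _ K (fun=> 0) _ _ uv) => // w /andP[uw wv].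
      by apply: dK; rewrite (lt_le_trans au uw) (le_lt_trans wv vb).
    rewrite -lerN2; apply: (@is_derive_ge0_le _ (fun x => - K x) (fun=> 0) _ _ uv) => // w /andP[uw wv].
    have := dK w; rewrite (lt_le_trans au uw) (le_lt_trans wv vb) => /(_ isT) d.
    by apply: is_derive_eq; rewrite oppr0.
  move=> /andP[ax xb]; have [xm|mx] := leP x m; first exact: le_K.
  by apply/esym/le_K => //; exact: ltW.
have e1 : Fa - Ga = K m.
  suff e3 : F x - G x @[x --> a^'+] --> K m by exact: cvg_unique (cvgB cFa cGa) e3.
  have cK : (fun=> K m) x @[x --> a^'+] --> K m by exact: cvg_cst.
  apply: cvg_trans cK.
  apply: near_eq_cvg; near=> x; rewrite -(Km x)//.
  by apply/andP; split; near: x; [exact: nbhs_right_gt|exact: nbhs_right_lt].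
have e2 : Fb - Gb = K m.
  suff e3 : F x - G x @[x --> b^'-] --> K m by exact: cvg_unique (cvgB cFb cGb) e3.
  have cK : (fun=> K m) x @[x --> b^'-] --> K m by exact: cvg_cst.
  apply: cvg_trans cK.
  apply: near_eq_cvg; near=> x; rewrite -(Km x)//.
  by apply/andP; split; near: x; [exact: nbhs_left_gt|exact: nbhs_left_lt].
lra.
Unshelve. all: by end_near. Qed.

Lemma primitive_oo (f : R -> R) (b : R) : 0 < b ->
  mu.-integrable `]0, b[ (EFin \o f) ->
  (forall x : R, 0 < x < b -> {for x, continuous f}) ->
  exists2 G : R -> R, (forall x : R, 0 < x < b -> is_derive x 1 G (f x)) &
    G x @[x --> 0^'+] --> 0 /\
    G x @[x --> b^'-] --> \int[mu]_(x in `]0, b[) f x.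
Proof.
move=> b0 intf cf.
pose g := f \_ `]0, b[.
have ig : mu.-integrable `[0, b] (EFin \o g).
  rewrite -restrict_EFin; apply/integrable_restrict => //=.
  by rewrite setIidr// => x /=; rewrite !in_itv/= => /andP[/ltW-> /ltW->].
pose G (x : R) := \int[mu]_(t in `[0, x]) g t.
have cG := parameterized_integral_continuous (ltW b0) ig.
have [_ cG0 cGb] := (continuous_within_itvP _ b0).1 cG.
exists G.
  move=> x xb; have /andP[x0 xltb] := xb.
  have gx : {for x, continuous g}.
    have := cf x xb; rewrite /prop_for /continuous_at.
    have -> : g x = f x by rewrite /g patchE mem_set//= in_itv.
    apply: cvg_trans; apply: near_eq_cvg; near=> y.
    rewrite /g patchE mem_set//= in_itv/=; apply/andP; split.
      by near: y; exact: lt_nbhsr.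
    by near: y; exact: lt_nbhsl.
  have [d1 d2] := continuous_FTC1_closed xltb ig x0 gx.
  apply: DeriveDef => //; rewrite -derive1E d2.
  by rewrite /g patchE mem_set//= in_itv.
split.
  have G0 : G 0 = 0 by rewrite /G set_itv1 Rintegral_set1.
  by move: cG0; rewrite /parameterized_integral -[in X in _ --> X]/(G 0) G0.
have Gb : G b = \int[mu]_(x in `]0, b[) f x.
  rewrite /G /Rintegral; congr (fine _).
  transitivity (\int[mu]_(x in `[0%R, b%R]) (((EFin \o f) \_ `]0%R, b%R[) x))%E.
    by apply: eq_integral => x _; rewrite restrict_EFin.
  rewrite -integral_mkcondr setIidr// => x /=.
  by rewrite !in_itv/= => /andP[/ltW-> /ltW->].
by rewrite -Gb; exact: cGb.
Unshelve. all: by end_near. Qed.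

Lemma q_harmonic_pair h : 0 < lam -> q_harmonic lam q h ->
  exists2 I, harmonic_pair lam q h I & I x @[x --> 0^'+] --> 0.
Proof.
move=> lam0 hq.
pose f (z c : R) := h (z - c) * expR (- c).
pose I (z : R) := \int[mu]_(c in `]0, z[) f z c.
have dh (x : R) : 0 < x -> is_derive x 1 h (((q + lam) * h x - lam * I x) / x).
  move=> x0; have [d _ e] := hq x x0.
  apply: DeriveDef => //; rewrite -derive1E.
  apply: (mulIf (lt0r_neq0 x0)); rewrite divfK ?lt0r_neq0//.
  by move: e; rewrite -/(I x) [q + lam]addrC; lra.
have ch (x : R) : 0 < x -> {for x, continuous h}.
  by move=> x0; exact: is_derive_continuous (dh x x0).
have cf (z c : R) : 0 < c < z -> {for c, continuous (f z)}.
  move=> /andP[_]; rewrite -subr_gt0 => zc.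
  apply: cvgM; last exact: continuous_expRN.
  have d2 := @is_derive1_comp _ h (fun c : R => z - c) c _ _ (dh _ zc) (dsub z c).
  exact: (@is_derive_continuous _ (h \o (fun c : R => z - c)) _ _ d2).
have prim (z : R) : 0 < z -> exists2 G : R -> R,
    (forall x : R, 0 < x < z -> is_derive x 1 G (f z x)) &
    G x @[x --> 0^'+] --> 0 /\ G x @[x --> z^'-] --> I z.
  by move=> z0; have [_ i _] := hq z z0; apply: primitive_oo => // x; exact: cf.
have loc (b : R) : 0 < b -> exists J : R -> R,
    [/\ forall z : R, 0 < z < b -> is_derive z 1 J (h z - J z),
        J x @[x --> 0^'+] --> 0 & forall z, 0 < z < b -> I z = J z].
  move=> b0; have [G dG [G0 Gb]] := prim b b0.
  pose J z := expR (b - z) * (I b - G (b - z)).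
  have dJ (z : R) : 0 < z < b -> is_derive z 1 J (h z - J z).
    move=> /andP[z0 zb]; have bz : 0 < b - z < b by lra.
    have d1 := @is_derive1_comp _ G (fun c : R => b - c) z _ _ (dG _ bz) (dsub b z).
    have d1' : is_derive z 1 (fun z : R => G (b - z)) _ := d1.
    have d2 := @is_derive1_comp _ expR (fun c : R => b - c) z _ _ (is_derive_expR (b - z)) (dsub b z).
    have d2' : is_derive z 1 (fun z : R => expR (b - z)) _ := d2.
    have eb : h z = expR (b - z) * expR (- (b - z)) * h z.
      by rewrite -expRD subrr expR0 mul1r.
    rewrite /J; apply: is_derive_eq; rewrite /GRing.scale/= /f.
    have -> : b - (b - z) = z by ring.
    by rewrite [h z in RHS]eb; ring.
  have J0 : J x @[x --> 0^'+] --> 0.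
    have J0E : expR (b - 0) * (I b - I b) = 0 by rewrite subrr mulr0.
    rewrite -[X in _ --> X]J0E.
    apply: cvgM.
      apply: cvg_at_right_filter.
      have d2 := @is_derive1_comp _ expR (fun c : R => b - c) 0 _ _ (is_derive_expR (b - 0)) (dsub b 0).
      exact: (@is_derive_continuous _ (expR \o (fun c : R => b - c)) _ _ d2).
    apply: cvgB; first exact: cvg_cst.
    apply: (@cvg_comp _ _ _ (fun x : R => b - x) G _ _ _ _ Gb) => A [e e0 He].
    exists e => // x /=; rewrite sub0r normrN => xe x0.
    by apply: He => /=; [rewrite opprB addrC subrK|rewrite gtrBl].
  exists J; split=> // z /andP[z0 zb].
  have [Gz dGz [Gz0 Gzz]] := prim z z0.
  pose F c := - (expR (- c) * J (z - c)).
  have zc0 (c : R) : 0 < c < z -> 0 < z - c < b by lra.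
  have dF (c : R) : 0 < z - c < b -> is_derive c 1 F (f z c).
    move=> zc; have d1 := @is_derive1_comp _ J (fun c : R => z - c) c _ _ (dJ _ zc) (dsub z c).
    have d1' : is_derive c 1 (fun c : R => J (z - c)) _ := d1.
    by rewrite /F /f; apply: is_derive_eq; rewrite /GRing.scale/=; ring.
  have e : I z - 0 = 0 - - J z.
    apply: (@derive_eq_increment Gz F (f z) 0 z 0 (I z) (- J z) 0 z0 _ Gz0 Gzz).
    - by move=> x xz; split; [exact: dGz|apply: dF; exact: zc0].
    - have -> : - J z = F 0 by rewrite /F oppr0 expR0 mul1r addr0.
      apply: cvg_at_right_filter; apply: is_derive_continuous (dF 0 _).
      by rewrite subr0 z0.
    - have -> : (0 : R) = - (expR (- z) * 0) by rewrite mulr0 oppr0.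
      apply: cvgN; apply: cvgM.
        by apply: cvg_at_left_filter; exact: continuous_expRN.
      apply: (@cvg_comp _ _ _ (fun c : R => z - c) J _ _ _ _ J0) => A [e e0 He].
      exists e => // c /= cz; rewrite -subr_gt0 => zc.
      by apply: He => //=; rewrite sub0r normrN.
  by move: e; rewrite subr0 sub0r opprK.
exists I.
  move=> x x0; split; last exact: dh.
  have x1 : 0 < x + 1 by rewrite addr_gt0.
  have [J [dJ _ IJ]] := loc _ x1.
  have xx1 : 0 < x < x + 1 by rewrite x0 ltrDl ltr01.
  rewrite (IJ x xx1); apply: near_eq_is_derive (dJ x xx1); near=> y.
  apply/esym/IJ; apply/andP; split.
    by near: y; exact: lt_nbhsr.
  by near: y; apply: lt_nbhsl; rewrite ltrDl.
have [J [_ J0 IJ]] := loc _ ltr01.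
apply: cvg_trans J0; apply: near_eq_cvg; near=> y.
apply/esym/IJ; apply/andP; split; near: y; first exact: nbhs_right_gt.
exact: nbhs_right_lt.
Unshelve. all: by end_near. Qed.

End q_harmonic.

(** * The Tricomi function *)

Section tricomi.
Context {R : realType}.
Notation mu := (@lebesgue_measure R).
Implicit Types (p nu z r t : R).

Lemma powR_le_expR p nu r : 0 <= p -> 0 < r ->
  exists2 K : R, 0 < K & forall t, 0 <= t -> t `^ p * (1 + t) `^ nu <= K * expR (r * t).
Proof.
move=> p0 r0.
pose m := p + `|nu| + 1.
have m0 : 0 < m by rewrite /m ltr_wpDl// addr_ge0.
pose e := r / m.
have e0 : 0 < e by rewrite divr_gt0.
pose K := 1 + e^-1.
have K0 : 0 < K by rewrite addr_gt0// invr_gt0.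
exists (K `^ m); first exact: powR_gt0.
move=> t t0.
have t1 : 1 <= 1 + t by rewrite lerDl.
have t10 : 0 <= 1 + t by exact: le_trans ler01 t1.
have e1 : 1 + t <= K * expR (e * t).
  apply: (@le_trans _ _ (K * (1 + e * t))); last by rewrite ler_pM2l// expR_ge1Dx.
  rewrite /K mulrDl !mul1r mulrDr mulr1 mulrA mulVf ?lt0r_neq0// mul1r.
  have h1 : 0 < e^-1 by rewrite invr_gt0.
  have h2 : 0 <= e * t by rewrite mulr_ge0// ltW.
  lra.
apply: (@le_trans _ _ ((1 + t) `^ m)).
  apply: (@le_trans _ _ ((1 + t) `^ p * (1 + t) `^ `|nu|)).
    apply: ler_pM; rewrite ?powR_ge0//.
      by apply: ge0_ler_powR; rewrite ?nnegrE// lerDr.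
    by apply: ler_powR => //; exact: ler_norm.
  rewrite -powRD; last by rewrite (lt0r_neq0 (lt_le_trans ltr01 t1)) implybT.
  by apply: ler_powR => //; rewrite /m lerDl.
apply: (@le_trans _ _ ((K * expR (e * t)) `^ m)).
  by apply: ge0_ler_powR; rewrite ?nnegrE ?mulr_ge0 ?expR_ge0// ltW.
rewrite powRM ?expR_ge0 ?(ltW K0)//.
rewrite [expR _ `^ _]/powR gt_eqF ?expR_gt0// expRK.
by rewrite /e (_ : m * (r / m * t) = r * t)//; field; exact: lt0r_neq0.
Qed.

Definition tricomi_density p nu z t : R := expR (- (z * t)) * t `^ p * (1 + t) `^ nu.

Lemma tricomi_density_ge0 p nu z t : 0 <= tricomi_density p nu z t.
Proof. by rewrite !mulr_ge0 ?expR_ge0 ?powR_ge0. Qed.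

Lemma is_derive_tricomi_density p nu z t : 0 < t ->
  is_derive t 1 (tricomi_density p nu z)
    (tricomi_density p nu z t * (- z + p / t + nu / (1 + t))).
Proof.
move=> t0; have t10 : 0 < 1 + t by rewrite addr_gt0.
have d1 := is_derive_powR p t0.
have dt : is_derive t 1 (fun t : R => 1 + t) 1.
  by apply: is_derive_eq; rewrite add0r ?mulr1.
have d2 := @is_derive1_comp _ (fun x : R => x `^ nu) (fun t : R => 1 + t) t _ _
  (is_derive_powR nu t10) dt.
have d2' : is_derive t 1 (fun t : R => (1 + t) `^ nu) _ := d2.
rewrite /tricomi_density; apply: is_derive_eq; rewrite /GRing.scale/=.
by ring.
Qed.

Lemma tricomi_density_continuous p nu z t : 0 < t ->
  {for t, continuous (tricomi_density p nu z)}.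
Proof. by move=> t0; exact: is_derive_continuous (is_derive_tricomi_density p nu z t0). Qed.

Lemma measurable_tricomi_density p nu z :
  measurable_fun (`]0, +oo[%classic : set R) (tricomi_density p nu z).
Proof.
apply: open_continuous_measurable_fun => // t /set_mem.
by rewrite /= in_itv/= andbT; exact: tricomi_density_continuous.
Qed.

Lemma integrable_exp (K r : R) : 0 < r ->
  mu.-integrable `]0, +oo[ (fun t : R => (K * expR (- (r * t)))%:E).
Proof.
move=> r0.
have i1 : mu.-integrable `]0, +oo[ (fun t : R => (r * expR (- (r * t)))%:E).
  apply/integrableP; split.
    by apply/measurable_EFinP; apply: measurable_funS (measurable_exp_density r).
  under eq_integral => t _ do rewrite /= ger0_norm ?mulr_ge0 ?expR_ge0 ?(ltW r0)//.
  by rewrite exp_tail// ltry.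
have i2 : mu.-integrable `]0, +oo[ (fun t : R => ((K / r)%:E * (r * expR (- (r * t)))%:E)%E).
  exact: integrableZl.
apply: eq_integrable i2 => // t _; rewrite /= -EFinM; congr (_%:E).
by rewrite mulrA divfK// lt0r_neq0.
Qed.

Lemma integrable_tricomi p nu z : 0 <= p -> 0 < z ->
  mu.-integrable `]0, +oo[ (EFin \o tricomi_density p nu z).
Proof.
move=> p0 z0; have z20 : 0 < z / 2 by rewrite divr_gt0.
have [K K0 HK] := powR_le_expR nu p0 z20.
have bd (t : R) : 0 < t -> tricomi_density p nu z t <= K * expR (- (z / 2 * t)).
  move=> t0; have -> : expR (- (z / 2 * t)) = expR (- (z * t)) * expR (z / 2 * t).
    by rewrite -expRD; congr expR; field.
  by rewrite /tricomi_density -mulrA [leRHS]mulrCA ler_wpM2l ?expR_ge0// HK// ltW.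
apply: le_integrable (integrable_exp K z20) => //.
  by apply/measurable_EFinP; exact: measurable_tricomi_density.
move=> t; rewrite /= in_itv/= andbT => t0; rewrite lee_fin.
by rewrite !ger0_norm ?tricomi_density_ge0 ?mulr_ge0 ?expR_ge0 ?(ltW K0)// bd.
Qed.

Definition tricomi_int p nu z : R := \int[mu]_(t in `]0, +oo[) tricomi_density p nu z t.

Let integrable_shrink (f : R -> R) :
  mu.-integrable `]0, +oo[ (EFin \o f) -> mu.-integrable `]1, +oo[ (EFin \o f).
Proof.
apply: integrableS => // t; rewrite /= !in_itv/= !andbT; exact: lt_trans.
Qed.

Lemma tricomi_int_gt0 p nu z : 0 <= p -> 0 < z -> 0 < tricomi_int p nu z.
Proof.
move=> p0 z0.
have [K K0 HK] := powR_le_expR (- nu) (lexx 0) ltr01.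
have z10 : 0 < z + 1 by rewrite addr_gt0.
pose g t : R := K^-1 * expR (- ((z + 1) * t)).
have ig := integrable_exp K^-1 z10.
have i1 := integrable_tricomi nu p0 z0.
have ig1 : mu.-integrable `]1, +oo[ (EFin \o g) by exact: integrable_shrink.
have i11 := integrable_shrink i1.
have e1 : \int[mu]_(t in `]1, +oo[) g t = K^-1 / (z + 1) * expR (- ((z + 1) * 1)).
  have <- : \int[mu]_(t in `]1, +oo[) ((K^-1 / (z + 1)) * ((z + 1) * expR (- ((z + 1) * t)))) =
      \int[mu]_(t in `]1, +oo[) g t.
    by apply: eq_Rintegral => t _; rewrite mulrA divfK ?lt0r_neq0.
  rewrite RintegralZl//; first by rewrite /Rintegral exp_tail.
  exact/integrable_shrink/integrable_exp.
have bd (t : R) : 1 < t -> g t <= tricomi_density p nu z t.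
  move=> t1; have t0 := lt_trans ltr01 t1; have t10 : 0 < 1 + t by rewrite addr_gt0.
  have := HK t (ltW t0); rewrite powRr0 mul1r mul1r powRN => h1.
  rewrite /g /tricomi_density mulrDl mul1r opprD expRD mulrCA -mulrA.
  rewrite ler_pM2l ?expR_gt0//.
  apply: (@le_trans _ _ ((1 + t) `^ nu)).
    rewrite expRN -invfM invf_ple ?posrE ?mulr_gt0 ?expR_gt0 ?powR_gt0//.
  rewrite ler_peMl ?powR_ge0//.
  by rewrite -(powRr0 t); apply: ler_powR => //; exact: ltW.
apply: (@lt_le_trans _ _ (\int[mu]_(t in `]1, +oo[) g t)).
  by rewrite e1 !mulr_gt0 ?invr_gt0 ?expR_gt0.
apply: (@le_trans _ _ (\int[mu]_(t in `]1, +oo[) tricomi_density p nu z t)).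
  apply: le_Rintegral => // t; rewrite /= in_itv/= andbT; exact: bd.
rewrite /tricomi_int /Rintegral fine_le//.
- exact: integrable_fin_num.
- exact: integrable_fin_num.
- apply: ge0_subset_integral => //.
  + by apply/measurable_EFinP; exact: measurable_tricomi_density.
  + by move=> t _; rewrite lee_fin tricomi_density_ge0.
  + by move=> t; rewrite /= !in_itv/= !andbT; exact: lt_trans.
Qed.

Lemma tricomi_int_succ p nu z : 0 <= p -> 0 < z ->
  tricomi_int (p + 1) nu z = tricomi_int p (nu + 1) z - tricomi_int p nu z.
Proof.
move=> p0 z0; rewrite /tricomi_int -RintegralB//; last 2 first.
- exact: integrable_tricomi.
- exact: integrable_tricomi.
have e (t : R) : 0 < t -> tricomi_density (p + 1) nu z t =
    tricomi_density p (nu + 1) z t - tricomi_density p nu z t.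
  by move=> t0; rewrite /tricomi_density !powR_succ ?addr_gt0//; ring.
by apply: eq_Rintegral => t /set_mem; rewrite /= in_itv/= andbT => /e ->.
Qed.

Lemma is_derive_tricomi_int p nu z : 0 <= p -> 0 < z ->
  is_derive z 1 (tricomi_int p nu) (- tricomi_int (p + 1) nu z).
Proof.
move=> p0 z0; have p10 : 0 <= p + 1 by rewrite addr_ge0.
have z20 : 0 < z / 2 by rewrite divr_gt0.
pose f (x t : R) := tricomi_density p nu x t.
have df (x t : R) : 0 < t -> is_derive x 1 (fun x => f x t) (- tricomi_density (p + 1) nu x t).
  move=> t0; rewrite /f /tricomi_density; apply: is_derive_eq; rewrite /GRing.scale/=.
  by rewrite powR_succ//; ring.
have zin : `]z / 2, z + 1[%classic z by rewrite /= in_itv/=; apply/andP; split; lra.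
have xpos x : `]z / 2, z + 1[%classic x -> 0 < x.
  by rewrite /= in_itv/= => /andP[]; lra.
have intf x : `]z / 2, z + 1[%classic x -> mu.-integrable `]0, +oo[ (EFin \o f x).
  by move=> /xpos x0; exact: integrable_tricomi.
have derf x t : `]z / 2, z + 1[%classic x -> `]0, +oo[%classic t -> derivable (f ^~ t) x 1.
  by rewrite /= !in_itv/= andbT => _ t0; have [] := df x t t0.
pose G (t : R) := tricomi_density (p + 1) nu (z / 2) t.
have G0 t : 0 <= G t by exact: tricomi_density_ge0.
have iG : mu.-integrable `]0, +oo[ (EFin \o G) by exact: integrable_tricomi.
have Gub x t : `]z / 2, z + 1[%classic x -> `]0, +oo[%classic t -> `|partial1of2 f x t| <= G t.
  rewrite /= !in_itv/= andbT => /andP[x1 _] t0.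
  have d := df x t t0; rewrite /partial1of2 derive1E derive_val normrN.
  rewrite ger0_norm ?tricomi_density_ge0// /G /tricomi_density -!mulrA.
  by rewrite ler_wpM2r ?mulr_ge0 ?powR_ge0// ler_expR lerN2 mulrA ler_pM2r// ltW.
have H := @cvg_differentiation_under_integral _ _ _ mu f _ _ z _ _ zin intf derf G G0 iG Gub.
have {}H := H (measurable_itv _).
have E : \int[mu]_(t in `]0, +oo[) partial1of2 f z t = - tricomi_int (p + 1) nu z.
  rewrite -mulN1r /tricomi_int -RintegralZl//; last exact: integrable_tricomi.
  apply: eq_Rintegral => t /set_mem; rewrite /= in_itv/= andbT => t0.
  by have d := df z t t0; rewrite /partial1of2 derive1E derive_val mulN1r.
rewrite E in H.
have H' : h^-1 *: ((tricomi_int p nu \o shift z) (h *: 1) - tricomi_int p nu z)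
    @[h --> 0^'] --> - tricomi_int (p + 1) nu z.
  by under eq_fun do rewrite /= /GRing.scale/= mulr1; exact: H.
apply: DeriveDef; first by apply: cvgP H'.
by apply: cvg_lim H'.
Qed.

Lemma Rintegral_cvg_oy (f : R -> R) : mu.-integrable `]0, +oo[ (EFin \o f) ->
  \int[mu]_(t in `]0, k.+1%:R[) f t @[k --> \oo] --> \int[mu]_(t in `]0, +oo[) f t.
Proof.
move=> iF; rewrite /Rintegral; apply: fine_cvg; rewrite fineK; last exact: integrable_fin_num.
have E k : (\int[mu]_(t in `]0%R, k.+1%:R[) (f t)%:E =
    \int[mu]_(t in `]0%R, +oo[) ((EFin \o f) \_ `]0%R, k.+1%:R[) t)%E.
  rewrite -integral_mkcondr setIidr// => t /=.
  by rewrite !in_itv/= andbT => /andP[].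
under eq_fun do rewrite E.
apply: (@dominated_cvg _ _ _ mu _ _ (fun k t => ((EFin \o f) \_ `]0%R, k.+1%:R[) t) _
   (fun t => `|(EFin \o f) t|%E)) => //.
- move=> k; apply/(measurable_restrict _ _ _).1 => //.
  by apply: measurable_funS (measurable_int _ iF) => // t [].
- move=> t; rewrite /= in_itv/= andbT => t0.
  have ct : (fun=> (f t)%:E) k @[k --> \oo] --> (f t)%:E by exact: cvg_cst.
  apply: cvg_trans ct; apply: near_eq_cvg; near=> k.
  rewrite patchE mem_set//= in_itv/= t0/=.
  near: k; have [k0 _ Hk] := nbhs_infty_gtr t; exists k0 => // k /= kk0.
  by apply: (lt_trans (Hk k kk0)); rewrite ltr_nat.
- exact: integrable_abse.
- move=> k t _; rewrite patchE; case: ifPn => // _.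
  by rewrite abse0.
Unshelve. all: by end_near. Qed.

Lemma tricomi_density_cvg0 (p nu z : R) : 0 <= p -> 0 < z ->
  tricomi_density p nu z k.+1%:R @[k --> \oo] --> 0.
Proof.
move=> p0 z0; have z20 : 0 < z / 2 by rewrite divr_gt0.
have [K K0 HK] := powR_le_expR nu p0 z20.
have cb : K / (z / 2) * k.+1%:R^-1 @[k --> \oo] --> 0.
  rewrite -[X in _ --> X](mulr0 (K / (z / 2))).
  by apply: cvgM; [exact: cvg_cst|exact: cvg_harmonic].
apply: (@squeeze_cvgr _ _ _ _ (fun=> 0) (fun k => K / (z / 2) * k.+1%:R^-1)) => //; last exact: cvg_cst.
near=> k; rewrite tricomi_density_ge0/=.
set t : R := k.+1%:R; have t0 : 0 < t by [].
have h := HK t (ltW t0).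
have -> : tricomi_density p nu z t = expR (- (z * t)) * (t `^ p * (1 + t) `^ nu).
  by rewrite /tricomi_density mulrA.
apply: (@le_trans _ _ (expR (- (z * t)) * (K * expR (z / 2 * t)))).
  by rewrite ler_wpM2l ?expR_ge0.
rewrite [leLHS]mulrCA -expRD -[leRHS]mulrA ler_pM2l// -invfM.
have -> : - (z * t) + z / 2 * t = - (z / 2 * t) by field.
rewrite expRN lef_pV2 ?posrE ?expR_gt0// ?mulr_gt0//.
by apply: le_trans (expR_ge1Dx _); rewrite lerDr.
Unshelve. all: by end_near. Qed.

Let integrableZ c p nu z : 0 <= p -> 0 < z ->
  mu.-integrable `]0, +oo[ (EFin \o (fun t => c * tricomi_density p nu z t)).
Proof.
move=> p0 z0; have i1 := integrable_tricomi nu p0 z0.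
have i2 : mu.-integrable `]0, +oo[ (fun t => (c%:E * (tricomi_density p nu z t)%:E)%E).
  exact: integrableZl.
exact: eq_integrable i2.
Qed.

Let integrable_add (f g : R -> R) : mu.-integrable `]0, +oo[ (EFin \o f) ->
  mu.-integrable `]0, +oo[ (EFin \o g) ->
  mu.-integrable `]0, +oo[ (EFin \o (fun t => f t + g t)).
Proof.
move=> i1 i2; have i : mu.-integrable `]0, +oo[ (fun t => ((f t)%:E + (g t)%:E)%E).
  exact: integrableD.
exact: eq_integrable i.
Qed.

Lemma tricomi_by_parts p nu z : 0 <= p -> 0 < z ->
  z * tricomi_int (p + 1) nu z = (p + 1) * tricomi_int p nu z
    + nu * tricomi_int (p + 1) (nu - 1) z.
Proof.
move=> p0 z0; have p10 : 0 <= p + 1 by rewrite addr_ge0.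
pose F := tricomi_density (p + 1) nu z.
pose f t := - z * tricomi_density (p + 1) nu z t + (p + 1) * tricomi_density p nu z t
  + nu * tricomi_density (p + 1) (nu - 1) z t.
have i1 := integrableZ (- z) nu p10 z0; have i2 := integrableZ (p + 1) nu p0 z0.
have i3 := integrableZ nu (nu - 1) p10 z0.
have i12 := integrable_add i1 i2.
have iF : mu.-integrable `]0, +oo[ (EFin \o f) by exact: integrable_add.
have fE : \int[mu]_(t in `]0, +oo[) f t = - z * tricomi_int (p + 1) nu z
    + (p + 1) * tricomi_int p nu z + nu * tricomi_int (p + 1) (nu - 1) z.
  rewrite /f !RintegralD// !RintegralZl//; exact: integrable_tricomi.
have dF (t : R) : 0 < t -> is_derive t 1 F (f t).
  move=> t0; have t10 : 0 < 1 + t by rewrite addr_gt0.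
  have := is_derive_tricomi_density (p + 1) nu z t0.
  suff -> : tricomi_density (p + 1) nu z t * (- z + (p + 1) / t + nu / (1 + t)) = f t by [].
  rewrite /f /tricomi_density powR_succ//.
  have -> : (1 + t) `^ nu = (1 + t) * (1 + t) `^ (nu - 1) by rewrite -powR_succ// subrK.
  by field; rewrite (lt0r_neq0 t0) (lt0r_neq0 t10).
have cf (t : R) : 0 < t -> {for t, continuous f}.
  move=> t0; have d1 := @tricomi_density_continuous (p + 1) nu z t t0.
  have d2 := @tricomi_density_continuous p nu z t t0.
  have d3 := @tricomi_density_continuous (p + 1) (nu - 1) z t t0.
  by apply: cvgD; first apply: cvgD; apply: cvgM => //; exact: cvg_cst.
have F0 : F t @[t --> 0^'+] --> 0.
  have c1 : {for 0, continuous (fun t : R => (1 + t) `^ nu)}.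
    have dt : is_derive (0 : R) 1 (fun t : R => 1 + t) 1.
      by apply: is_derive_eq; rewrite add0r ?mulr1.
    have x0 : 0 < 1 + 0 :> R by rewrite addr0.
    have d2 := @is_derive1_comp _ (fun x : R => x `^ nu) (fun t : R => 1 + t) 0 _ _
      (is_derive_powR nu x0) dt.
    exact: (@is_derive_continuous _ ((fun x : R => x `^ nu) \o (fun t : R => 1 + t)) _ _ d2).
  have z1 : expR (- (z * 0)) * 0 * (1 + 0) `^ nu = 0 by rewrite mulr0 mul0r.
  rewrite -[X in _ --> X]z1; apply: cvgM.
    apply: cvgM; first by apply: cvg_at_right_filter; exact: continuous_expRNM.
    by apply: powR_cvg0; rewrite ltr_wpDl.
  exact: cvg_at_right_filter.
have fk k : \int[mu]_(t in `]0, k.+1%:R[) f t = F k.+1%:R.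
  have k0 : 0 < k.+1%:R :> R by [].
  have ik : mu.-integrable `]0, k.+1%:R[ (EFin \o f).
    apply: integrableS iF => // t; rewrite /= !in_itv/= andbT.
    by move=> /andP[].
  have cfk (x : R) : 0 < x < k.+1%:R -> {for x, continuous f} by move=> /andP[/cf].
  have [G dG [G0 Gk]] := primitive_oo k0 ik cfk.
  have := @derive_eq_increment _ G F f 0 k.+1%:R 0 _ 0 (F k.+1%:R) k0 _ G0 Gk F0 _.
  rewrite !subr0; apply.
    by move=> x xk; split; [exact: dG|apply: dF; case/andP: xk].
  by apply: cvg_at_left_filter; apply: is_derive_continuous (dF _ k0).
have L1 := Rintegral_cvg_oy iF.
have L2 : \int[mu]_(t in `]0, k.+1%:R[) f t @[k --> \oo] --> 0.
  by under eq_fun do rewrite fk; exact: tricomi_density_cvg0.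
have : \int[mu]_(t in `]0, +oo[) f t = 0 by exact: cvg_unique L1 L2.
by rewrite fE; lra.
Qed.

Lemma GammaE p : Gamma (p + 1) = tricomi_int p 0 (1 : R).
Proof.
by apply: eq_Rintegral => t _; rewrite /tricomi_density powRr0 mulr1 mul1r mulrC addrK.
Qed.

Lemma Gamma_gt0 p : 0 <= p -> 0 < Gamma (p + 1).
Proof. by move=> p0; rewrite GammaE tricomi_int_gt0. Qed.

Lemma Gamma_succ p : 0 <= p -> Gamma (p + 2) = (p + 1) * Gamma (p + 1).
Proof.
move=> p0; have -> : p + 2 = p + 1 + 1 by ring.
rewrite !GammaE.
by have := tricomi_by_parts 0 p0 ltr01; rewrite mul1r mul0r addr0.
Qed.

Lemma TricomiU_int q be z : TricomiU (q + 1) be z =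
  (Gamma (q + 1))^-1 * tricomi_int q (be - (q + 1) - 1) z.
Proof.
by congr (_ * _); apply: eq_Rintegral => t _; rewrite /tricomi_density addrK.
Qed.

Lemma TricomiU_gt0 q be z : 0 <= q -> 0 < z -> 0 < TricomiU (q + 1) be z.
Proof.
by move=> q0 z0; rewrite TricomiU_int mulr_gt0 ?invr_gt0 ?Gamma_gt0 ?tricomi_int_gt0.
Qed.

Lemma K2_pair (lam q : R) : 0 <= q ->
  harmonic_pair lam q (fun z => lam * K2 q (q + lam) z) (K2 q (q + lam + 1)).
Proof.
move=> q0; set n := q + lam; move=> z z0.
pose G := Gamma (q + 1).
pose T0 := tricomi_int q (lam - 1); pose T1 := tricomi_int q lam.
have E0 : K2 q n = fun z => z `^ n * expR (- z) * (G^-1 * T0 z).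
  apply/funext => u; rewrite /K2 TricomiU_int -/G /T0.
  by have -> : n + 1 - (q + 1) - 1 = lam - 1 by rewrite /n; ring.
have E1 : K2 q (n + 1) = fun z => z `^ (n + 1) * expR (- z) * (G^-1 * T1 z).
  apply/funext => u; rewrite /K2 TricomiU_int -/G /T1.
  by have -> : n + 1 + 1 - (q + 1) - 1 = lam by rewrite /n; ring.
have d0 : is_derive z 1 T0 (T0 z - T1 z).
  have := is_derive_tricomi_int (lam - 1) q0 z0.
  by rewrite tricomi_int_succ// opprB subrK.
have d1 : is_derive z 1 T1 ((lam * T0 z - (n + 1) * T1 z) / z).
  have := is_derive_tricomi_int lam q0 z0.
  suff -> : - tricomi_int (q + 1) lam z = (lam * T0 z - (n + 1) * T1 z) / z by [].
  apply: (mulIf (lt0r_neq0 z0)); rewrite divfK ?lt0r_neq0//.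
  have := tricomi_by_parts lam q0 z0.
  rewrite (tricomi_int_succ (lam - 1) q0 z0) subrK -/T0 -/T1 /n.
  by lra.
have p1 := is_derive_powR n z0; have p2 := is_derive_powR (n + 1) z0.
have zn := lt0r_neq0 z0; have Gn : G != 0 := lt0r_neq0 (Gamma_gt0 q0).
rewrite E0 E1; split; apply: is_derive_eq; rewrite /GRing.scale/= (powR_succ _ z0).
  by field; rewrite zn Gn.
by rewrite -/n; field; rewrite zn Gn.
Qed.

Lemma tricomi_scaling p z : 0 <= p -> 0 < z -> z `^ (p + 1) * tricomi_int p 0 z = Gamma (p + 1).
Proof.
move=> p0 z0; pose F (z : R) := z `^ (p + 1) * tricomi_int p 0 z.
have dF (u : R) : 0 < u -> is_derive u 1 F 0.
  move=> u0; have d1 := is_derive_tricomi_int 0 p0 u0.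
  have d2 := is_derive_powR (p + 1) u0.
  have := tricomi_by_parts 0 p0 u0; rewrite mul0r addr0 => e.
  rewrite /F; apply: is_derive_eq; rewrite /GRing.scale/=.
  apply: (mulIf (lt0r_neq0 u0)); rewrite mul0r.
  have -> : (u `^ (p + 1) * - tricomi_int (p + 1) 0 u +
    tricomi_int p 0 u * ((p + 1) * u `^ (p + 1) / u)) * u =
    u `^ (p + 1) * ((p + 1) * tricomi_int p 0 u * (u / u) - u * tricomi_int (p + 1) 0 u) by ring.
  by rewrite divff ?lt0r_neq0// mulr1 e subrr mulr0.
have le_F (x y : R) : 0 < x -> x <= y -> F x = F y.
  move=> x0 xy; apply/eqP; rewrite eq_le; apply/andP; split.
    apply: (@is_derive_ge0_le _ F (fun=> 0) _ _ xy) => // w /andP[xw _].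
    exact: dF (lt_le_trans x0 xw).
  rewrite -lerN2; apply: (@is_derive_ge0_le _ (fun x => - F x) (fun=> 0) _ _ xy) => // w /andP[xw _].
  by have d := dF w (lt_le_trans x0 xw); apply: is_derive_eq; rewrite oppr0.
rewrite -/(F z) GammaE.
have -> : tricomi_int p 0 1 = F 1 by rewrite /F powR1 mul1r.
by have [z1|z1] := leP z 1; [exact: le_F|apply/esym/le_F => //; exact: ltW].
Qed.

Lemma tricomi_cvg0 (q lam : R) : 0 <= q -> 0 < lam ->
  z `^ (q + lam + 1) * tricomi_int q lam z @[z --> 0^'+] --> Gamma (q + lam + 1).
Proof.
move=> q0 lam0; pose n := q + lam; have n0 : 0 < n by rewrite ltr_wpDl.
have G0 := Gamma_gt0 (ltW n0); set G := Gamma (n + 1) in G0 *.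
have lower (z : R) : 0 < z -> G <= z `^ (n + 1) * tricomi_int q lam z.
  move=> z0; rewrite /G -(tricomi_scaling (ltW n0) z0) ler_wpM2l ?powR_ge0//.
  have bd (t : R) : 0 < t -> tricomi_density n 0 z t <= tricomi_density q lam z t.
    move=> t0; rewrite /tricomi_density powRr0 mulr1 -mulrA ler_wpM2l ?expR_ge0//.
    rewrite /n powRD ?(lt0r_neq0 t0) ?implybT// ler_wpM2l ?powR_ge0//.
    have t10 : 0 <= 1 + t by rewrite addr_ge0// ltW.
    by apply: (ge0_ler_powR (ltW lam0)); rewrite ?nnegrE ?lerDr// ltW.
  apply: le_Rintegral => //; [exact: integrable_tricomi (ltW n0) z0|exact: integrable_tricomi|].
  by move=> t; rewrite /= in_itv/= andbT; exact: bd.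
have upper (del z : R) : 0 < del -> 0 < z -> z `^ (n + 1) * tricomi_int q lam z <=
    (1 + del) `^ lam * G + (del^-1 `^ q * (1 + del^-1) `^ lam) * z `^ n.
  move=> d0 z0; set Kd := _ `^ q * _.
  have Kd0 : 0 <= Kd by rewrite mulr_ge0 ?powR_ge0.
  have bd (t : R) : 0 < t -> tricomi_density q lam z t <=
      (1 + del) `^ lam * tricomi_density n 0 z t + Kd * expR (- (z * t)).
    move=> t0; rewrite /tricomi_density powRr0 mulr1.
    rewrite [leRHS](_ : _ = expR (- (z * t)) * ((1 + del) `^ lam * t `^ n + Kd)); last by ring.
    rewrite -mulrA ler_wpM2l ?expR_ge0//.
    have [h|h] := leP 1 (del * t).
      apply: ler_wpDr => //; rewrite /n powRD ?(lt0r_neq0 t0) ?implybT//.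
      have d10 : 0 <= 1 + del by rewrite addr_ge0// ltW.
      rewrite [leRHS]mulrCA ler_wpM2l ?powR_ge0// -powRM ?(ltW t0)//.
      have t10 : 0 <= 1 + t by rewrite addr_ge0// ltW.
      apply: (ge0_ler_powR (ltW lam0)); rewrite ?nnegrE ?mulr_ge0 ?(ltW t0)//.
      by rewrite mulrDl mul1r addrC lerD2l.
    apply: ler_wpDl; first by rewrite mulr_ge0 ?powR_ge0.
    have td : t <= del^-1 by rewrite -[leRHS]mul1r ler_pdivlMr// mulrC ltW.
    have di : 0 <= del^-1 by rewrite invr_ge0 ltW.
    apply: ler_pM; rewrite ?powR_ge0//.
      by apply: ge0_ler_powR; rewrite ?nnegrE// ltW.
    have t10 : 0 <= 1 + t by rewrite addr_ge0// ltW.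
    have d10 : 0 <= 1 + del^-1 by rewrite addr_ge0.
    by apply: (ge0_ler_powR (ltW lam0)); rewrite ?nnegrE ?lerD2l.
  have iE := integrable_exp Kd z0.
  have iT := integrableZ ((1 + del) `^ lam) 0 (ltW n0) z0.
  have E2 : \int[mu]_(t in `]0, +oo[) (Kd * expR (- (z * t))) = Kd / z.
    have <- : \int[mu]_(t in `]0, +oo[) ((Kd / z) * (z * expR (- (z * t)))) =
        \int[mu]_(t in `]0, +oo[) (Kd * expR (- (z * t))).
      by apply: eq_Rintegral => t _; rewrite mulrA divfK ?lt0r_neq0.
    rewrite RintegralZl//; last exact: integrable_exp.
    by rewrite /Rintegral exp_tail// mulr0 oppr0 expR0 mulr1.
  have : tricomi_int q lam z <= (1 + del) `^ lam * tricomi_int n 0 z + Kd / z.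
    rewrite -E2 /tricomi_int -RintegralZl//; last exact: integrable_tricomi (ltW n0) z0.
    rewrite -RintegralD//.
    apply: le_Rintegral => //; [exact: integrable_tricomi|exact: integrable_add|].
    by move=> t; rewrite /= in_itv/= andbT; exact: bd.
  move=> /(ler_wpM2l (powR_ge0 z (n + 1))) /le_trans; apply.
  have sc : z `^ (n + 1) * tricomi_int n 0 z = G := tricomi_scaling (ltW n0) z0.
  rewrite mulrDr [X in X + _]mulrCA sc lerD2l (powR_succ n z0).
  have -> : z * z `^ n * (Kd / z) = Kd * z `^ n * (z / z) by ring.
  by rewrite divff ?lt0r_neq0// mulr1.
apply/cvgrPdist_le => e e0.
have cd : (1 + del) `^ lam * G @[del --> 0^'+] --> (1 + 0) `^ lam * G.
  apply: cvgM; last exact: cvg_cst.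
  have dt : is_derive (0 : R) 1 (fun t : R => 1 + t) 1.
    by apply: is_derive_eq; rewrite add0r ?mulr1.
  have x0 : 0 < 1 + 0 :> R by rewrite addr0.
  have d2 := @is_derive1_comp _ (fun x : R => x `^ lam) (fun t : R => 1 + t) 0 _ _
    (is_derive_powR lam x0) dt.
  apply: cvg_at_right_filter.
  exact: (@is_derive_continuous _ ((fun x : R => x `^ lam) \o (fun t : R => 1 + t)) _ _ d2).
have e20 : 0 < e / 2 by rewrite divr_gt0.
have [del [d0 Hd]] : exists del : R, 0 < del /\ (1 + del) `^ lam * G <= G + e / 2.
  have G1 : (1 + 0) `^ lam * G < G + e / 2 by rewrite addr0 powR1 mul1r ltrDl.
  have H2 : \forall x \near 0^'+, (1 + x) `^ lam * G < G + e / 2 by exact: cvgr_lt cd _ G1.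
  have H1 : \forall x \near (0 : R)^'+, 0 < x by exact: nbhs_right_gt.
  by have [del [d0 /ltW dG]] := filter_ex (filterI H1 H2); exists del.
have cz : (del^-1 `^ q * (1 + del^-1) `^ lam) * z `^ n @[z --> 0^'+] --> 0.
  rewrite -[X in _ --> X](mulr0 (del^-1 `^ q * (1 + del^-1) `^ lam)).
  by apply: cvgM; [exact: cvg_cst|exact: powR_cvg0].
have Hz : \forall z \near 0^'+, (del^-1 `^ q * (1 + del^-1) `^ lam) * z `^ n < e / 2.
  exact: cvgr_lt cz _ e20.
near=> z; have z0 : 0 < z by near: z; exact: nbhs_right_gt.
have h1 := lower z z0; have h2 := upper del z d0 z0.
have h3 : (del^-1 `^ q * (1 + del^-1) `^ lam) * z `^ n < e / 2 by near: z; exact: Hz.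
rewrite -/n -/G ler_norml; apply/andP; split; lra.
Unshelve. all: by end_near. Qed.

End tricomi.

(** * Closed forms *)

Section K2_facts.
Context {R : realType}.
Notation mu := (@lebesgue_measure R).
Variables (lam q : R).
Hypotheses (lam_gt0 : 0 < lam) (q_ge0 : 0 <= q).
Let n := q + lam.
Let n_gt0 : 0 < n. Proof. by rewrite ltr_wpDl. Qed.

Lemma TricomiU_le_inv nu : exists2 K : R, 0 < K &
  forall z, 1 < z -> tricomi_int q nu z <= K / (z - 1).
Proof.
have [K K0 HK] := powR_le_expR nu q_ge0 ltr01; exists K => // z z1.
have z10 : 0 < z - 1 by rewrite subr_gt0.
have E : \int[mu]_(t in `]0, +oo[) (K * expR (- ((z - 1) * t))) = K / (z - 1).
  have <- : \int[mu]_(t in `]0, +oo[) ((K / (z - 1)) * ((z - 1) * expR (- ((z - 1) * t)))) =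
      \int[mu]_(t in `]0, +oo[) (K * expR (- ((z - 1) * t))).
    by apply: eq_Rintegral => t _; rewrite mulrA divfK ?lt0r_neq0.
  rewrite RintegralZl//; last exact: integrable_exp.
  by rewrite /Rintegral exp_tail// mulr0 oppr0 expR0 mulr1.
have bd (t : R) : 0 < t -> tricomi_density q nu z t <= K * expR (- ((z - 1) * t)).
  move=> t0; have -> : expR (- ((z - 1) * t)) = expR (- (z * t)) * expR (1 * t).
    by rewrite -expRD; congr expR; ring.
  by rewrite /tricomi_density -mulrA [leRHS]mulrCA ler_wpM2l ?expR_ge0// HK// ltW.
rewrite -E; apply: le_Rintegral => //.
- exact: integrable_tricomi (lt_trans ltr01 z1).
- exact: integrable_exp.
- by move=> t; rewrite /= in_itv/= andbT; exact: bd.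
Qed.

Lemma K2_int z : K2 q n z = z `^ n * expR (- z) * ((Gamma (q + 1))^-1 * tricomi_int q (lam - 1) z).
Proof.
rewrite /K2 TricomiU_int; have -> // : n + 1 - (q + 1) - 1 = lam - 1.
by rewrite /n; ring.
Qed.

Lemma K2_succ_int z : K2 q (n + 1) z =
  z `^ (n + 1) * expR (- z) * ((Gamma (q + 1))^-1 * tricomi_int q lam z).
Proof.
rewrite /K2 TricomiU_int; have -> // : n + 1 + 1 - (q + 1) - 1 = lam.
by rewrite /n; ring.
Qed.

Lemma K2_gt0 m z : 0 < z -> 0 < K2 q m z.
Proof.
move=> z0; apply: mulr_gt0; last exact: TricomiU_gt0.
by rewrite mulr_gt0 ?powR_gt0 ?expR_gt0.
Qed.

Lemma K2_cvg0 z : 0 < z -> K2 q n (z + k.+1%:R) @[k --> \oo] --> 0.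
Proof.
move=> z0; have [K K0 HK] := TricomiU_le_inv (lam - 1).
have h20 : 0 < 2^-1 :> R by rewrite invr_gt0.
have [K' K'0 HK'] := powR_le_expR 0 (ltW n_gt0) h20.
have G0 := Gamma_gt0 q_ge0.
pose c := K' * 2 * ((Gamma (q + 1))^-1 * (K / z)).
have cc : c * k.+1%:R^-1 @[k --> \oo] --> 0.
  rewrite -[X in _ --> X](mulr0 c).
  by apply: cvgM; [exact: cvg_cst|exact: cvg_harmonic].
apply: (@squeeze_cvgr _ _ _ _ (fun=> 0) (fun k => c * k.+1%:R^-1)) => //; last exact: cvg_cst.
near=> k; set t : R := k.+1%:R; have t0 : 0 < t by [].
have t1 : 1 <= t by rewrite ler1n.
have zt : 0 < z + t by rewrite addr_gt0.
rewrite (ltW (K2_gt0 n zt))/= K2_int /c.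
have h1 : (z + t) `^ n * expR (- (z + t)) <= K' * 2 / t.
  have := HK' (z + t) (ltW zt); rewrite powRr0 mulr1 => h.
  apply: (@le_trans _ _ (K' * expR (2^-1 * (z + t)) * expR (- (z + t)))).
    by rewrite ler_wpM2r ?expR_ge0.
  rewrite -!mulrA -expRD ler_pM2l//.
  have -> : 2^-1 * (z + t) - (z + t) = - (2^-1 * (z + t)) by field.
  have -> : 2 / t = (2^-1 * t)^-1 by rewrite invfM invrK.
  rewrite expRN lef_pV2 ?posrE ?expR_gt0 ?mulr_gt0//.
  apply: (@le_trans _ _ (1 + 2^-1 * (z + t))); last exact: expR_ge1Dx.
  by move: z0 t0; lra.
have h2 : (Gamma (q + 1))^-1 * tricomi_int q (lam - 1) (z + t) <= (Gamma (q + 1))^-1 * (K / z).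
  rewrite ler_pM2l ?invr_gt0//; apply: le_trans (HK _ _) _; first by move: z0 t1; lra.
  by rewrite ler_pM2l// lef_pV2 ?posrE//; move: z0 t1; lra.
rewrite [leRHS]mulrAC; apply: ler_pM => //.
- by rewrite mulr_ge0 ?powR_ge0 ?expR_ge0.
- by rewrite mulr_ge0 ?invr_ge0 ?(ltW G0)// ltW// tricomi_int_gt0.
Unshelve. all: by end_near. Qed.

Lemma K2_le z : 0 < z -> lam * K2 q n z <= K2 q (n + 1) z.
Proof.
move=> z0; pose k z := lam * K2 q n z; pose L := K2 q (n + 1).
pose D z := z `^ (- n) * expR z * (k z - L z).
have dD (u : R) : 0 < u -> is_derive u 1 D (u `^ (- n) * expR u * (q * L u / u)).
  move=> u0; have [dL dk] := K2_pair lam q_ge0 u0.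
  have d1 := is_derive_powR (- n) u0.
  rewrite /D /k /L; apply: is_derive_eq; rewrite /GRing.scale/= -/n.
  have -> : lam = n - q by rewrite /n; ring.
  by field; exact: lt0r_neq0.
have D_le (x y : R) : 0 < x -> x <= y -> D x <= D y.
  move=> x0 xy; apply: (@is_derive_ge0_le _ D (fun u => u `^ (- n) * expR u * (q * L u / u)) _ _ xy).
    by move=> u /andP[xu _]; exact: dD (lt_le_trans x0 xu).
  move=> u /andP[xu _]; have u0 := lt_le_trans x0 xu.
  have L0 : 0 <= L u by exact/ltW/K2_gt0.
  apply: mulr_ge0; first by rewrite mulr_ge0 ?powR_ge0 ?expR_ge0.
  by apply: divr_ge0; [apply: mulr_ge0|exact: ltW].
have [K K0 HK] := TricomiU_le_inv (lam - 1).
have G0 := Gamma_gt0 q_ge0.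
have D_bd w : 1 < w -> D w <= lam * (Gamma (q + 1))^-1 * K / (w - 1).
  move=> w1; have w0 := lt_trans ltr01 w1.
  apply: (@le_trans _ _ (w `^ (- n) * expR w * k w)).
    by rewrite ler_wpM2l ?mulr_ge0 ?powR_ge0 ?expR_ge0// gerBl ltW// K2_gt0.
  rewrite /k K2_int powRN expRN.
  have -> : (w `^ n)^-1 * expR w * (lam * (w `^ n * (expR w)^-1 *
    ((Gamma (q + 1))^-1 * tricomi_int q (lam - 1) w))) =
    (w `^ n / w `^ n) * (expR w / expR w) * (lam * (Gamma (q + 1))^-1) *
     tricomi_int q (lam - 1) w by ring.
  rewrite !divff ?lt0r_neq0 ?expR_gt0 ?powR_gt0// !mul1r -[leRHS]mulrA.
  by rewrite ler_wpM2l ?HK// mulr_ge0 ?invr_ge0// ltW.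
suff : D z <= 0.
  by rewrite /D pmulr_rle0 ?subr_le0// mulr_gt0 ?powR_gt0 ?expR_gt0.
rewrite leNgt; apply/negP => Dz.
pose c := lam * (Gamma (q + 1))^-1 * K; have c0 : 0 < c by rewrite !mulr_gt0 ?invr_gt0.
pose w := z + 1 + c / D z.
have cD : 0 < c / D z by rewrite divr_gt0.
have w1 : 1 < w by rewrite /w; lra.
have zw : z <= w by rewrite /w; lra.
have := le_trans (D_le _ _ z0 zw) (D_bd w w1).
rewrite -/c ler_pdivlMr ?subr_gt0// => /le_lt_trans /(_ (_ : c < D z * (w - 1))).
rewrite ltxx => H; suff : false by []; apply: H.
have -> : D z * (w - 1) = D z * z + D z * (c / D z) by rewrite /w; ring.
by rewrite [D z * (c / _)]mulrC divfK ?lt0r_neq0// ltrDr mulr_gt0.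
Qed.

Lemma K2_succ_cvg : K2 q (n + 1) z @[z --> 0^'+] --> Gamma (n + 1) / Gamma (q + 1).
Proof.
have G0 := Gamma_gt0 q_ge0.
have c1 : expR (- z) / Gamma (q + 1) @[z --> 0^'+] --> expR (- 0) / Gamma (q + 1).
  by apply: cvgM; [apply: cvg_at_right_filter; exact: continuous_expRN|exact: cvg_cst].
have e1 : Gamma (n + 1) * (expR (- 0) / Gamma (q + 1)) = Gamma (n + 1) / Gamma (q + 1).
  by rewrite oppr0 expR0 mul1r.
have H : z `^ (n + 1) * tricomi_int q lam z * (expR (- z) / Gamma (q + 1)) @[z --> 0^'+] -->
    Gamma (n + 1) * (expR (- 0) / Gamma (q + 1)).
  by apply: cvgM => //; exact: tricomi_cvg0.
rewrite -e1; apply: cvg_trans H; apply: near_eq_cvg; near=> z.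
by rewrite K2_succ_int; ring.
Unshelve. all: by end_near. Qed.

Lemma TricomiU_cvg : (z `^ (q + 1 + lam) * TricomiU (1 + q) (q + 2 + lam) z) @[z --> 0^'+] -->
  Gamma (1 + q + lam) / Gamma (1 + q).
Proof.
have -> : 1 + q + lam = n + 1 by rewrite /n; ring.
rewrite [1 + q]addrC.
have H : z `^ (n + 1) * tricomi_int q lam z / Gamma (q + 1) @[z --> 0^'+] -->
    Gamma (n + 1) / Gamma (q + 1).
  by apply: cvgM; [exact: tricomi_cvg0|exact: cvg_cst].
apply: cvg_trans H; apply: near_eq_cvg; near=> z.
rewrite TricomiU_int; have -> : q + 2 + lam - (q + 1) - 1 = lam by ring.
have -> : q + 1 + lam = n + 1 by rewrite /n; ring.
by ring.
Unshelve. all: by end_near. Qed.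

Opaque TricomiU.

Lemma TricomiU_ratio_le z : 0 < z ->
  0 <= TricomiU (q + 1) (n + 1) z / TricomiU (q + 1) (n + 2) z <= z / lam.
Proof.
move=> z0; have u1 := TricomiU_gt0 (n + 1) q_ge0 z0; have u2 := TricomiU_gt0 (n + 2) q_ge0 z0.
apply/andP; split; first exact: divr_ge0 (ltW u1) (ltW u2).
rewrite (ler_pdivrMr _ _ u2) mulrAC (ler_pdivlMr _ _ lam_gt0) mulrC.
have := K2_le z0; rewrite /K2 (powR_succ _ z0).
have -> : n + 1 + 1 = n + 2 by ring.
have -> : lam * (z `^ n * expR (- z) * TricomiU (q + 1) (n + 1) z) =
  z `^ n * expR (- z) * (lam * TricomiU (q + 1) (n + 1) z) by ring.
have -> : z * z `^ n * expR (- z) * TricomiU (q + 1) (n + 2) z =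
  z `^ n * expR (- z) * (z * TricomiU (q + 1) (n + 2) z) by ring.
by rewrite ler_pM2l// mulr_gt0 ?powR_gt0 ?expR_gt0.
Qed.

Lemma TricomiU_ratio_cvg0 :
  TricomiU (q + 1) (n + 1) z / TricomiU (q + 1) (n + 2) z @[z --> 0^'+] --> 0.
Proof.
apply: (@squeeze_cvgr _ _ _ _ (fun=> 0) (fun z => z / lam)).
- near=> z; apply: TricomiU_ratio_le.
  by near: z; exact: nbhs_right_gt.
- exact: cvg_cst.
- rewrite -[X in _ --> X](mul0r lam^-1); apply: cvgM; last exact: cvg_cst.
  by apply: cvg_at_right_filter; exact: cvg_id.
Unshelve. all: by end_near. Qed.

End K2_facts.

Section closed_forms.
Context {R : realType}.
Variables (lam q : R).
Hypotheses (lam_gt0 : 0 < lam) (q_ge0 : 0 <= q).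
Opaque TricomiU KummerM Gamma.
Let n := q + lam.
Let n_gt0 : 0 < n. Proof. by rewrite ltr_wpDl. Qed.
Let n1_gt0 : 0 < n + 1. Proof. by rewrite addr_gt0. Qed.

(* The values [I a] of the two companions in [K1_pair] and [K2_pair], replaced
   at [a = 0] by their limits. *)
Definition K1_edge a : R := if 0 < a then K1 q (n + 1) a / (n + 1) else 0.
Definition K2_edge a : R :=
  if 0 < a then K2 q (n + 1) a else Gamma (n + 1) / Gamma (q + 1).
Definition scale a z : R := K1 q n z - K1_edge a / K2_edge a * (lam * K2 q n z).

Lemma K1_edge_ge0 a : 0 <= K1_edge a.
Proof.
rewrite /K1_edge; case: ifPn => // a0.
by rewrite divr_ge0 ?ltW// K1_succ_gt0.
Qed.

Lemma K2_edge_gt0 a : 0 < K2_edge a.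
Proof.
rewrite /K2_edge; case: ifPn => [a0|_]; first exact: K2_gt0.
by rewrite divr_gt0 ?Gamma_gt0// ltW.
Qed.

Lemma scale_edge a : 0 < a -> 0 < scale a a.
Proof.
move=> a0; have e1 := K1_edge_ge0 a; have e2 := K2_edge_gt0 a.
have h1 : K1_edge a < K1 q n a by rewrite /K1_edge a0 K1_gt_succ.
have h2 : lam * K2 q n a <= K2_edge a by rewrite /K2_edge a0 K2_le.
rewrite /scale subr_gt0; apply: le_lt_trans h1.
by rewrite mulrAC ler_pdivrMr// ler_wpM2l.
Qed.

Lemma scale_W_closed a z : 0 < a -> scale a z = W_closed q lam a z.
Proof.
move=> a0; rewrite /scale /K1_edge /K2_edge a0 /W_closed -/n.
have h := lt0r_neq0 (K2_gt0 q_ge0 (n + 1) a0); have n1 := lt0r_neq0 n1_gt0.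
by field; rewrite n1 h.
Qed.

Let n2E : n + 1 + 1 = n + 2. Proof. by ring. Qed.

Lemma K_ratio a : 0 < a -> K1 q (n + 1) a / K2 q (n + 1) a =
  KummerM (q + 1) (n + 2) a / TricomiU (q + 1) (n + 2) a.
Proof.
move=> a0; rewrite /K1 /K2 n2E.
have h := lt0r_neq0 (TricomiU_gt0 (n + 2) q_ge0 a0).
have p := lt0r_neq0 (powR_gt0 (n + 1) a0); have e := lt0r_neq0 (expR_gt0 (- a)).
by field; rewrite h p e.
Qed.

Lemma W_closedE a z : 0 < a -> W_closed q lam a z = z `^ n * expR (- z) *
  (KummerM (q + 1) (n + 1) z - lam / (n + 1) * TricomiU (q + 1) (n + 1) z
     * (KummerM (q + 1) (n + 2) a / TricomiU (q + 1) (n + 2) a)).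
Proof. by move=> a0; rewrite /W_closed -/n K_ratio// /K1 /K2; ring. Qed.

Lemma W_detE a z : W_det q lam a z = z `^ n * expR (- z) * D_fun q lam a z.
Proof.
rewrite /W_det /D_fun -/n; congr (_ * _).
rewrite (expand_det_row _ ord0) !big_ord_recl big_ord0 /cofactor !det_mx11 !mxE /=.
have -> : 1 + q = q + 1 by ring.
have -> : lam + 1 + q = n + 1 by rewrite /n; ring.
have -> : lam + 2 + q = n + 2 by rewrite /n; ring.
have -> : lam + q + 1 = n + 1 by rewrite /n; ring.
by rewrite /bump /= expr0 expr1; ring.
Qed.

Lemma W_det_closed a z : 0 < a ->
  W_det q lam a z = (n + 1) * TricomiU (q + 1) (n + 2) a * W_closed q lam a z.
Proof.
move=> a0; rewrite W_detE W_closedE// /D_fun -/n.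
have h := lt0r_neq0 (TricomiU_gt0 (n + 2) q_ge0 a0); have n1 := lt0r_neq0 n1_gt0.
have -> : lam + q + 1 = n + 1 by rewrite /n; ring.
by field; rewrite n1 h.
Qed.

Section derivatives.
Variables (h I : R -> R).
Hypothesis hI : harmonic_pair lam q h I.

Let dh (x : R) : 0 < x -> is_derive x 1 h ((n * h x - lam * I x) / x).
Proof. by move=> /hI[]. Qed.

Let near_derive1 (z : R) : 0 < z ->
  \forall x \near z, (n * h x - lam * I x) / x = derive1 h x.
Proof.
move=> z0; near=> x; have x0 : 0 < x by near: x; exact: lt_nbhsr.
by have d := dh x0; rewrite derive1E derive_val.
Unshelve. all: by end_near. Qed.

Let is_derive_derive1 (z : R) : 0 < z -> is_derive z 1 (derive1 h)
  (((n - 1) * ((n * h z - lam * I z) / z) - lam * (h z - I z)) / z).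
Proof.
move=> z0; apply: near_eq_is_derive (near_derive1 z0) _.
have [dI _] := hI z0; have d := dh z0; have zn := lt0r_neq0 z0.
have dinv : is_derive z 1 (fun x : R => x^-1) (- z ^- 2).
  have := @is_deriveV R (fun x : R => x) z 1 1 zn (is_derive_id z (1 : R)).
  by rewrite /GRing.scale/= mulr1.
by apply: is_derive_eq; rewrite /GRing.scale/=; field.
Qed.

Lemma pair_twice_derivable z : 0 < z -> twice_derivable h z.
Proof.
move=> z0; split; last by have [] := is_derive_derive1 z0.
near=> x; have x0 : 0 < x by near: x; exact: lt_nbhsr.
by have [] := dh x0.
Unshelve. all: by end_near. Qed.

Lemma pair_derive2 z : 0 < z -> derive1n 2 h z =
  ((n - 1) * ((n * h z - lam * I z) / z) - lam * (h z - I z)) / z.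
Proof. by move=> z0; have d := is_derive_derive1 z0; rewrite /= derive1E derive_val. Qed.

End derivatives.

Let K1p : harmonic_pair lam q (K1 q n) (fun z => K1 q (n + 1) z / (n + 1)).
Proof. exact: K1_pair. Qed.

Let K2p : harmonic_pair lam q (K2 q n) (fun z => K2 q (n + 1) z / lam).
Proof.
have H := K2_pair lam q_ge0.
have := pair_lin (1 - lam^-1) H H; rewrite -/n.
have l0 := lt0r_neq0 lam_gt0.
congr (harmonic_pair lam q _ _); apply/funext => x; field; exact: l0.
Qed.

Let Wp a : harmonic_pair lam q (W_closed q lam a) (fun z => K1 q (n + 1) z / (n + 1)
  - lam / (n + 1) * (K1 q (n + 1) a / K2 q (n + 1) a) * (K2 q (n + 1) z / lam)).
Proof. exact: pair_lin K1p K2p. Qed.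

Lemma W_closed_twice_derivable a z : 0 < z ->
  [/\ twice_derivable (K1 q n) z, twice_derivable (K2 q n) z,
      twice_derivable (W_closed q lam a) z &
      derive1n 2 (W_closed q lam a) z = derive1n 2 (K1 q n) z
        - lam / (n + 1) * (K1 q (n + 1) a / K2 q (n + 1) a) * derive1n 2 (K2 q n) z].
Proof.
move=> z0; split.
- exact: pair_twice_derivable K1p _ z0.
- exact: pair_twice_derivable K2p _ z0.
- exact: pair_twice_derivable (@Wp a) _ z0.
- rewrite (pair_derive2 (@Wp a) z0) (pair_derive2 K1p z0) (pair_derive2 K2p z0).
  by rewrite /W_closed -/n; ring.
Qed.

(* The companion of [W_closed q lam a] vanishes at [a]. *)
Lemma W_closed_derive2 a : 0 < a ->
  derive1n 2 (W_closed q lam a) a = ((n - 1) * n - lam * a) / a ^+ 2 * W_closed q lam a a.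
Proof.
move=> a0; rewrite (pair_derive2 (@Wp a) a0).
have h := lt0r_neq0 (K2_gt0 q_ge0 (n + 1) a0); have l0 := lt0r_neq0 lam_gt0.
have n1 := lt0r_neq0 n1_gt0; have an := lt0r_neq0 a0.
have -> : K1 q (n + 1) a / (n + 1) - lam / (n + 1) * (K1 q (n + 1) a / K2 q (n + 1) a)
    * (K2 q (n + 1) a / lam) = 0 by field; rewrite n1 h l0.
by field.
Qed.

Lemma W_closed_normalized_derive2 a : 0 < a ->
  expR a * a `^ (- n + 2) / Gamma (n + 1) * derive1n 2 (W_closed q lam a) a =
  ((n - 1) * n - lam * a) / Gamma (n + 1) * (KummerM (q + 1) (n + 1) a
    - lam / (n + 1) * (TricomiU (q + 1) (n + 1) a / TricomiU (q + 1) (n + 2) a)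
      * KummerM (q + 1) (n + 2) a).
Proof.
move=> a0; rewrite W_closed_derive2// W_closedE//.
have an := lt0r_neq0 a0; have pn := lt0r_neq0 (powR_gt0 n a0).
have G0 := lt0r_neq0 (Gamma_gt0 (ltW n_gt0)).
have -> : a `^ (- n + 2) = a ^+ 2 / a `^ n.
  by rewrite powRD ?an ?implybT// powRN (powR_mulrn 2 (ltW a0)) mulrC.
have u0 := lt0r_neq0 (TricomiU_gt0 (n + 2) q_ge0 a0); have n1 := lt0r_neq0 n1_gt0.
rewrite expRN; have e0 := lt0r_neq0 (expR_gt0 a).
by field; rewrite n1 u0 G0 pn an e0.
Qed.

Lemma W_closed_derive2_formula a : 0 < a ->
  expR a * a `^ (- n + 2) / Gamma (n + 1) * derive1n 2 (W_closed q lam a) a =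
  KummerM_reg (q + 1) (n + 2) a / (n + 1) *
    (lam * (n + 1) * (a * n - a * q - n ^+ 2 + n)
       * TricomiU (q + 1) (n + 1) a / TricomiU (q + 1) (n + 2) a
     + a * (a - n + 1) * ((n + 1) * (n - q) - lam * (n + 1)))
  + (- (a + 1) * n + a * q + n ^+ 2) * KummerM_reg (q + 1) (n + 1) a.
Proof.
move=> a0; rewrite W_closed_normalized_derive2// /KummerM_reg (Gamma_succ (ltW n_gt0)).
have G0 := lt0r_neq0 (Gamma_gt0 (ltW n_gt0)).
have u0 := lt0r_neq0 (TricomiU_gt0 (n + 2) q_ge0 a0); have n1 := lt0r_neq0 n1_gt0.
have qE : a * n - a * q = lam * a /\ n - q = lam by split; rewrite /n; ring.
have gen (u2 u1 m2 m1 G : R) : u2 != 0 -> G != 0 ->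
    ((n - 1) * n - lam * a) / G * (m1 - lam / (n + 1) * (u1 / u2) * m2) =
    m2 / ((n + 1) * G) / (n + 1) *
      (lam * (n + 1) * (a * n - a * q - n ^+ 2 + n) * u1 / u2
        + a * (a - n + 1) * ((n + 1) * (n - q) - lam * (n + 1)))
    + (- (a + 1) * n + a * q + n ^+ 2) * (m1 / G).
  move=> u20 G1; have -> : - (a + 1) * n + a * q + n ^+ 2 = n ^+ 2 - n - (a * n - a * q) by ring.
  by rewrite qE.1 qE.2; field; rewrite n1 u20 G1.
exact: gen.
Qed.

Lemma W_closed_derive2_cvg0 :
  (expR a * a `^ (- n + 2) / Gamma (n + 1) * derive1n 2 (W_closed q lam a) a) @[a --> 0^'+] -->
  (n - 1) * n / Gamma (n + 1).
Proof.
have q1 : 0 < q + 1 by rewrite ltr_wpDl.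
have n2 : 0 < n + 2 by rewrite addr_gt0.
have cM be : 0 < be -> KummerM (q + 1) be a @[a --> 0^'+] --> (1 : R).
  move=> b0; rewrite -[X in _ --> X](KummerM0 q1 b0); apply: cvg_at_right_filter.
  exact: is_derive_continuous (is_derive_KummerM 0 q1 b0).
have c1 : ((n - 1) * n - lam * a) / Gamma (n + 1) @[a --> 0^'+] -->
    ((n - 1) * n - lam * 0) / Gamma (n + 1).
  apply: cvgM; last exact: cvg_cst.
  apply: cvgB; first exact: cvg_cst.
  by apply: cvgM; [exact: cvg_cst|apply: cvg_at_right_filter; exact: cvg_id].
have c2 : KummerM (q + 1) (n + 1) a
    - lam / (n + 1) * (TricomiU (q + 1) (n + 1) a / TricomiU (q + 1) (n + 2) a)
      * KummerM (q + 1) (n + 2) a @[a --> 0^'+] --> 1 - lam / (n + 1) * 0 * 1.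
  apply: cvgB; first exact: cM.
  apply: cvgM; last exact: cM.
  by apply: cvgM; [exact: cvg_cst|exact: TricomiU_ratio_cvg0].
have E : (n - 1) * n / Gamma (n + 1) =
    ((n - 1) * n - lam * 0) / Gamma (n + 1) * (1 - lam / (n + 1) * 0 * 1) by ring.
rewrite E; apply: cvg_trans (cvgM c1 c2); apply: near_eq_cvg; near=> a.
by rewrite W_closed_normalized_derive2//; near: a; exact: nbhs_right_gt.
Unshelve. all: by end_near. Qed.

End closed_forms.

Section passage_functionals.
Context d (T : measurableType d) (R : realType) (P : probability T R).
Variables (lam q : R) (N : R -> T -> nat) (C tau : nat -> {RV P >-> R})
  (X : R -> R -> T -> R).
Hypotheses (lam_gt0 : 0 < lam) (q_ge0 : 0 <= q)
  (tau_exp : forall i, exponential_law lam (tau i))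
  (tau_indep : mutual_independence P
     (fun i => preimage_set_system setT (tau i) measurable))
  (NE : forall (t : R) (w : T) (k : nat), 0 <= t ->
          (k <= N t w)%N = (\sum_(i < k) tau i w <= t))
  (C_exp : forall i, exponential_law 1 (C i))
  (C_indep : independent_marks N C)
  (X_segerdahl : forall z w,
     segerdahl_path 0 1 (fun t => compound N C t w) z (fun t => X z t w)).
Let n := q + lam.
Let n_gt0 : 0 < n. Proof. by rewrite ltr_wpDl. Qed.

Let fin_num_lin (c A B : R) (u v : \bar R) : 0 < A -> 0 <= B -> (0 <= u)%E -> (0 <= v)%E ->
  c%:E = (A%:E * u + B%:E * v)%E -> u \is a fin_num.
Proof.
move=> A0 B0; case: u => [r| |]//= _ v0.
rewrite gt0_muley ?lte_fin// addye//.
by rewrite gt_eqF// (lt_le_trans (ltNyr 0))// mule_ge0// lee_fin.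
Qed.

Let expectation_ge0 (f : T -> R) : (forall w, 0 <= f w) -> (0 <= 'E_P[f])%E.
Proof. by move=> f0; rewrite unlock; apply: integral_ge0 => w _; rewrite lee_fin. Qed.

Let discount_ge0 (t : \bar R) : 0 <= discount q t.
Proof. by case: t => //= r; exact: expR_ge0. Qed.

Lemma passage_values (a b z : R) : 0 <= a -> 0 < z -> a <= z -> z <= b ->
  [/\ 0 < scale lam q a b,
      0 <= scale lam q a z / scale lam q a b <= 1,
      upcross P X q a b z = (scale lam q a z / scale lam q a b)%:E &
      Psi_two_sided P X q b z a = ((lam * K2 q n z
        - scale lam q a z / scale lam q a b * (lam * K2 q n b)) / K2_edge lam q a)%:E].
Proof.
move=> a0 z0 az zb; have b0 : 0 < b := lt_le_trans z0 zb.
set e1 := K1_edge lam q a; set e2 := K2_edge lam q a.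
have e10 : 0 <= e1 by exact: K1_edge_ge0.
have e20 : 0 < e2 by exact: K2_edge_gt0.
have G0 : 0 < Gamma (n + 1) / Gamma (q + 1).
  by rewrite divr_gt0 ?Gamma_gt0// ltW.
have eqs y : 0 < y -> a <= y <= b ->
    (K1 q n y)%:E = ((K1 q n b)%:E * upcross P X q a b y
      + e1%:E * Psi_two_sided P X q b y a)%E /\
    (lam * K2 q n y)%:E = ((lam * K2 q n b)%:E * upcross P X q a b y
      + e2%:E * Psi_two_sided P X q b y a)%E.
  move=> y0 ayb; have ab : a <= b by case/andP: ayb => ? ?; apply: le_trans zb.
  split.
    apply: (@pair_two_sided _ lam q _ _ lam_gt0 q_ge0 (K1_pair lam_gt0 q_ge0) _ _ a b 0 0
      a0 ab b0 (lexx 0) (lexx 0) _ d T P N C tau X tau_exp tau_indep NE C_exp C_indep X_segerdahl y y0 ayb).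
    - by move=> x x0; apply/ltW/K1_gt0.
    - by move=> x x0; rewrite ltW// divr_gt0 ?K1_succ_gt0// addr_gt0.
    - by move=> _; split; [exact: K1_succ_cvg0|rewrite !mulr0].
  apply: (@pair_two_sided _ lam q _ _ lam_gt0 q_ge0 (K2_pair lam q_ge0) _ _ a b
    (lam / n * (Gamma (n + 1) / Gamma (q + 1))) (Gamma (n + 1) / Gamma (q + 1))
    a0 ab b0 _ (ltW G0) _ d T P N C tau X tau_exp tau_indep NE C_exp C_indep X_segerdahl y y0 ayb).
  - by move=> x x0; apply/ltW/mulr_gt0 => //; exact: K2_gt0.
  - by move=> x x0; exact/ltW/K2_gt0.
  - by apply/ltW/mulr_gt0 => //; exact: divr_gt0.
  - move=> _; split; first exact: K2_succ_cvg.
    by rewrite -/n [RHS]mulrA [n * _]mulrC divfK// lt0r_neq0.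
have real y : 0 < y -> a <= y <= b -> exists U V : R,
    [/\ upcross P X q a b y = U%:E, Psi_two_sided P X q b y a = V%:E, 0 <= U, 0 <= V &
        K1 q n y = K1 q n b * U + e1 * V /\ lam * K2 q n y = lam * K2 q n b * U + e2 * V].
  move=> y0 ayb; have [E1 E2] := eqs y y0 ayb.
  have u0 : (0 <= upcross P X q a b y)%E.
    by apply: expectation_ge0 => w /=; rewrite mulr_ge0.
  have v0 : (0 <= Psi_two_sided P X q b y a)%E.
    by apply: expectation_ge0 => w /=; rewrite mulr_ge0.
  have uf := fin_num_lin (K1_gt0 lam_gt0 q_ge0 b0) e10 u0 v0 E1.
  have E2' := E2; rewrite addeC in E2'.
  have kb0 : 0 <= lam * K2 q n b by apply/ltW/mulr_gt0 => //; exact: K2_gt0.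
  have vf := fin_num_lin e20 kb0 v0 u0 E2'.
  exists (fine (upcross P X q a b y)), (fine (Psi_two_sided P X q b y a)).
  split; rewrite ?fineK ?fine_ge0//.
  rewrite -(fineK uf) -(fineK vf) -!EFinM -EFinD in E1 E2.
  by split; [case: E1|case: E2].
have Wrel y U V : K1 q n y = K1 q n b * U + e1 * V ->
    lam * K2 q n y = lam * K2 q n b * U + e2 * V ->
    scale lam q a y = U * scale lam q a b.
  move=> R1 R2; rewrite /scale -/n -/e1 -/e2 R1 R2.
  by field; exact: lt0r_neq0.
have Wb : 0 < scale lam q a b.
  have [a_gt0|a_le0] := ltP 0 a.
    have ab := le_trans az zb.
    have [|U [V [_ _ U0 _ [R1 R2]]]] := real a a_gt0; first by rewrite lexx.
    have := scale_edge lam_gt0 q_ge0 a_gt0; rewrite (Wrel _ _ _ R1 R2).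
    by move=> H; have : 0 < U; [rewrite lt_neqAle U0 andbT; apply/eqP => UE; move: H; rewrite -UE mul0r ltxx|
      move=> U1; move: H; rewrite pmulr_rgt0].
  have an : (0 < a) = false by apply/negbTE; rewrite -leNgt.
  by rewrite /scale /K1_edge an !mul0r subr0; exact: K1_gt0.
have [|U [V [UE VE U0 V0 [R1 R2]]]] := real z z0; first by rewrite az.
have WU := Wrel _ _ _ R1 R2.
have -> : scale lam q a z / scale lam q a b = U by rewrite WU mulfK// lt0r_neq0.
split=> //.
  rewrite U0/=.
  have Kz : K1 q n z <= K1 q n b.
    by move: zb; rewrite le_eqVlt => /orP[/eqP ->//|zb]; apply/ltW/K1_lt.
  have Kb : 0 < K1 q n b by exact: K1_gt0.
  rewrite -(ler_pM2l Kb) mulr1; apply: le_trans Kz.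
  by rewrite R1 lerDl mulr_ge0.
rewrite VE R2; congr (_%:E); field; exact: lt0r_neq0.
Qed.

Lemma Psi_value (a z : R) : 0 <= a -> 0 < z -> a <= z ->
  Psi P X q z a = (lam * K2 q n z / K2_edge lam q a)%:E.
Proof.
move=> a0 z0 az.
have e20 : 0 < K2_edge lam q a by exact: K2_edge_gt0.
have L1 := Psi_limit q_ge0 tau_exp NE C_exp X_segerdahl a0 az.
pose U k := scale lam q a z / scale lam q a (z + k.+1%:R).
have zk k : z <= z + k.+1%:R by rewrite lerDl.
have val k := passage_values a0 z0 az (zk k).
have cU : U k * (lam * K2 q n (z + k.+1%:R)) @[k --> \oo] --> 0.
  have c0 : lam * K2 q n (z + k.+1%:R) @[k --> \oo] --> 0.
    rewrite -[X in _ --> X](mulr0 lam).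
    by apply: cvgM; [exact: cvg_cst|exact: K2_cvg0].
  apply: (@squeeze_cvgr _ _ _ _ (fun=> 0) (fun k => lam * K2 q n (z + k.+1%:R))) => //; last exact: cvg_cst.
  near=> k; have [_ /andP[U0 U1] _ _] := val k.
  have k0 : 0 <= lam * K2 q n (z + k.+1%:R).
    by apply/ltW/mulr_gt0 => //; apply: K2_gt0; rewrite // addr_gt0.
  by rewrite mulr_ge0//= ler_piMl.
have L2 : Psi_two_sided P X q (z + k.+1%:R) z a @[k --> \oo] -->
    (lam * K2 q n z / K2_edge lam q a)%:E.
  have E k : Psi_two_sided P X q (z + k.+1%:R) z a = ((lam * K2 q n z
      - U k * (lam * K2 q n (z + k.+1%:R))) / K2_edge lam q a)%:E.
    by have [_ _ _ ->] := val k.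
  rewrite (eq_cvg _ _ E); apply: cvg_EFin; first exact: nearW.
  have -> : lam * K2 q n z / K2_edge lam q a = (lam * K2 q n z - 0) / K2_edge lam q a.
    by rewrite subr0.
  apply: cvgM; last exact: cvg_cst.
  by apply: cvgB => //; exact: cvg_cst.
exact: cvg_unique L1 L2.
Unshelve. all: by end_near. Qed.

End passage_functionals.

Lemma ratio_unique (R : realType) (D : set R) (W f : R -> R) x0 :
  D x0 -> (forall z, D z -> f z != 0) ->
  (forall z b, D z -> D b -> z <= b -> W z / W b = f z / f b) ->
  exists2 c : R, c != 0 & forall z, D z -> W z = c * f z.
Proof.
move=> D0 f0 H.
have W0 z : D z -> W z != 0.
  move=> Dz; apply/eqP => Wz; have := H z z Dz Dz (lexx z).
  by rewrite Wz mul0r divff ?f0// => /eqP; rewrite eq_sym oner_eq0.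
exists (W x0 / f x0); first by rewrite mulf_neq0 ?invr_eq0 ?W0 ?f0.
move=> z Dz; have [zx|xz] := leP z x0.
  have := H z x0 Dz D0 zx => /(congr1 (fun t => t * W x0)).
  by rewrite divfK ?W0// => ->; ring.
have := H x0 z D0 Dz (ltW xz) => /(congr1 (fun t => t * W z / (f x0 / f z))).
have fz := f0 _ Dz; have fx := f0 _ D0; have Wz := W0 _ Dz.
rewrite divfK// => E; have -> : W x0 / f x0 * f z = W x0 / (f x0 / f z).
  by rewrite invfM invrK; ring.
by rewrite E mulrAC divff ?mul1r// mulf_neq0// invr_eq0.
Qed.

Unset Implicit Arguments.
Set Strict Implicit.
Set Printing Implicit Defensive.

Theorem theorem2 (R : realType) (d : measure_display) (T : measurableType d)
    (P : probability T R) (lam q : R)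
    (N : R -> T -> nat) (C : nat -> {RV P >-> R}) (X : R -> R -> T -> R)
    (lam_gt0 : 0 < lam) (q_ge0 : 0 <= q)
    (N_poisson : poisson_process P lam N)
    (C_exp : forall i, exponential_law 1 (C i))
    (C_indep : independent_marks N C)
    (X_segerdahl : forall z w,
       segerdahl_path 0 1 (fun t => compound N C t w) z (fun t => X z t w)) :
  let n := q + lam in
  (* 1 *)
  [/\ [/\ forall H : R -> R, is_H P X q H <->
            exists2 c : R, c != 0 & forall z, 0 < z -> H z = c * K1 q n z,
          forall z, 0 < z ->
            K1 q n z = z `^ n * expR (- z) * KummerM (q + 1) (n + 1) z /\
            K1 q n z = z `^ n * KummerM lam (n + 1) (- z),
          q_harmonic lam q (K1 q n) /\ increasing_on_pos (K1 q n) &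
          forall h : R -> R, q_harmonic lam q h -> increasing_on_pos h ->
            exists2 c : R, 0 < c & forall z, 0 < z -> h z = c * K1 q n z],
  (* 2 *)
      [/\ forall a z, 0 < a -> a <= z ->
            Psi P X q z a = (lam * (K2 q n z / K2 q (n + 1) a))%:E /\
            Psi P X q z a =
              (lam * ((expR (- z) * z `^ n * TricomiU (q + 1) (n + 1) z) /
                      (expR (- a) * a `^ (n + 1)
                       * TricomiU (q + 1) (n + 2) a)))%:E,
          (z `^ (q + 1 + lam) * TricomiU (1 + q) (q + 2 + lam) z)
            @[z --> 0^'+] --> Gamma (1 + q + lam) / Gamma (1 + q) &
          forall z, 0 < z ->
            Psi P X q z 0 =
              (lam * Gamma (1 + q) / Gamma (1 + q + lam)
               * (expR (- z) * z `^ n * TricomiU (q + 1) (n + 1) z))%:E],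
  (* 3 *)
      (forall theta a z, -1 < theta -> 0 <= a -> a <= z ->
         Psi_theta P X q z a theta = (Psi P X q z a * ((1 + theta)^-1)%:E)%E),
  (* 4 *)
      [/\ forall a, 0 < a ->
            [/\ forall H, is_H P X q H -> is_scale P X q a (W_of P X q H a),
                forall z, a <= z ->
                  [/\ W_of P X q (K1 q n) a z =
                        K1 q n z
                        - fine (Psi P X q z a) * (K1 q (n + 1) a / (n + 1)),
                      W_of P X q (K1 q n) a z = W_closed q lam a z &
                      W_of P X q (K1 q n) a z =
                        z `^ n * expR (- z) *
                        (KummerM (q + 1) (n + 1) z
                         - lam / (n + 1) * TricomiU (q + 1) (n + 1) z
                           * (KummerM (q + 1) (n + 2) a
                              / TricomiU (q + 1) (n + 2) a))],
                forall W, is_scale P X q a W <->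
                  exists2 c : R, c != 0 &
                    forall z, a <= z -> W z = c * W_closed q lam a z,
                is_scale P X q a (W_det q lam a) &
                forall z, a <= z ->
                  W_det q lam a z = z `^ n * expR (- z) *
                    ((lam + q + 1) * KummerM (q + 1) (n + 1) z
                       * TricomiU (q + 1) (n + 2) a
                     - lam * TricomiU (q + 1) (n + 1) z
                       * KummerM (q + 1) (n + 2) a)],
          forall a z, 0 < a -> a <= z ->
            [/\ twice_derivable (K1 q n) z, twice_derivable (K2 q n) z,
                twice_derivable (W_closed q lam a) z &
                derive1n 2 (W_closed q lam a) z =
                  derive1n 2 (K1 q n) z
                  - lam / (n + 1) * (K1 q (n + 1) a / K2 q (n + 1) a)
                    * derive1n 2 (K2 q n) z],
          forall a, 0 < a ->
            expR a * a `^ (- n + 2) / Gamma (n + 1)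
              * derive1n 2 (W_closed q lam a) a =
            KummerM_reg (q + 1) (n + 2) a / (n + 1) *
              (lam * (n + 1) * (a * n - a * q - n ^+ 2 + n)
                 * TricomiU (q + 1) (n + 1) a / TricomiU (q + 1) (n + 2) a
               + a * (a - n + 1) * ((n + 1) * (n - q) - lam * (n + 1)))
            + (- (a + 1) * n + a * q + n ^+ 2) * KummerM_reg (q + 1) (n + 1) a &
          exists2 rho : R,
            (TricomiU (q + 1) (n + 1) u / TricomiU (q + 1) (n + 2) u)
              @[u --> 0^'+] --> rho &
            let W0 := (n - 1) * n * (1 - lam * n * rho / (n + 1) ^+ 2)
                      / Gamma (n + 1) in
            (expR a * a `^ (- n + 2) / Gamma (n + 1)
               * derive1n 2 (W_closed q lam a) a) @[a --> 0^'+] --> W0 /\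
            (W0 < 0 <-> q + lam < 1)] &
  (* 5 *)
      (forall a b z, 0 < a -> a < b -> a <= z -> z <= b ->
         (forall W, is_scale P X q a W ->
            Psi_two_sided P X q b z a =
              (Psi P X q z a - (W z / W b)%:E * Psi P X q b a)%E) /\
         Psi_two_sided P X q b z a =
           (lam / a * ((expR (- z) * z `^ n * TricomiU (q + 1) (n + 1) z) /
                       (expR (- a) * a `^ n * TricomiU (q + 1) (n + 2) a))
            - lam / a * ((expR (- b) * b `^ n * TricomiU (q + 1) (n + 1) b) /
                         (expR (- a) * a `^ n * TricomiU (q + 1) (n + 2) a))
              * ((z / b) `^ n * expR (b - z)
                 * (D_fun q lam a z / D_fun q lam a b)))%:E)].
Proof.
move=> n.
have [tau [tau_exp tau_indep NE]] := N_poisson.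
have n_gt0 : 0 < n by rewrite ltr_wpDl.
have n2E : n + 1 + 1 = n + 2 by ring.
have pv (a b z : R) (a0 : 0 <= a) (z0 : 0 < z) (az : a <= z) (zb : z <= b) :=
  passage_values lam_gt0 q_ge0 tau_exp tau_indep NE C_exp C_indep X_segerdahl a0 z0 az zb.
have psi (a z : R) (a0 : 0 <= a) (z0 : 0 < z) (az : a <= z) :=
  Psi_value lam_gt0 q_ge0 tau_exp tau_indep NE C_exp C_indep X_segerdahl a0 z0 az.
have scale0 z : scale lam q 0 z = K1 q n z.
  by rewrite /scale /K1_edge ltxx !mul0r subr0.
have K1n0 (z : R) : 0 < z -> K1 q n z != 0.
  by move=> z0; rewrite lt0r_neq0// K1_gt0.
have simpl_c (c x y : R) : c != 0 -> c * x / (c * y) = x / y.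
  by move=> c0; rewrite invfM mulrACA divff// mul1r.
have Hchar H : is_H P X q H <->
    exists2 c : R, c != 0 & forall z, 0 < z -> H z = c * K1 q n z.
  split=> [HH|[c c0 Hc] z b z0 zb].
    apply: (@ratio_unique R [set z | 0 < z] H (K1 q n) 1) => //= z b z0 b0 zb.
    have [_ _ E _] := pv 0 b z (lexx 0) z0 (ltW z0) zb.
    by apply: EFin_inj; rewrite -HH// E !scale0.
  have b0 := lt_le_trans z0 zb.
  have [_ _ -> _] := pv 0 b z (lexx 0) z0 (ltW z0) zb.
  by rewrite !scale0 !Hc// simpl_c.
have Wn0 (a z : R) : 0 < a -> a <= z -> W_closed q lam a z != 0.
  move=> a0 az; have z0 := lt_le_trans a0 az.
  have [W0 _ _ _] := pv a z z (ltW a0) z0 az (lexx z).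
  by rewrite -scale_W_closed// lt0r_neq0.
have Wchar (a : R) W : 0 < a -> is_scale P X q a W <->
    exists2 c : R, c != 0 & forall z, a <= z -> W z = c * W_closed q lam a z.
  move=> a0; split=> [HW|[c c0 Hc] z b az zb].
    apply: (@ratio_unique R [set z | a <= z] W (W_closed q lam a) a) => //=.
      by move=> z; exact: Wn0.
    move=> z b az ab zb; have z0 := lt_le_trans a0 az.
    have [_ _ E _] := pv a b z (ltW a0) z0 az zb.
    by apply: EFin_inj; rewrite -HW// E !scale_W_closed.
  have z0 := lt_le_trans a0 az; have ab := le_trans az zb.
  have [_ _ -> _] := pv a b z (ltW a0) z0 az zb.
  by rewrite !scale_W_closed// !Hc// simpl_c.
have K1h : q_harmonic lam q (K1 q n).
  apply: (pair_q_harmonic (K1_pair lam_gt0 q_ge0)); last exact: K1_succ_cvg0.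
  by move=> x x0; apply/ltW/K1_gt0.
have edge (a : R) : 0 < a -> K2_edge lam q a = K2 q (n + 1) a.
  by move=> a0; rewrite /K2_edge a0.
have Wof (a z c : R) H : 0 < a -> a <= z -> (forall z, 0 < z -> H z = c * K1 q n z) ->
    W_of P X q H a z = c * (K1 q n z - fine (Psi P X q z a) * (K1 q (n + 1) a / (n + 1))) /\
    W_of P X q H a z = c * W_closed q lam a z.
  move=> a0 az Hc; have z0 := lt_le_trans a0 az.
  have [_ iK eK] := K1h a a0; have [_ dK] := K1_pair lam_gt0 q_ge0 a0.
  have IE : \int[lebesgue_measure]_(y in `]0, a[) (expR (- y) * H (a - y)) =
      c * (K1 q (n + 1) a / (n + 1)).
    have e (y : R) : 0 < y < a -> expR (- y) * H (a - y) = c * (K1 q n (a - y) * expR (- y)).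
      by move=> /andP[_ ya]; rewrite Hc ?subr_gt0//; ring.
    transitivity (\int[lebesgue_measure]_(y in `]0, a[) (c * (K1 q n (a - y) * expR (- y)))).
      by apply: eq_Rintegral => y /set_mem; rewrite /= in_itv/= => /e ->.
    rewrite RintegralZl//; congr (_ * _).
    move: eK; rewrite derive1E derive_val [a * _]mulrC divfK ?lt0r_neq0// [lam + q]addrC -/n.
    by move=> eK; apply: (mulfI (lt0r_neq0 lam_gt0)); move: eK; lra.
  have E1 : W_of P X q H a z =
      c * (K1 q n z - fine (Psi P X q z a) * (K1 q (n + 1) a / (n + 1))).
    by rewrite /W_of IE Hc//; ring.
  split=> //; rewrite E1 psi ?(ltW a0)//= edge// /W_closed -/n.
  by congr (_ * _); ring.
have Wof1 (a z : R) : 0 < a -> a <= z ->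
    W_of P X q (K1 q n) a z = K1 q n z - fine (Psi P X q z a) * (K1 q (n + 1) a / (n + 1)) /\
    W_of P X q (K1 q n) a z = W_closed q lam a z.
  move=> a0 az; have [|E1 E2] := @Wof a z 1 (K1 q n) a0 az; first by move=> *; rewrite mul1r.
  by rewrite mul1r in E1; rewrite mul1r in E2.
have cn (a : R) : 0 < a -> (n + 1) * TricomiU (q + 1) (n + 2) a != 0.
  by move=> a0; apply/lt0r_neq0/mulr_gt0; [exact: addr_gt0|exact: TricomiU_gt0].
have PsiE (a z : R) : 0 < a -> a <= z -> Psi P X q z a =
    (lam * ((expR (- z) * z `^ n * TricomiU (q + 1) (n + 1) z) /
            (expR (- a) * a `^ (n + 1) * TricomiU (q + 1) (n + 2) a)))%:E.
  move=> a0 az; rewrite psi ?(ltW a0) ?(lt_le_trans a0 az)// edge// /K2 n2E.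
  by congr (_%:E); rewrite !invfM; ring.
split.
- split=> //.
  + by move=> z z0; split=> //; exact: K1_transformation.
  + split=> // x y; rewrite !in_itv/= !andbT => x0 _; exact: K1_lt.
  + move=> h hq hinc; have [I hI I0] := q_harmonic_pair lam_gt0 hq.
    have [|c Hc] := pair_proportional q_ge0 hI (K1_pair lam_gt0 q_ge0) I0 (K1_succ_cvg0 lam_gt0 q_ge0).
      by move=> x x0; rewrite lt0r_neq0// divr_gt0 ?K1_succ_gt0// addr_gt0.
    exists c; last by move=> z /Hc[].
    have h12 : h 1 < h 2 by apply: hinc; rewrite ?in_itv/= ?andbT// ltr1n.
    have k12 : K1 q n 1 < K1 q n 2 by apply: K1_lt => //; rewrite ltr1n.
    have [_ E1] := Hc 1 ltr01; have [|_ E2] := Hc 2; first by [].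
    by move: h12; rewrite E1 E2 -subr_gt0 -mulrBr pmulr_lgt0// subr_gt0.
- split.
  + move=> a z a0 az; split; last exact: PsiE.
    by rewrite psi ?(ltW a0) ?(lt_le_trans a0 az)// edge// mulrA.
  + exact: TricomiU_cvg.
  + move=> z z0; rewrite psi ?(ltW z0)// /K2_edge ltxx -/n.
    have -> : 1 + q + lam = n + 1 by rewrite /n; ring.
    rewrite [1 + q]addrC; congr (_%:E); rewrite /K2 invfM invrK [expR (- z) * _]mulrC.
    by ring.
- by move=> theta a z theta1 a0 az; exact: (Psi_theta_overshoot q_ge0 tau_exp tau_indep NE C_exp C_indep X_segerdahl a0 az theta1).
- split.
  + move=> a a0; split.
    * move=> H /Hchar[c c0 Hc]; apply/(Wchar a _ a0); exists c => // z az.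
      by have [] := Wof a z c H a0 az Hc.
    * move=> z az; have [E1 E2] := Wof1 a z a0 az; split=> //.
      by rewrite E2 W_closedE.
    * by move=> W; exact: Wchar.
    * apply/(Wchar a _ a0); exists ((n + 1) * TricomiU (q + 1) (n + 2) a).
        exact: cn.
      by move=> z _; exact: W_det_closed.
    * by move=> z _; exact: W_detE.
  + by move=> a z a0 az; apply: W_closed_twice_derivable => //; exact: lt_le_trans az.
  + by move=> a a0; exact: W_closed_derive2_formula.
  + exists 0; first exact: TricomiU_ratio_cvg0.
    have G0 : 0 < Gamma (n + 1) by apply: Gamma_gt0; exact: ltW.
    rewrite /= mulr0 mul0r subr0 mulr1; split; first exact: W_closed_derive2_cvg0.
    by rewrite pmulr_llt0 ?invr_gt0// pmulr_llt0// subr_lt0.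
- move=> a b z a0 ab az zb; have z0 := lt_le_trans a0 az; have b0 := lt_le_trans z0 zb.
  have [Wb _ E1 E2] := pv a b z (ltW a0) z0 az zb.
  have EU : Psi_two_sided P X q b z a = (Psi P X q z a
      - (scale lam q a z / scale lam q a b)%:E * Psi P X q b a)%E.
    rewrite E2 !psi ?(ltW a0) ?(ltW ab)// -EFinM -EFinB; congr (_%:E); ring.
  split.
    move=> W HW; rewrite EU; have := HW z b az zb; rewrite E1 => ->.
    by [].
  rewrite EU !PsiE ?(ltW ab)// -EFinM -EFinB; congr (_%:E).
  have -> : scale lam q a z / scale lam q a b = (z / b) `^ n * expR (b - z) *
      (D_fun q lam a z / D_fun q lam a b).
    rewrite !scale_W_closed// -(simpl_c _ _ _ (cn a a0)) -!W_det_closed// !W_detE.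
    have -> : (z / b) `^ n = z `^ n / b `^ n.
      have bi : b^-1 = b `^ (-1) by rewrite powR_inv1// ltW.
      by rewrite powRM ?(ltW z0) ?invr_ge0 ?(ltW b0)// bi -powRrM mulN1r powRN.
    rewrite expRD !expRN !invfM invrK; ring.
  have -> : a `^ (n + 1) = a * a `^ n by rewrite (powR_succ n a0).
  rewrite !invfM; ring.
Qed.
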